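(* Let $f(z)=z+\sum_{n=2}^\infty a_nz^n$ belong to the class $\mathcal{S}_G^{\ast}$, and let $\beta_n$ be its logarithmic coefficients. Then $$|\beta_n|\le\frac{1}{4n}\quad(n=1,2,3,4),$$ and these bounds are sharp.
   Context: Let $\mathcal{U}=\{z\in\mathbb{C}:|z|<1\}$. Let $\mathcal{S}$ denote the class of functions $f$ analytic and univalent in $\mathcal{U}$ normalized by $f(0)=0$, $f'(0)=1$. For analytic $g,h$ on $\mathcal{U}$, $g\prec h$ means there is an analytic $w$ on $\mathcal{U}$ with $w(0)=0$, $|w(z)|<1$, and $g(z)=h(w(z))$. Let $\Psi(z)=\frac{z}{\ln(1+z)}$ on $\mathcal{U}$ (principal branch, $\Psi(0)=1$). Define $\mathcal{S}_G^{\ast}=\{f\in\mathcal{S}: zf'(z)/f(z)\prec\Psi(z)\}$. The logarithmic coefficients $\beta_n$ of $f\in\mathcal{S}$ are defined by $\log\frac{f(z)}{z}=2\sum_{n=1}^\infty\beta_nz^n$ for $z\in\mathcal{U}$ (branch with value $0$ at $z=0$). ''Sharp'' means each bound is attained by some function in $\mathcal{S}_G^{\ast}$. *)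

(* Defs.v *)
From Stdlib Require Import Reals.
From Coquelicot Require Import Coquelicot.

Open Scope C_scope.

Definition inU (z : C) : Prop := (Cmod z < 1)%R.

Definition Cderiv (f : C -> C) (z : C) (l : C) : Prop :=
  @is_derive C_AbsRing C_NormedModule f z l.

Definition analytic_on_U (f : C -> C) : Prop :=
  forall z, inU z -> exists l, Cderiv f z l.

Definition Cexp (z : C) : C :=
  (exp (fst z) * cos (snd z), exp (fst z) * sin (snd z))%R.

(* Principal logarithm on the right half-plane Re w > 0 (where the principal
   argument equals atan (Im w / Re w)).  For z in U, 1 + z lies there. *)
Definition Log_rhp (w : C) : C :=
  (ln (Cmod w), atan (snd w / fst w))%R.

(* Psi(z) = z / ln(1+z), with Psi(0) = 1 (removable singularity). *)
Definition Psi (z : C) : C :=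
  if Req_EM_T (fst z) 0 then
    (if Req_EM_T (snd z) 0 then RtoC 1 else z / Log_rhp (1 + z))
  else z / Log_rhp (1 + z).

Definition in_S (f : C -> C) : Prop :=
  analytic_on_U f /\
  (forall z1 z2, inU z1 -> inU z2 -> f z1 = f z2 -> z1 = z2) /\
  f 0 = 0 /\ Cderiv f 0 1.

Definition subordinate (g h : C -> C) : Prop :=
  exists w : C -> C, analytic_on_U w /\ w 0 = 0 /\
    (forall z, inU z -> (Cmod (w z) < 1)%R) /\
    (forall z, inU z -> g z = h (w z)).

(* z f'(z) / f(z), with its value 1 at z = 0 (removable singularity,
   since f(0) = 0, f'(0) = 1). *)
Definition starlike_quot (f f' : C -> C) (z : C) : C :=
  if Req_EM_T (fst z) 0 then
    (if Req_EM_T (snd z) 0 then RtoC 1 else z * f' z / f z)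
  else z * f' z / f z.

Definition in_SGstar (f : C -> C) : Prop :=
  in_S f /\
  exists f' : C -> C, (forall z, inU z -> Cderiv f z (f' z)) /\
    subordinate (starlike_quot f f') Psi.

(* beta : nat -> C are the logarithmic coefficients of f:
   log (f z / z) = 2 * sum_{n>=1} beta_n z^n on U, with the branch of the
   logarithm that is analytic on U and vanishes at 0.  We express this via
   an analytic g on U with g 0 = 0, exp (g z) = f z / z (i.e. z * exp (g z)
   = f z) and g z = sum_n (2 * beta_n) z^n for all z in U. *)
Definition log_coeffs (f : C -> C) (beta : nat -> C) : Prop :=
  beta 0%nat = 0 /\
  exists g : C -> C, analytic_on_U g /\ g 0 = 0 /\
    (forall z, inU z -> z * Cexp (g z) = f z) /\
    (forall z, inU z -> is_pseries (fun n => 2 * beta n) z (g z)).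

(* Main.v *)
Require Import Defs.
From Stdlib Require Import Reals ZArith Lra Lia.
From Coquelicot Require Import Coquelicot.

(* Let P = z f'/f, so that P = 1 + 2 * sum_n n beta_n z^n = Psi(w) for a Schwarz function w.

   Upper bound.  Psi' does not vanish on the disc, so w' = P'/Psi'(w) is differentiable and
   circle means of w(z) z^(-k) do not depend on the radius; expanding Psi(w) = P at 0 then
   identifies them with the Taylor coefficients of w.  Bessel's inequality makes the lower
   triangular Toeplitz matrix of the first four coefficients of w(z)/z a contraction, and three
   steps of the Schur algorithm write them in terms of parameters of modulus at most 1.  In
   these parameters 4 n beta_n is bounded by 1 by the triangle inequality and a polynomial
   inequality in their moduli.

   Sharpness.  w(z) = z^n gives f(z) = z exp(sum_(k>=1) G_k z^(nk) / (nk)), where the G_k are the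
   Taylor coefficients of Psi.  By Kaluza's theorem sum_(k>=1) |G_k| <= 1, so the exponent is
   1-Lipschitz on the disc, which yields the univalence of f directly. *)

Local Open Scope C_scope.

(** * Complex derivatives and the exponential *)

(** For [w] the hypotheses state only a complex derivative at each point, neither a Taylor series
    nor a continuous derivative, while differentiating a circle mean in the radius calls for
    continuity. The equation Psi(w) = P supplies both, since log(f(z)/z), and hence P, is given as a
    power series. Formal inversion yields candidates d1, ..., d4 for the coefficients of [w], and w
    - (d1 z + ... + d4 z^4) = O(z^5) is a purely local estimate; only then do circle means enter.
    The target 1/(4n) means |2 e_n| <= 1 for the coefficients e_n = 2 n beta_n of P. By 2 (Psi(w) -
    1) = w - w^2/6 + w^3/12 - (19/360) w^4 + ..., each 2 e_n is d_n plus products of earlier d_k.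
    From n = 2 on, |d_k| <= 1 alone is too weak, and the trade-off between the d_k recorded by the
    Schur parameters is needed. That Psi' has no zero comes from Psi = 1/L with L = log(1+z)/z: in
    (1+z) L'(z) the constant term dominates the rest on the open disc. *)

Lemma Cderiv_is_derive (f : C -> C) (z l : C) :
  Cderiv f z l <-> @is_derive C_AbsRing (AbsRing_NormedModule C_AbsRing) f z l.
Proof.
  split; intros [_ H]; (split; [apply is_linear_scal_l | exact H]).
Qed.

Lemma Cderiv_eps (f : C -> C) (z l : C) :
  Cderiv f z l <->
  (forall eps : posreal, exists del : posreal, forall y, (Cmod (y - z) < del)%R ->
     (Cmod (f y - f z - (y - z) * l) <= eps * Cmod (y - z))%R).
Proof.
  split.
  - intros [_ H] eps.
    destruct (H z (fun P HP => HP) eps) as [d Hd].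
    exists d; intros y Hy. exact (Hd y Hy).
  - intros H; split; [apply is_linear_scal_l |].
    intros x Hx eps.
    replace x with z.
    + destruct (H eps) as [d Hd]. exists d. intros y Hy. exact (Hd y Hy).
    + apply (@is_filter_lim_locally_unique C_AbsRing (AbsRing_NormedModule C_AbsRing)) in Hx. exact Hx.
Qed.

Lemma Cderiv_const (c z : C) : Cderiv (fun _ => c) z 0.
Proof. apply Cderiv_is_derive. apply @is_derive_const. Qed.

Lemma Cderiv_id (z : C) : Cderiv (fun x => x) z 1.
Proof. apply Cderiv_is_derive. apply @is_derive_id. Qed.

Lemma Cderiv_plus (f g : C -> C) (z a b : C) :
  Cderiv f z a -> Cderiv g z b -> Cderiv (fun x => f x + g x) z (a + b).
Proof.
  rewrite !Cderiv_is_derive; intros Hf Hg.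
  exact (@is_derive_plus C_AbsRing (AbsRing_NormedModule C_AbsRing) f g z a b Hf Hg).
Qed.

Lemma Cderiv_mult (f g : C -> C) (z a b : C) :
  Cderiv f z a -> Cderiv g z b -> Cderiv (fun x => f x * g x) z (a * g z + f z * b).
Proof.
  rewrite !Cderiv_is_derive; intros Hf Hg.
  exact (is_derive_mult f g z a b Hf Hg Cmult_comm).
Qed.

Lemma Cderiv_comp (f g : C -> C) (z a b : C) :
  Cderiv f (g z) a -> Cderiv g z b -> Cderiv (fun x => f (g x)) z (b * a).
Proof.
  rewrite !Cderiv_is_derive; intros Hf Hg.
  exact (@is_derive_comp C_AbsRing (AbsRing_NormedModule C_AbsRing) f g z a b Hf Hg).
Qed.

Lemma Cderiv_unique (f : C -> C) (z a b : C) : Cderiv f z a -> Cderiv f z b -> a = b.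
Proof.
  intros Ha Hb.
  now rewrite <- (is_C_derive_unique _ _ _ Ha), <- (is_C_derive_unique _ _ _ Hb).
Qed.

Lemma Cderiv_ext_loc (f g : C -> C) (z l : C) (d : posreal) :
  (forall y, (Cmod (y - z) < d)%R -> f y = g y) -> Cderiv f z l -> Cderiv g z l.
Proof.
  rewrite !Cderiv_is_derive; intros H.
  apply is_derive_ext_loc. exists d. intros y Hy. apply H. exact Hy.
Qed.

Lemma Cmod_triangle_rev (x y : C) : (Cmod x - Cmod y <= Cmod (x - y))%R.
Proof.
  generalize (Cmod_triangle (x - y) y). replace (x - y + y) with x by ring. lra.
Qed.

Lemma Cmod_minus_sym (x y : C) : Cmod (x - y) = Cmod (y - x).
Proof. rewrite <- Cmod_opp. f_equal. ring. Qed.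

(** The inverse, the exponential and power series all have a second order remainder with an explicit
    constant, so this test settles their differentiability. *)
Lemma Cderiv_quadratic (f : C -> C) (z l : C) (K : R) (d : posreal) :
  (forall y, (Cmod (y - z) < d)%R ->
     (Cmod (f y - f z - (y - z) * l) <= K * Cmod (y - z) ^ 2)%R) ->
  Cderiv f z l.
Proof.
  intros H. apply Cderiv_eps. intros eps.
  assert (HK : (0 < Rmax K 1)%R) by (apply Rlt_le_trans with 1%R; [lra | apply Rmax_r]).
  assert (Hm : (0 < Rmin d (eps / Rmax K 1))%R).
  { apply Rmin_pos; [apply cond_pos |]. apply Rdiv_lt_0_compat; [apply cond_pos | exact HK]. }
  exists (mkposreal _ Hm). simpl. intros y Hy.
  assert (Hy1 := Rlt_le_trans _ _ _ Hy (Rmin_l _ _)).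
  assert (Hy2 := Rlt_le_trans _ _ _ Hy (Rmin_r _ _)).
  eapply Rle_trans; [apply H, Hy1 |].
  assert (H0 := Cmod_ge_0 (y - z)).
  assert (H1 : (Cmod (y - z) * Rmax K 1 <= eps)%R).
  { apply Rlt_le. apply (Rmult_lt_compat_r _ _ _ HK) in Hy2.
    field_simplify in Hy2; lra. }
  assert (H2 := Rmax_l K 1).
  simpl. rewrite Rmult_1_r.
  assert (H3 : (K * Cmod (y - z) <= eps)%R) by nra.
  nra.
Qed.

Lemma Cderiv_continuous (f : C -> C) (z l : C) :
  Cderiv f z l -> forall eps : posreal, exists del : posreal, forall y,
    (Cmod (y - z) < del)%R -> (Cmod (f y - f z) < eps)%R.
Proof.
  intros H eps.
  destruct (proj1 (Cderiv_eps f z l) H (mkposreal 1 Rlt_0_1)) as [d Hd].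
  assert (Hl := Cmod_ge_0 l).
  assert (Hm : (0 < Rmin d (eps / (2 + Cmod l)))%R).
  { apply Rmin_pos; [apply cond_pos |]. apply Rdiv_lt_0_compat; [apply cond_pos | lra]. }
  exists (mkposreal _ Hm). simpl. intros y Hy.
  assert (Hy1 := Rlt_le_trans _ _ _ Hy (Rmin_l _ _)).
  assert (Hy2 := Rlt_le_trans _ _ _ Hy (Rmin_r _ _)).
  specialize (Hd y Hy1). simpl in Hd.
  replace (f y - f z) with (f y - f z - (y - z) * l + (y - z) * l) by ring.
  eapply Rle_lt_trans; [apply Cmod_triangle |]. rewrite Cmod_mult.
  assert (H0 := Cmod_ge_0 (y - z)).
  apply (Rmult_lt_compat_r (2 + Cmod l)) in Hy2; [| lra].
  replace (eps / (2 + Cmod l) * (2 + Cmod l))%R with (pos eps) in Hy2 by (field; lra).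
  destruct (Rle_lt_or_eq_dec _ _ H0); [nra |].
  assert (0 < eps)%R by apply cond_pos. nra.
Qed.

Lemma Cderiv_Cinv (z : C) : z <> 0 -> Cderiv Cinv z (- / (z * z)).
Proof.
  intros Hz. assert (Hm := proj1 (Cmod_gt_0 z) Hz).
  assert (Hd : (0 < Cmod z / 2)%R) by lra.
  apply Cderiv_quadratic with (2 / Cmod z ^ 3)%R (mkposreal _ Hd). simpl.
  intros y Hy.
  assert (Hy2 : (Cmod z / 2 < Cmod y)%R).
  { generalize (Cmod_triangle_rev z y). rewrite Cmod_minus_sym. lra. }
  assert (Hy0 : y <> 0) by (apply Cmod_gt_0; lra).
  replace (/ y - / z - (y - z) * - / (z * z)) with ((y - z) * (y - z) * / (z * z * y)) by (field; auto).
  rewrite !Cmod_mult, Cmod_inv by (repeat apply Cmult_neq_0; auto).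
  rewrite !Cmod_mult.
  replace (2 / (Cmod z * (Cmod z * (Cmod z * 1))) * (Cmod (y - z) * (Cmod (y - z) * 1)))%R
    with (Cmod (y - z) * Cmod (y - z) * (2 / (Cmod z * Cmod z * Cmod z)))%R by (field; lra).
  apply Rmult_le_compat_l; [apply Rle_0_sqr |].
  replace (2 / (Cmod z * Cmod z * Cmod z))%R with (/ (Cmod z * Cmod z * (Cmod z / 2)))%R by (field; lra).
  apply Rinv_le_contravar.
  - repeat apply Rmult_lt_0_compat; lra.
  - apply Rmult_le_compat_l; [| lra]. apply Rle_0_sqr.
Qed.

Lemma Cderiv_inv (f : C -> C) (z l : C) :
  f z <> 0 -> Cderiv f z l -> Cderiv (fun x => / f x) z (- l / (f z * f z)).
Proof.
  intros H0 H. replace (- l / (f z * f z)) with (l * - / (f z * f z)) by (field; auto).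
  apply (Cderiv_comp Cinv f); [now apply Cderiv_Cinv | exact H].
Qed.

Lemma Cderiv_pow (n : nat) (z : C) : Cderiv (fun x => x ^ n) z (INR n * z ^ (n - 1)).
Proof.
  induction n as [| n IH].
  - simpl. replace (0 * 1) with (RtoC 0) by ring. apply Cderiv_const.
  - replace (INR (S n) * z ^ (S n - 1)) with (1 * z ^ n + z * (INR n * z ^ (n - 1))).
    + apply (Cderiv_mult (fun x => x) (fun x => x ^ n)); [apply Cderiv_id | exact IH].
    + rewrite S_INR, RtoC_plus. destruct n as [| n]; simpl; [ring |].
      rewrite Nat.sub_0_r. ring.
Qed.

Lemma Cexp_plus (a b : C) : Cexp (a + b) = Cexp a * Cexp b.
Proof.
  destruct a as [a1 a2], b as [b1 b2]. unfold Cexp, Cplus, Cmult. simpl.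
  rewrite exp_plus, cos_plus, sin_plus. f_equal; ring.
Qed.

Lemma Cexp_0 : Cexp 0 = 1.
Proof. unfold Cexp, RtoC. simpl. rewrite exp_0, cos_0, sin_0. f_equal; ring. Qed.

Lemma Cmod_Cexp (z : C) : Cmod (Cexp z) = exp (fst z).
Proof.
  unfold Cmod, Cexp. simpl.
  replace (_ + _)%R with (Rsqr (exp (fst z))).
  - apply sqrt_Rsqr, Rlt_le, exp_pos.
  - generalize (sin2_cos2 (snd z)). unfold Rsqr. intros H.
    transitivity (exp (fst z) * exp (fst z) * (sin (snd z) * sin (snd z) + cos (snd z) * cos (snd z)))%R;
      [rewrite H; ring | ring].
Qed.

Lemma Cexp_neq_0 (z : C) : Cexp z <> 0.
Proof. apply Cmod_gt_0. rewrite Cmod_Cexp. apply exp_pos. Qed.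

Lemma sin_abs_le (t : R) : (Rabs (sin t) <= Rabs t)%R.
Proof.
  assert (H : forall x, (0 < x -> Rabs (sin x) <= x)%R).
  { intros x Hx. assert (H1 := sin_lt_x x Hx).
    destruct (Rle_lt_dec x 1) as [H2 | H2].
    - apply Rabs_le. split; [| lra].
      assert (H3 : (0 <= sin x)%R) by (apply sin_ge_0; generalize PI2_1 PI2_3_2; lra). lra.
    - apply Rle_trans with 1%R; [| lra]. apply Rabs_le, SIN_bound. }
  destruct (Rtotal_order t 0) as [Ht | [Ht | Ht]].
  - rewrite <- (Rabs_Ropp (sin t)), <- sin_neg, (Rabs_left t Ht). apply H. lra.
  - subst t. rewrite sin_0. apply Rle_refl.
  - rewrite (Rabs_right t) by lra. now apply H.
Qed.

Lemma cos_ge_quadratic (t : R) : (1 - cos t <= t ^ 2 / 2)%R.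
Proof.
  replace t with (2 * (t / 2))%R at 1 by field. rewrite cos_2a_sin.
  assert (H := sin_abs_le (t / 2)). apply Rsqr_le_abs_1 in H. unfold Rsqr in H. nra.
Qed.

(** From exp(-x) >= 1 - x comes exp(x) (1 - x) <= 1, hence (exp(x) - 1 - x) (1 - x) <= x^2, and 1 -
    x >= 1/2. *)
Lemma exp_le_quadratic (x : R) : (Rabs x <= 1 / 2)%R -> (exp x - 1 - x <= 2 * x ^ 2)%R.
Proof.
  intros H. apply Rabs_le_between in H.
  assert (H1 := exp_ineq1_le (- x)). rewrite exp_Ropp in H1.
  assert (H2 := exp_pos x).
  apply (Rmult_le_compat_r (exp x)) in H1; [| lra].
  rewrite Rinv_l in H1 by lra.
  apply Rmult_le_reg_r with (1 - x)%R; [lra |].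
  assert (0 <= x^2 * (1 - 2 * x))%R by nra. nra.
Qed.

Lemma sin_minus_le (t : R) : (Rabs t <= 1)%R -> (Rabs (sin t - t) <= t ^ 2)%R.
Proof.
  intros Ht.
  assert (H : forall x, (0 <= x <= 1 -> Rabs (sin x - x) <= x ^ 2)%R).
  { intros x [[Hx | <-] Hx1].
    - destruct (MVT_cor2 sin cos 0 x Hx) as [c [Hc Hc1]].
      + intros c _. apply derivable_pt_lim_sin.
      + rewrite sin_0 in Hc. replace (sin x - x)%R with (- (x * (1 - cos c)))%R by lra.
        rewrite Rabs_Ropp. assert (H1 := cos_ge_quadratic c). assert (H2 := COS_bound c).
        rewrite Rabs_right by nra. nra.
    - rewrite sin_0, Rminus_0_r, Rabs_R0. simpl. lra. }
  apply Rabs_le_between in Ht.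
  destruct (Rle_lt_dec 0 t) as [H0 | H0].
  - apply H; lra.
  - rewrite <- Rabs_Ropp. replace (- (sin t - t))%R with (sin (- t) - - t)%R by (rewrite sin_neg; ring).
    replace (t ^ 2)%R with ((- t) ^ 2)%R by ring. apply H; lra.
Qed.

Lemma Cmod_le_Rabs (z : C) : (Cmod z <= Rabs (fst z) + Rabs (snd z))%R.
Proof.
  replace z with (RtoC (fst z) + Ci * RtoC (snd z)) at 1.
  - eapply Rle_trans; [apply Cmod_triangle |].
    rewrite Cmod_mult, Cmod_Ci, !Cmod_R. lra.
  - destruct z. unfold Cplus, Cmult, Ci, RtoC. simpl. f_equal; ring.
Qed.

Lemma Cmod_sqr (z : C) : (Cmod z ^ 2 = fst z ^ 2 + snd z ^ 2)%R.
Proof. apply Cmod2_alt. Qed.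

Lemma Cexp_quadratic (h : C) : (Cmod h < 1 / 2)%R -> (Cmod (Cexp h - 1 - h) <= 5 * Cmod h ^ 2)%R.
Proof.
  intros Hh. rewrite Cmod_sqr.
  assert (Hx := Rle_trans _ _ _ (Rmax_l _ _) (Rmax_Cmod h)).
  assert (Hy := Rle_trans _ _ _ (Rmax_r _ _) (Rmax_Cmod h)).
  eapply Rle_trans; [apply Cmod_le_Rabs |].
  destruct h as [x y]. simpl in *.
  assert (Hx2 : (Rabs x <= 1 / 2)%R) by lra. assert (Hy2 : (Rabs y <= 1)%R) by lra.
  assert (E1 := exp_le_quadratic x Hx2). assert (E2 := exp_ineq1_le x).
  assert (S1 := sin_minus_le y Hy2). assert (S2 := sin_abs_le y).
  assert (C1 := cos_ge_quadratic y). assert (C2 := COS_bound y).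
  apply Rabs_le_between in Hx2.
  assert (E3 : (exp x <= 2)%R) by nra.
  assert (E4 : (Rabs (exp x - 1) <= 2 * Rabs x)%R).
  { unfold Rabs at 2. destruct (Rcase_abs x); apply Rabs_le; nra. }
  assert (F1 : (Rabs (exp x * cos y + - (1) + - x) <= 2 * x ^ 2 + y ^ 2)%R).
  { replace (exp x * cos y + - (1) + - x)%R with ((exp x - 1 - x) - exp x * (1 - cos y))%R by ring.
    assert (0 <= exp x * (1 - cos y) <= y ^ 2)%R by (generalize (exp_pos x); nra).
    apply Rabs_le. nra. }
  assert (F2 : (Rabs (exp x * sin y + - 0 + - y) <= x ^ 2 + y ^ 2 + y ^ 2)%R).
  { replace (exp x * sin y + - 0 + - y)%R with ((exp x - 1) * sin y + (sin y - y))%R by ring.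
    eapply Rle_trans; [apply Rabs_triang |]. rewrite Rabs_mult.
    assert (Rabs (exp x - 1) * Rabs (sin y) <= 2 * Rabs x * Rabs y)%R
      by (apply Rmult_le_compat; try apply Rabs_pos; assumption).
    assert (Hq := Rle_0_sqr (Rabs x - Rabs y)). unfold Rsqr in Hq.
    generalize (pow2_abs x) (pow2_abs y). nra. }
  nra.
Qed.

Lemma Cderiv_Cexp (z : C) : Cderiv Cexp z (Cexp z).
Proof.
  assert (Hd : (0 < 1 / 2)%R) by lra.
  apply Cderiv_quadratic with (5 * Cmod (Cexp z))%R (mkposreal _ Hd). simpl. intros y Hy.
  replace (Cexp y) with (Cexp z * Cexp (y - z)) by (rewrite <- Cexp_plus; f_equal; ring).
  replace (Cexp z * Cexp (y - z) - Cexp z - (y - z) * Cexp z)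
    with (Cexp z * (Cexp (y - z) - 1 - (y - z))) by ring.
  rewrite Cmod_mult. assert (H := Cexp_quadratic (y - z) Hy).
  assert (H0 := Cmod_ge_0 (Cexp z)). simpl in H. nra.
Qed.

(** With s = x + iy, |e^s - 1|^2 = (e^x - 1)^2 + 2 e^x (1 - cos y), and for x <= 0 the two terms are
    at most x^2 and y^2. The constant 1 is what the univalence argument needs. *)
Lemma Cmod_Cexp_minus_1 (s : C) : (fst s <= 0)%R -> (Cmod (Cexp s - 1) <= Cmod s)%R.
Proof.
  intros Hs. apply Rsqr_incr_0; try apply Cmod_ge_0.
  rewrite !Rsqr_pow2, !Cmod_sqr.
  destruct s as [x y]. simpl in *.
  assert (E2 := exp_ineq1_le x). assert (E3 := exp_pos x).
  assert (E4 : (exp x <= 1)%R)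
    by (rewrite <- exp_0; destruct Hs as [Hs | ->]; [left; now apply exp_increasing | right; reflexivity]).
  assert (C1 := cos_ge_quadratic y). assert (C2 := COS_bound y).
  assert (T := sin2_cos2 y). unfold Rsqr in T.
  replace (_ + _)%R with ((exp x - 1) ^ 2 + 2 * exp x * (1 - cos y)
     + exp x * exp x * (sin y * sin y + cos y * cos y - 1))%R by ring.
  rewrite T. nra.
Qed.

(** * Complex power series on the disc *)

(** Splitting into real and imaginary parts opens the theory of real series, in particular
    comparison and Cauchy products. *)
Definition is_Cseries (a : nat -> C) (l : C) : Prop :=
  is_series (fun n => fst (a n)) (fst l) /\ is_series (fun n => snd (a n)) (snd l).

Definition CSeries (a : nat -> C) : C :=
  (Series (fun n => fst (a n)), Series (fun n => snd (a n))).

Lemma is_series_C (a : nat -> C) (l : C) :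
  @is_series C_AbsRing C_NormedModule a l <-> is_Cseries a l.
Proof.
  assert (Hs : forall n, @sum_n C_AbelianMonoid a n
    = (sum_n (fun k => fst (a k)) n, sum_n (fun k => snd (a k)) n)).
  { induction n as [| n IH].
    - rewrite !sum_O. now destruct (a 0%nat).
    - rewrite !sum_Sn, IH. reflexivity. }
  split.
  - intros H. split.
    + apply filterlim_ext with (fun n => fst (@sum_n C_AbelianMonoid a n)).
      { intros n. now rewrite Hs. }
      eapply filterlim_comp; [exact H |]. intros P [e He]. exists e. intros y Hy. apply He, Hy.
    + apply filterlim_ext with (fun n => snd (@sum_n C_AbelianMonoid a n)).
      { intros n. now rewrite Hs. }
      eapply filterlim_comp; [exact H |]. intros P [e He]. exists e. intros y Hy. apply He, Hy.
  - intros [H1 H2] P [e He].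
    destruct (H1 (fun x => ball (fst l) e x)) as [N1 HN1]; [now exists e |].
    destruct (H2 (fun x => ball (snd l) e x)) as [N2 HN2]; [now exists e |].
    exists (max N1 N2). intros n Hn.
    refine (eq_ind_r (fun u : C => P u) (He _ _) (Hs n)).
    split; [apply HN1 | apply HN2]; lia.
Qed.

Lemma is_pseries_C (a : nat -> C) (z l : C) :
  @is_pseries C_AbsRing C_NormedModule a z l <-> is_Cseries (fun n => a n * z ^ n) l.
Proof.
  unfold is_pseries. rewrite is_series_C. unfold is_Cseries.
  assert (E : forall n, @scal C_AbsRing C_NormedModule (pow_n z n) (a n) = a n * z ^ n).
  { intros n. rewrite Cmult_comm. apply (f_equal (Cmult (a n))).
    induction n as [| n IH]; [reflexivity |]. simpl. rewrite IH. reflexivity. }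
  split; intros [H1 H2]; split;
    (eapply is_series_ext; [| eassumption]); intros n; cbv beta; now rewrite E.
Qed.

Lemma is_Cseries_ext (a b : nat -> C) (l : C) :
  (forall n, a n = b n) -> is_Cseries a l -> is_Cseries b l.
Proof.
  intros E [H1 H2]; split; (eapply is_series_ext; [| eassumption]); intros n; cbv beta; now rewrite E.
Qed.

Lemma is_Cseries_unique (a : nat -> C) (l : C) : is_Cseries a l -> CSeries a = l.
Proof.
  intros [H1 H2]. unfold CSeries. rewrite (is_series_unique _ _ H1), (is_series_unique _ _ H2).
  now destruct l.
Qed.

Lemma is_Cseries_plus (a b : nat -> C) (la lb : C) :
  is_Cseries a la -> is_Cseries b lb -> is_Cseries (fun n => a n + b n) (la + lb).
Proof. intros [H1 H2] [H3 H4]; split; now apply (is_series_plus (V := R_NormedModule)). Qed.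

Lemma is_Cseries_scal (c : C) (a : nat -> C) (l : C) :
  is_Cseries a l -> is_Cseries (fun n => c * a n) (c * l).
Proof.
  intros [H1 H2]; split.
  - apply (is_series_minus (V := R_NormedModule));
      apply (is_series_scal (V := R_NormedModule)); assumption.
  - apply (is_series_plus (V := R_NormedModule));
      apply (is_series_scal (V := R_NormedModule)); assumption.
Qed.

Lemma is_Cseries_incr_1 (a : nat -> C) (l : C) :
  is_Cseries (fun n => a (S n)) l -> is_Cseries a (a 0%nat + l).
Proof.
  intros [H1 H2]; split.
  - apply (is_series_decr_1 (V := R_NormedModule)).
    replace (plus _ _) with (fst l); [exact H1 |].
    unfold plus, opp; simpl. ring.
  - apply (is_series_decr_1 (V := R_NormedModule)).
    replace (plus _ _) with (snd l); [exact H2 |].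
    unfold plus, opp; simpl. ring.
Qed.

Lemma fst_le_Cmod (z : C) : (Rabs (fst z) <= Cmod z)%R.
Proof. exact (Rle_trans _ _ _ (Rmax_l _ _) (Rmax_Cmod z)). Qed.

Lemma snd_le_Cmod (z : C) : (Rabs (snd z) <= Cmod z)%R.
Proof. exact (Rle_trans _ _ _ (Rmax_r _ _) (Rmax_Cmod z)). Qed.

Lemma ex_series_Rabs_le (a b : nat -> R) :
  (forall n, (Rabs (a n) <= b n)%R) -> ex_series b -> ex_series a.
Proof. exact (@ex_series_le R_AbsRing R_CompleteNormedModule a b). Qed.

Lemma CSeries_correct (a : nat -> C) :
  ex_series (fun n => Cmod (a n)) -> is_Cseries a (CSeries a).
Proof.
  intros H; split; apply Series_correct; eapply ex_series_Rabs_le; try exact H;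
    intros n; [apply fst_le_Cmod | apply snd_le_Cmod].
Qed.

(** Bounding the two parts separately would lose a constant. Instead the series is rotated: |l|^2 is
    the sum of Re(conj(l) a_n) <= |l| b_n, and |l| is cancelled. *)
Lemma is_Cseries_Cmod_le (a : nat -> C) (b : nat -> R) (l : C) :
  (forall n, (Cmod (a n) <= b n)%R) -> ex_series b -> is_Cseries a l ->
  (Cmod l <= Series b)%R.
Proof.
  intros Hab Hb Hl.
  assert (H : is_series (fun n => fst (Cconj l * a n)) (fst (Cconj l * l)))
    by apply (is_Cseries_scal _ _ _ Hl).
  assert (Hle : forall n, (Rabs (fst (Cconj l * a n)%C) <= Cmod l * b n)%R).
  { intros n. eapply Rle_trans; [apply fst_le_Cmod |]. rewrite Cmod_mult, Cmod_conj.
    apply Rmult_le_compat_l; [apply Cmod_ge_0 | apply Hab]. }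
  assert (E : (Cmod l ^ 2 <= Cmod l * Series b)%R).
  { replace (Cmod l ^ 2)%R with (fst (Cconj l * l)%C).
    - rewrite <- (is_series_unique _ _ H), <- Series_scal_l.
      eapply Rle_trans; [apply Rle_abs |].
      assert (Hex : ex_series (fun n => (Cmod l * b n)%R))
        by exact (@ex_series_scal R_AbsRing R_NormedModule (Cmod l) b Hb).
      eapply Rle_trans; [apply Series_Rabs |].
      + eapply ex_series_Rabs_le; [| exact Hex]. intros n. rewrite Rabs_Rabsolu. apply Hle.
      + apply Series_le; [| exact Hex]. intros n; split; [apply Rabs_pos | apply Hle].
    - rewrite Cmod_sqr. destruct l; simpl; ring. }
  destruct (Cmod_ge_0 l) as [Hp | <-].
  - apply Rmult_le_reg_l with (Cmod l); [exact Hp |]. simpl in E. lra.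
  - rewrite <- (Rmult_0_l (Series b)), <- Series_scal_l.
    apply Series_le; [| exact Hb]. intros n. rewrite Rmult_0_l. split; [lra |].
    eapply Rle_trans; [apply Cmod_ge_0 | apply Hab].
Qed.

Lemma sum_f_R0_fst (u : nat -> C) (n : nat) :
  sum_f_R0 (fun k => fst (u k)) n = fst (@sum_n C_AbelianMonoid u n).
Proof.
  induction n as [| n IH]; cbn [sum_f_R0].
  - now rewrite sum_O.
  - rewrite IH, sum_Sn. reflexivity.
Qed.

Lemma sum_f_R0_snd (u : nat -> C) (n : nat) :
  sum_f_R0 (fun k => snd (u k)) n = snd (@sum_n C_AbelianMonoid u n).
Proof.
  induction n as [| n IH]; cbn [sum_f_R0].
  - now rewrite sum_O.
  - rewrite IH, sum_Sn. reflexivity.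
Qed.

Lemma is_Cseries_mult (a b : nat -> C) (la lb : C) :
  is_Cseries a la -> is_Cseries b lb ->
  ex_series (fun n => Cmod (a n)) -> ex_series (fun n => Cmod (b n)) ->
  is_Cseries (fun n => @sum_n C_AbelianMonoid (fun k => a k * b (n - k)%nat) n) (la * lb).
Proof.
  intros [A1 A2] [B1 B2] HA HB.
  assert (X1 : ex_series (fun n => Rabs (fst (a n)))).
  { eapply ex_series_Rabs_le; [| exact HA]. intros n. rewrite Rabs_Rabsolu. apply fst_le_Cmod. }
  assert (X2 : ex_series (fun n => Rabs (snd (a n)))).
  { eapply ex_series_Rabs_le; [| exact HA]. intros n. rewrite Rabs_Rabsolu. apply snd_le_Cmod. }
  assert (Y1 : ex_series (fun n => Rabs (fst (b n)))).
  { eapply ex_series_Rabs_le; [| exact HB]. intros n. rewrite Rabs_Rabsolu. apply fst_le_Cmod. }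
  assert (Y2 : ex_series (fun n => Rabs (snd (b n)))).
  { eapply ex_series_Rabs_le; [| exact HB]. intros n. rewrite Rabs_Rabsolu. apply snd_le_Cmod. }
  split.
  - eapply is_series_ext; [| apply (is_series_minus (V := R_NormedModule));
      [exact (is_series_mult _ _ _ _ A1 B1 X1 Y1) | exact (is_series_mult _ _ _ _ A2 B2 X2 Y2)]].
    intros n. cbv beta. rewrite <- sum_f_R0_fst. unfold minus, plus, opp; simpl.
    change (sum_f_R0 (fun k => fst (a k) * fst (b (n - k)%nat)) n
      - sum_f_R0 (fun k => snd (a k) * snd (b (n - k)%nat)) n
      = sum_f_R0 (fun k => fst (a k * b (n - k)%nat)%C) n)%R.
    rewrite <- minus_sum. reflexivity.
  - eapply is_series_ext; [| apply (is_series_plus (V := R_NormedModule));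
      [exact (is_series_mult _ _ _ _ A1 B2 X1 Y2) | exact (is_series_mult _ _ _ _ A2 B1 X2 Y1)]].
    intros n. cbv beta. rewrite <- sum_f_R0_snd.
    change (sum_f_R0 (fun k => fst (a k) * snd (b (n - k)%nat)) n
      + sum_f_R0 (fun k => snd (a k) * fst (b (n - k)%nat)) n
      = sum_f_R0 (fun k => snd (a k * b (n - k)%nat)%C) n)%R.
    rewrite <- plus_sum. reflexivity.
Qed.

(** Passing to moduli makes absolute convergence on the disc a statement about a real power series,
    so that the radius of the derived series is known. *)
Definition conv_U (a : nat -> C) : Prop := Rbar_le 1 (CV_radius (fun n => Cmod (a n))).

Definition PS (a : nat -> C) (z : C) : C := CSeries (fun n => a n * z ^ n).

Definition dPS (a : nat -> C) (n : nat) : C := INR (S n) * a (S n).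

Lemma conv_U_abs (a : nat -> C) (z : C) :
  conv_U a -> inU z -> ex_series (fun n => Cmod (a n * z ^ n)%C).
Proof.
  intros Ha Hz.
  assert (H : Rbar_lt (Rabs (Cmod z)) (CV_radius (fun n => Cmod (a n)))).
  { apply Rbar_lt_le_trans with 1%R; [| exact Ha]. simpl.
    rewrite Rabs_right by apply Rle_ge, Cmod_ge_0. exact Hz. }
  apply CV_disk_inside in H. eapply ex_series_ext; [| exact H].
  intros n. cbv beta. rewrite Rabs_right, Cmod_mult, Cmod_pow; [reflexivity |].
  apply Rle_ge, Rmult_le_pos; [apply Cmod_ge_0 | apply pow_le, Cmod_ge_0].
Qed.

Lemma PS_correct (a : nat -> C) (z : C) :
  conv_U a -> inU z -> is_Cseries (fun n => a n * z ^ n) (PS a z).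
Proof. intros Ha Hz. apply CSeries_correct. now apply conv_U_abs. Qed.

Lemma conv_U_intro (a : nat -> C) :
  (forall r, (0 < r < 1)%R -> exists M, forall n, (Cmod (a n) * r ^ n <= M)%R) -> conv_U a.
Proof.
  intros H. unfold conv_U.
  destruct (CV_radius_bounded (fun n => Cmod (a n))) as [Hub _].
  assert (Hr : forall r, (0 < r < 1)%R -> Rbar_le r (CV_radius (fun n => Cmod (a n)))).
  { intros r Hr. apply Hub. destruct (H r Hr) as [M HM]. exists M. intros n.
    rewrite Rabs_right; [apply HM |].
    apply Rle_ge, Rmult_le_pos; [apply Cmod_ge_0 | apply pow_le; lra]. }
  destruct (CV_radius _) as [c | |]; simpl in *.
  - destruct (Rle_lt_dec 1 c) as [Hc | Hc]; [exact Hc | exfalso].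
    assert (H1 := Hr (1 / 2)%R ltac:(lra)). specialize (Hr ((1 + c) / 2)%R ltac:(lra)). lra.
  - exact I.
  - apply (Hr (1 / 2)%R). lra.
Qed.

Lemma conv_U_bounded (a : nat -> C) (M : R) :
  (forall n, (Cmod (a n) <= M)%R) -> conv_U a.
Proof.
  intros H. apply conv_U_intro. intros r Hr. exists M. intros n.
  assert (H1 : (0 <= r ^ n)%R) by (apply pow_le; lra).
  assert (H2 : (r ^ n <= 1)%R) by (rewrite <- (pow1 n); apply pow_incr; lra).
  generalize (H n) (Cmod_ge_0 (a n)). nra.
Qed.

Lemma conv_U_of_pseries (a : nat -> C) (F : C -> C) :
  (forall z, inU z -> is_Cseries (fun n => a n * z ^ n) (F z)) -> conv_U a.
Proof.
  intros H. apply conv_U_intro. intros r Hr.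
  assert (Hb : forall u : nat -> R, ex_series u -> exists M, forall n, (Rabs (u n) <= M)%R).
  { intros u Hu. apply ex_series_lim_0 in Hu.
    destruct (filterlim_bounded u) as [M HM]; [exists 0%R; exact Hu | exists M; exact HM]. }
  destruct (H (RtoC r)) as [H1 H2].
  { unfold inU. rewrite Cmod_R, Rabs_right; lra. }
  destruct (Hb _ (ex_intro _ _ H1)) as [M1 HM1]. destruct (Hb _ (ex_intro _ _ H2)) as [M2 HM2].
  exists (M1 + M2)%R. intros n.
  replace (Cmod (a n) * r ^ n)%R with (Cmod (a n * RtoC r ^ n)).
  - eapply Rle_trans; [apply Cmod_le_Rabs |]. apply Rplus_le_compat; [apply HM1 | apply HM2].
  - rewrite Cmod_mult, Cmod_pow, Cmod_R, Rabs_right; lra.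
Qed.

Lemma conv_U_dPS (a : nat -> C) : conv_U a -> conv_U (dPS a).
Proof.
  unfold conv_U. intros H. rewrite <- CV_radius_derive in H.
  erewrite CV_radius_ext; [exact H |]. intros n. unfold PS_derive, dPS.
  rewrite Cmod_mult, Cmod_R, Rabs_right; [reflexivity |]. apply Rle_ge, pos_INR.
Qed.

Lemma conv_U_incr (a : nat -> C) : conv_U a -> conv_U (fun n => a (S n)).
Proof.
  intros H. apply conv_U_intro. intros r Hr.
  destruct (CV_radius_bounded (fun n => Cmod (a n))) as [Hub Hlub].
  assert (Hz : inU (RtoC r)) by (unfold inU; rewrite Cmod_R, Rabs_right; lra).
  assert (Hs := conv_U_abs a (RtoC r) H Hz). apply ex_series_lim_0 in Hs.
  destruct (filterlim_bounded (fun n => Cmod (a n * RtoC r ^ n))) as [M HM];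
    [exists 0%R; exact Hs |].
  exists (M / r)%R. intros n. specialize (HM (S n)).
  change (Rabs (Cmod (a (S n) * RtoC r ^ S n)) <= M)%R in HM.
  rewrite Rabs_right in HM by apply Rle_ge, Cmod_ge_0.
  rewrite Cmod_mult, Cmod_pow, Cmod_R, Rabs_right in HM by lra. simpl in HM.
  apply Rmult_le_reg_r with r; [lra |].
  replace (M / r * r)%R with M by (field; lra). lra.
Qed.

Lemma PS_incr (a : nat -> C) (z : C) :
  conv_U a -> inU z -> PS a z = a 0%nat + z * PS (fun n => a (S n)) z.
Proof.
  intros Ha Hz. apply is_Cseries_unique.
  replace (a 0%nat) with (a 0%nat * z ^ 0) by (simpl; ring).
  apply (is_Cseries_incr_1 (fun n => a n * z ^ n)).
  eapply is_Cseries_ext; [| apply (is_Cseries_scal z), (PS_correct _ _ (conv_U_incr _ Ha) Hz)].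
  intros n. simpl. ring.
Qed.

(** Induction via y^(n+1) - z^(n+1) - (y-z)(n+1) z^n = y (y^n - z^n - (y-z) n z^(n-1)) + n z^(n-1)
    (y-z)^2. For n < 2 the factor n(n-1) vanishes, so the truncated exponent n - 2 is harmless. *)
Lemma pow_taylor_bound (n : nat) (y z : C) (rho : R) :
  (Cmod y <= rho)%R -> (Cmod z <= rho)%R ->
  (Cmod (y ^ n - z ^ n - (y - z) * (INR n * z ^ (n - 1)))
    <= INR n * INR (n - 1) * rho ^ (n - 2) * Cmod (y - z) ^ 2)%R.
Proof.
  intros Hy Hz. assert (H0 := Cmod_ge_0 y). assert (H1 := Cmod_ge_0 z).
  induction n as [| n IH].
  { simpl. replace (1 - 1 - (y - z) * (0 * 1)) with (RtoC 0) by ring. rewrite Cmod_0. lra. }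
  destruct n as [| n].
  { simpl. replace (y * 1 - z * 1 - (y - z) * (1 * 1)) with (RtoC 0) by ring. rewrite Cmod_0. lra. }
  replace (S (S n) - 1)%nat with (S n) in * by lia. replace (S (S n) - 2)%nat with n in * by lia.
  replace (S n - 1)%nat with n in * by lia.
  replace (y ^ S (S n) - z ^ S (S n) - (y - z) * (INR (S (S n)) * z ^ S n))
    with (y * (y ^ S n - z ^ S n - (y - z) * (INR (S n) * z ^ n))
      + INR (S n) * z ^ n * ((y - z) * (y - z)))
    by (rewrite (S_INR (S n)), RtoC_plus; simpl; ring).
  eapply Rle_trans; [apply Cmod_triangle |].
  rewrite !Cmod_mult, Cmod_pow, Cmod_R, (Rabs_right (INR (S n))) by apply Rle_ge, pos_INR.
  assert (Hq := pos_INR n). assert (Hd := Cmod_ge_0 (y - z)).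
  assert (Hp : (0 <= rho ^ n)%R) by (apply pow_le; lra).
  assert (Hzn : (Cmod z ^ n <= rho ^ n)%R) by (apply pow_incr; lra).
  assert (T2 : (INR (S n) * Cmod z ^ n * (Cmod (y - z) * Cmod (y - z))
     <= INR (S n) * rho ^ n * Cmod (y - z) ^ 2)%R).
  { replace (Cmod (y - z) * Cmod (y - z))%R with (Cmod (y - z) ^ 2)%R by ring.
    apply Rmult_le_compat_r; [apply pow2_ge_0 |].
    apply Rmult_le_compat_l; [apply pos_INR | exact Hzn]. }
  assert (T1 : (Cmod y * Cmod (y ^ S n - z ^ S n - (y - z) * (INR (S n) * z ^ n))
     <= INR (S n) * INR n * rho ^ n * Cmod (y - z) ^ 2)%R).
  { apply Rle_trans with (rho * (INR (S n) * INR n * rho ^ (S n - 2) * Cmod (y - z) ^ 2))%R.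
    - apply Rmult_le_compat; auto. apply Cmod_ge_0.
    - apply Req_le. destruct n as [| n]; [simpl; ring |].
      replace (S (S n) - 2)%nat with n by lia. simpl (rho ^ S n)%R. ring. }
  assert (0 <= rho ^ n * Cmod (y - z) ^ 2)%R by (apply Rmult_le_pos; [exact Hp | apply pow2_ge_0]).
  rewrite (S_INR (S n)), (S_INR n) in *. nra.
Qed.

Lemma Cderiv_PS (a : nat -> C) (z : C) :
  conv_U a -> inU z -> Cderiv (PS a) z (PS (dPS a) z).
Proof.
  intros Ha Hz. unfold inU in Hz. assert (H0 := Cmod_ge_0 z).
  set (rho := ((1 + Cmod z) / 2)%R).
  assert (Hd : (0 < (1 - Cmod z) / 2)%R) by lra.
  (* The remainder constant is the twice differentiated series of moduli at [rho], a radius halfway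
     between |z| and 1. *)
  set (b := fun n => (Cmod (a n) * (INR n * INR (n - 1) * rho ^ (n - 2)))%R).
  assert (Hb : ex_series b).
  { apply ex_series_incr_1, ex_series_incr_1.
    assert (Hc := conv_U_dPS _ (conv_U_dPS _ Ha)).
    assert (Hrho : inU (RtoC rho)) by (unfold inU, rho; rewrite Cmod_R, Rabs_right; lra).
    eapply ex_series_ext; [| exact (conv_U_abs _ _ Hc Hrho)].
    intros n. unfold b, dPS. rewrite !Cmod_mult, Cmod_pow, !Cmod_R, !Rabs_right;
      try (apply Rle_ge, pos_INR); [| unfold rho; lra].
    replace (S (S n) - 1)%nat with (S n) by lia. replace (S (S n) - 2)%nat with n by lia.
    match goal with |- @eq _ ?u ?v => change (@eq R u v) end. ring. }
  apply Cderiv_quadratic with (Series b) (mkposreal _ Hd). simpl. intros y Hy.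
  assert (Hyr : (Cmod y <= rho)%R).
  { generalize (Cmod_triangle (y - z) z). replace (y - z + z) with y by ring. unfold rho. lra. }
  assert (HyU : inU y) by (unfold inU, rho in *; lra).
  assert (HD : is_Cseries (fun n => a n * (INR n * z ^ (n - 1))) (PS (dPS a) z)).
  { replace (PS (dPS a) z) with (a 0%nat * (INR 0 * z ^ (0 - 1)) + PS (dPS a) z) by (simpl; ring).
    apply (is_Cseries_incr_1 (fun n => a n * (INR n * z ^ (n - 1)))).
    eapply is_Cseries_ext; [| apply (PS_correct _ z (conv_U_dPS _ Ha) Hz)].
    intros n. unfold dPS. cbv beta. replace (S n - 1)%nat with n by lia. ring. }
  assert (HS := is_Cseries_plus _ _ _ _
    (is_Cseries_plus _ _ _ _ (PS_correct _ _ Ha HyU) (is_Cseries_scal (- (1)) _ _ (PS_correct _ _ Ha Hz)))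
    (is_Cseries_scal (- (y - z)) _ _ HD)).
  replace (PS a y - PS a z - (y - z) * PS (dPS a) z)
    with (PS a y + - (1) * PS a z + - (y - z) * PS (dPS a) z) by ring.
  change (Cmod (y - z) * (Cmod (y - z) * 1))%R with (Cmod (y - z) ^ 2)%R.
  rewrite <- Series_scal_r.
  refine (is_Cseries_Cmod_le _ _ _ _ _ HS); [| now apply ex_series_scal_r].
  intros n. cbv beta.
  replace (a n * y ^ n + - (1) * (a n * z ^ n) + - (y - z) * (a n * (INR n * z ^ (n - 1))))
    with (a n * (y ^ n - z ^ n - (y - z) * (INR n * z ^ (n - 1)))) by ring.
  rewrite Cmod_mult. unfold b. rewrite Rmult_assoc.
  apply Rmult_le_compat_l; [apply Cmod_ge_0 |].
  apply pow_taylor_bound; [exact Hyr | unfold rho; lra].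
Qed.

(** * Gregory coefficients and the logarithm *)

(** Course-of-values recursion: row [n] is meaningful up to index [n]. Each new entry is solved from
    the requirement that the convolution with 1/(k+1) vanish. *)
Fixpoint kaluza_table (n : nat) : nat -> R :=
  match n with
  | O => fun _ => 1%R
  | S m => fun k => if Nat.leb k m then kaluza_table m k
      else (- sum_f_R0 (fun j => kaluza_table m j / INR (S (S m - j))) m)%R
  end.

Definition kaluza (n : nat) : R := kaluza_table n n.

Lemma kaluza_table_diag (n k : nat) : (k <= n)%nat -> kaluza_table n k = kaluza k.
Proof.
  induction n as [| n IH]; intros H.
  - now replace k with 0%nat by lia.
  - destruct (Nat.eq_dec k (S n)) as [-> | Hk]; [reflexivity |]. simpl.
    replace (Nat.leb k n) with true by (symmetry; apply Nat.leb_le; lia). apply IH. lia.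
Qed.

Lemma kaluza_S (n : nat) :
  kaluza (S n) = (- sum_f_R0 (fun j => kaluza j / INR (S (S n - j))) n)%R.
Proof.
  unfold kaluza at 1. cbn [kaluza_table].
  replace (Nat.leb (S n) n) with false by (symmetry; apply Nat.leb_gt; lia).
  f_equal. apply sum_eq. intros i Hi. now rewrite kaluza_table_diag.
Qed.

Lemma kaluza_conv (n : nat) :
  sum_f_R0 (fun j => kaluza j / INR (S (S n - j)))%R (S n) = 0%R.
Proof.
  cbn [sum_f_R0]. rewrite kaluza_S, Nat.sub_diag. simpl (INR 1). field.
Qed.

(* Kaluza's theorem: the reciprocal of a power series with log-convex coefficients
   u_k (here u_k = 1/(k+1)) has nonpositive coefficients after the first. *)
Lemma kaluza_nonpos (n : nat) : (kaluza (S n) <= 0)%R.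
Proof.
  induction n as [n IH] using (well_founded_induction Wf_nat.lt_wf).
  destruct n as [| n].
  { rewrite kaluza_S. simpl. unfold kaluza; simpl. lra. }
  rewrite kaluza_S.
  assert (Hc := kaluza_conv n).
  (* With u_k = 1/(k+1) the factor is u_(n+2)/u_(n+1). By log-convexity it times u_(n+1-j) is at
     least u_(n+2-j), with equality at j = 0; for j >= 1 the sign of [kaluza j] reverses the
     inequality. The left side vanishes by the previous convolution identity. *)
  assert (H : (INR (S (S n)) / INR (S (S (S n))) * sum_f_R0 (fun j => kaluza j / INR (S (S n - j))) (S n)
     <= sum_f_R0 (fun j => kaluza j / INR (S (S (S n) - j))) (S n))%R).
  { rewrite scal_sum. apply sum_Rle. intros j Hj.
    replace (S (S n) - j)%nat with (S (S n - j)) by lia.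
    replace (S (S n)) with (S (S n - j + j)) at 1 by lia.
    replace (S (S (S n))) with (S (S (S n - j + j)))%nat by lia.
    set (k := (S n - j)%nat). rewrite !S_INR, !plus_INR.
    assert (Hk := pos_INR k). assert (Hj0 := pos_INR j).
    apply Rminus_le.
    replace (_ - _)%R with (kaluza j * INR j * / ((INR k + 1 + 1) * (INR k + 1) * (INR k + INR j + 1 + 1)))%R
      by (field; lra).
    assert (0 < / ((INR k + 1 + 1) * (INR k + 1) * (INR k + INR j + 1 + 1)))%R
      by (apply Rinv_0_lt_compat; repeat apply Rmult_lt_0_compat; lra).
    assert (kaluza j * INR j <= 0)%R.
    { destruct j as [| j]; [simpl; lra |]. assert (Hn := IH j ltac:(lia)). nra. }
    nra. }
  rewrite Hc in H. lra.
Qed.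

(** In the vanishing convolution the index 0 contributes 1/(n+2), and every other weight is at least
    1/(n+2). As the remaining terms all have the same sign, the weights can be replaced by this
    lower bound. *)
Lemma sum_Rabs_kaluza (n : nat) : (sum_f_R0 (fun j => Rabs (kaluza (S j))) n <= 1)%R.
Proof.
  assert (Hc := kaluza_conv n). rewrite decomp_sum in Hc by lia.
  replace (kaluza 0) with 1%R in Hc by reflexivity.
  assert (Hp : (0 < INR (S (S n)))%R) by (apply lt_0_INR; lia).
  apply Rmult_le_reg_l with (1 / INR (S (S n)))%R; [apply Rdiv_lt_0_compat; lra |].
  replace (S (S n - 0)) with (S (S n)) in Hc by lia. simpl pred in Hc.
  rewrite Rmult_1_r. rewrite scal_sum.
  apply Rle_trans with (- sum_f_R0 (fun i => kaluza (S i) / INR (S (S n - S i))) n)%R; [| lra].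
  replace (- _)%R with (-1 * sum_f_R0 (fun i => kaluza (S i) / INR (S (S n - S i))) n)%R by ring.
  rewrite scal_sum. apply sum_Rle. intros j Hj.
  assert (Hn := kaluza_nonpos j). rewrite Rabs_left1 by exact Hn.
  assert (H1 : (/ INR (S (S n)) <= / INR (S (S n - S j)))%R).
  { apply Rinv_le_contravar; [apply lt_0_INR; lia | apply le_INR; lia]. }
  unfold Rdiv. nra.
Qed.

(* Psi(z) = sum_n gregory n * z^n; the recursion for kaluza n = (-1)^n * gregory n says that the
   product with log(1 + z) / z = sum_n (-z)^n / (n + 1) is 1. *)
Definition gregory (n : nat) : C := RtoC ((-1) ^ n * kaluza n).

Definition log_coef (n : nat) : C := RtoC ((-1) ^ n / INR (S n)).

Lemma gregory_0 : gregory 0 = 1.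
Proof. unfold gregory, kaluza. simpl. f_equal. ring. Qed.

Lemma kaluza_1 : kaluza 1 = (- (1 / 2))%R.
Proof. rewrite kaluza_S. simpl. unfold kaluza; simpl. field. Qed.

Lemma kaluza_2 : kaluza 2 = (- (1 / 12))%R.
Proof. rewrite kaluza_S. simpl. rewrite kaluza_1. unfold kaluza; simpl. field. Qed.

Lemma kaluza_3 : kaluza 3 = (- (1 / 24))%R.
Proof. rewrite kaluza_S. simpl. rewrite kaluza_1, kaluza_2. unfold kaluza; simpl. field. Qed.

Lemma kaluza_4 : kaluza 4 = (- (19 / 720))%R.
Proof. rewrite kaluza_S. simpl. rewrite kaluza_1, kaluza_2, kaluza_3. unfold kaluza; simpl. field. Qed.

Lemma Cmod_gregory (n : nat) : Cmod (gregory n) = Rabs (kaluza n).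
Proof.
  unfold gregory. rewrite Cmod_R, Rabs_mult, pow_1_abs. ring.
Qed.

Lemma Cmod_gregory_le_1 (n : nat) : (Cmod (gregory n) <= 1)%R.
Proof.
  rewrite Cmod_gregory. destruct n as [| n].
  - unfold kaluza; simpl. rewrite Rabs_R1. lra.
  - eapply Rle_trans; [| apply (sum_Rabs_kaluza n)].
    destruct n as [| n]; [simpl; lra |]. cbn [sum_f_R0].
    assert (0 <= sum_f_R0 (fun j => Rabs (kaluza (S j))) n)%R
      by (apply cond_pos_sum; intros; apply Rabs_pos). lra.
Qed.

Lemma conv_gregory : conv_U gregory.
Proof. exact (conv_U_bounded _ 1 Cmod_gregory_le_1). Qed.

Lemma conv_log_coef : conv_U log_coef.
Proof.
  apply (conv_U_bounded _ 1). intros n. unfold log_coef.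
  rewrite Cmod_R. unfold Rdiv. rewrite Rabs_mult, pow_1_abs, Rmult_1_l.
  assert (H := pos_INR n). rewrite Rabs_right.
  - apply Rle_trans with (/ 1)%R; [apply Rinv_le_contravar; rewrite ?S_INR; lra | lra].
  - apply Rle_ge, Rlt_le, Rinv_0_lt_compat. rewrite S_INR. lra.
Qed.

Lemma RtoC_sum_n (u : nat -> R) (n : nat) :
  @sum_n C_AbelianMonoid (fun k => RtoC (u k)) n = RtoC (sum_f_R0 u n).
Proof.
  induction n as [| n IH]; [now rewrite sum_O |].
  rewrite sum_Sn, IH. cbn [sum_f_R0]. symmetry. apply RtoC_plus.
Qed.

Lemma is_series_0 : is_series (fun _ : nat => 0%R) 0%R.
Proof.
  apply filterlim_ext with (fun _ : nat => 0%R); [| apply filterlim_const].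
  intros n. rewrite sum_n_const. ring.
Qed.

Lemma is_Cseries_head (a : nat -> C) : (forall n, a (S n) = 0) -> is_Cseries a (a 0%nat).
Proof.
  intros H. replace (a 0%nat) with (a 0%nat + 0) by ring. apply is_Cseries_incr_1.
  apply is_Cseries_ext with (fun _ => 0); [easy |]. split; exact is_series_0.
Qed.

Lemma PS_gregory_log_coef (z : C) : inU z -> PS gregory z * PS log_coef z = 1.
Proof.
  intros Hz.
  assert (H := is_Cseries_mult _ _ _ _ (PS_correct _ z conv_gregory Hz) (PS_correct _ z conv_log_coef Hz)
    (conv_U_abs _ z conv_gregory Hz) (conv_U_abs _ z conv_log_coef Hz)).
  assert (E : forall n, @sum_n C_AbelianMonoid
      (fun k => gregory k * z ^ k * (log_coef (n - k)%nat * z ^ (n - k)%nat)) n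
    = RtoC ((-1) ^ n * sum_f_R0 (fun j => kaluza j / INR (S (n - j)))%R n) * z ^ n).
  { intros n. rewrite scal_sum, <- RtoC_sum_n.
    transitivity (@sum_n C_AbelianMonoid (fun k => z ^ n * RtoC (kaluza k / INR (S (n - k)) * (-1) ^ n)) n).
    - apply (@sum_n_ext_loc C_AbelianMonoid). intros k Hk. unfold gregory, log_coef.
      replace (z ^ n) with (z ^ k * z ^ (n - k)) by (rewrite <- Cpow_add_r; f_equal; lia).
      replace ((-1) ^ n)%R with ((-1) ^ k * (-1) ^ (n - k))%R by (rewrite <- pow_add; f_equal; lia).
      unfold Rdiv. rewrite !RtoC_mult.
      match goal with |- @eq _ ?u ?v => change (@eq C u v) end. ring.
    - rewrite Cmult_comm. exact (@sum_n_mult_l C_Ring (z ^ n) _ n). }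
  assert (H' := is_Cseries_ext _ _ _ E H). clear H.
  apply is_Cseries_unique in H'. rewrite <- H'.
  transitivity (RtoC ((-1) ^ 0 * sum_f_R0 (fun j => kaluza j / INR (S (0 - j)))%R 0) * z ^ 0).
  - apply is_Cseries_unique, (is_Cseries_head (fun n => RtoC ((-1) ^ n *
      sum_f_R0 (fun j => kaluza j / INR (S (n - j)))%R n) * z ^ n)).
    intros n. rewrite kaluza_conv, Rmult_0_r. ring.
  - unfold kaluza. apply injective_projections; simpl; field.
Qed.

(** * Derivatives along real curves and the power series of the principal logarithm *)

Definition RCderiv (gam : R -> C) (t : R) (d : C) : Prop :=
  is_derive (fun s => fst (gam s)) t (fst d) /\ is_derive (fun s => snd (gam s)) t (snd d).

Lemma is_derive_R_eps (f : R -> R) (t l : R) :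
  is_derive f t l <->
  (forall eps : posreal, exists del : posreal, forall s, (Rabs (s - t) < del)%R ->
     (Rabs (f s - f t - (s - t) * l) <= eps * Rabs (s - t))%R).
Proof.
  split.
  - intros [_ H] eps. destruct (H t (fun P HP => HP) eps) as [d Hd].
    exists d; intros y Hy. exact (Hd y Hy).
  - intros H; split; [apply is_linear_scal_l |]. intros x Hx eps.
    replace x with t.
    + destruct (H eps) as [d Hd]. exists d. intros y Hy. exact (Hd y Hy).
    + apply (@is_filter_lim_locally_unique R_AbsRing R_NormedModule) in Hx. exact Hx.
Qed.

Lemma RCderiv_eps (gam : R -> C) (t : R) (d : C) :
  RCderiv gam t d <->
  (forall eps : posreal, exists del : posreal, forall s, (Rabs (s - t) < del)%R ->
     (Cmod (gam s - gam t - RtoC (s - t) * d) <= eps * Rabs (s - t))%R).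
Proof.
  unfold RCderiv. rewrite !is_derive_R_eps.
  assert (E1 : forall s, fst (gam s - gam t - RtoC (s - t) * d) = (fst (gam s) - fst (gam t) - (s - t) * fst d)%R)
    by (intros; simpl; ring).
  assert (E2 : forall s, snd (gam s - gam t - RtoC (s - t) * d) = (snd (gam s) - snd (gam t) - (s - t) * snd d)%R)
    by (intros; simpl; ring).
  split.
  - intros [H1 H2] eps.
    destruct (H1 (pos_div_2 eps)) as [d1 Hd1]. destruct (H2 (pos_div_2 eps)) as [d2 Hd2].
    assert (Hm : (0 < Rmin d1 d2)%R) by (apply Rmin_pos; apply cond_pos).
    exists (mkposreal _ Hm). simpl. intros s Hs.
    specialize (Hd1 s (Rlt_le_trans _ _ _ Hs (Rmin_l _ _))).
    specialize (Hd2 s (Rlt_le_trans _ _ _ Hs (Rmin_r _ _))). simpl in Hd1, Hd2.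
    eapply Rle_trans; [apply Cmod_le_Rabs |]. rewrite E1, E2. lra.
  - intros H; split; intros eps; destruct (H eps) as [d0 Hd]; exists d0; intros s Hs;
      specialize (Hd s Hs); (eapply Rle_trans; [| exact Hd]).
    + rewrite <- E1. apply fst_le_Cmod.
    + rewrite <- E2. apply snd_le_Cmod.
Qed.

Lemma RCderiv_comp (f : C -> C) (gam : R -> C) (t : R) (l d : C) :
  Cderiv f (gam t) l -> RCderiv gam t d -> RCderiv (fun s => f (gam s)) t (d * l).
Proof.
  rewrite Cderiv_eps, !RCderiv_eps. intros Hf Hg eps.
  assert (Hl := Cmod_ge_0 l). assert (Hd := Cmod_ge_0 d).
  assert (He := cond_pos eps).
  assert (P1 : (0 < eps / (2 * (1 + Cmod d)))%R) by (apply Rdiv_lt_0_compat; lra).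
  (* The cap at 1 bounds the increments of the curve by (1 + |d|) |s - t|, the factor anticipated in
     [P1]; each of the two errors then takes half of [eps]. *)
  assert (P2 : (0 < Rmin 1 (eps / (2 * (1 + Cmod l))))%R)
    by (apply Rmin_pos; [lra | apply Rdiv_lt_0_compat; lra]).
  destruct (Hf (mkposreal _ P1)) as [df Hdf].
  destruct (Hg (mkposreal _ P2)) as [dg Hdg]. simpl in Hdf, Hdg.
  assert (P3 : (0 < Rmin dg (df / (1 + Cmod d)))%R)
    by (apply Rmin_pos; [apply cond_pos | apply Rdiv_lt_0_compat; [apply cond_pos | lra]]).
  exists (mkposreal _ P3). simpl. intros s Hs.
  assert (Hs1 := Rlt_le_trans _ _ _ Hs (Rmin_l _ _)).
  assert (Hs2 := Rlt_le_trans _ _ _ Hs (Rmin_r _ _)).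
  specialize (Hdg s Hs1). assert (Ha := Rabs_pos (s - t)).
  set (a := Rabs (s - t)) in *.
  set (e2 := Rmin 1 (eps / (2 * (1 + Cmod l)))) in *.
  assert (He2 : (e2 <= 1)%R) by apply Rmin_l.
  assert (He2' : (e2 * (2 * (1 + Cmod l)) <= eps)%R).
  { apply Rle_trans with (eps / (2 * (1 + Cmod l)) * (2 * (1 + Cmod l)))%R.
    - apply Rmult_le_compat_r; [lra | apply Rmin_r].
    - right. field. lra. }
  assert (Hgam : (Cmod (gam s - gam t) <= (1 + Cmod d) * a)%R).
  { replace (gam s - gam t) with (gam s - gam t - RtoC (s - t) * d + RtoC (s - t) * d) by ring.
    eapply Rle_trans; [apply Cmod_triangle |]. rewrite Cmod_mult, Cmod_R. fold a. nra. }
  assert (Hlt : (Cmod (gam s - gam t) < df)%R).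
  { eapply Rle_lt_trans; [exact Hgam |].
    apply (Rmult_lt_compat_l (1 + Cmod d)) in Hs2; [| lra].
    replace ((1 + Cmod d) * (df / (1 + Cmod d)))%R with (pos df) in Hs2 by (field; lra). exact Hs2. }
  specialize (Hdf _ Hlt).
  replace (f (gam s) - f (gam t) - RtoC (s - t) * (d * l))
    with (f (gam s) - f (gam t) - (gam s - gam t) * l + (gam s - gam t - RtoC (s - t) * d) * l) by ring.
  eapply Rle_trans; [apply Cmod_triangle |]. rewrite Cmod_mult.
  assert (T1 : (eps / (2 * (1 + Cmod d)) * Cmod (gam s - gam t) <= eps / 2 * a)%R).
  { apply Rle_trans with (eps / (2 * (1 + Cmod d)) * ((1 + Cmod d) * a))%R.
    - apply Rmult_le_compat_l; [lra | exact Hgam].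
    - right. field. lra. }
  nra.
Qed.

Lemma inU_bounds (z : C) : inU z -> (-1 < fst z < 1 /\ fst z ^ 2 + snd z ^ 2 < 1)%R.
Proof.
  unfold inU. intros H. assert (H1 := fst_le_Cmod z). apply Rabs_le_between in H1.
  assert (H0 := Cmod_ge_0 z). rewrite <- Cmod_sqr. split; [lra | nra].
Qed.

Lemma inU_scal (z : C) (t : R) : (0 <= t <= 1)%R -> inU z -> inU (RtoC t * z).
Proof.
  unfold inU. intros Ht Hz. rewrite Cmod_mult, Cmod_R, Rabs_right by lra.
  generalize (Cmod_ge_0 z). nra.
Qed.

Lemma one_plus_neq_0 (z : C) : inU z -> 1 + z <> 0.
Proof.
  intros Hz E. apply inU_bounds in Hz. apply (f_equal fst) in E. simpl in E. lra.
Qed.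

Lemma PS_geom (z : C) : inU z -> PS (fun n => RtoC ((-1) ^ n)) z = / (1 + z).
Proof.
  intros Hz.
  assert (Hc : conv_U (fun n => RtoC ((-1) ^ n))).
  { apply (conv_U_bounded _ 1). intros n. rewrite Cmod_R, pow_1_abs. lra. }
  assert (H := PS_incr _ _ Hc Hz).
  assert (Hs : PS (fun n => RtoC ((-1) ^ S n)) z = - PS (fun n => RtoC ((-1) ^ n)) z).
  { apply is_Cseries_unique.
    replace (- PS (fun n => RtoC ((-1) ^ n)) z) with (- (1) * PS (fun n => RtoC ((-1) ^ n)) z) by ring.
    eapply is_Cseries_ext; [| apply is_Cseries_scal, (PS_correct _ _ Hc Hz)].
    intros n. cbv beta. simpl pow. rewrite RtoC_mult. ring. }
  cbv beta in H. rewrite Hs in H. clear Hs.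
  assert (H1 := one_plus_neq_0 z Hz).
  set (s := PS (fun n => RtoC ((-1) ^ n)) z) in *.
  assert (E : s + z * s = 1) by (rewrite H at 1; change ((-1) ^ 0)%R with 1%R; ring).
  transitivity ((s + z * s) / (1 + z)); [| rewrite E]; field; exact H1.
Qed.

(** The left side is the derivative of z L(z), with L the sum of [log_coef]; together with the value
    0 at 0 it identifies z L(z) as log(1+z). *)
Lemma PS_log_ode (z : C) :
  inU z -> PS log_coef z + z * PS (dPS log_coef) z = / (1 + z).
Proof.
  intros Hz. rewrite <- PS_geom by exact Hz. symmetry. apply is_Cseries_unique.
  assert (Hd := conv_U_dPS _ conv_log_coef).
  assert (H : is_Cseries (fun n => RtoC (INR n) * log_coef n * z ^ n) (z * PS (dPS log_coef) z)).
  { replace (z * PS (dPS log_coef) z) with (RtoC (INR 0) * log_coef 0 * z ^ 0 + z * PS (dPS log_coef) z)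
      by (simpl; ring).
    apply (is_Cseries_incr_1 (fun n => RtoC (INR n) * log_coef n * z ^ n)).
    eapply is_Cseries_ext; [| apply (is_Cseries_scal z), (PS_correct _ _ Hd Hz)].
    intros n. unfold dPS. simpl Cpow. ring. }
  eapply is_Cseries_ext; [| exact (is_Cseries_plus _ _ _ _ (PS_correct _ _ conv_log_coef Hz) H)].
  intros n. cbv beta.
  replace (RtoC ((-1) ^ n)) with (RtoC (INR (S n)) * log_coef n).
  - rewrite S_INR, RtoC_plus. ring.
  - unfold log_coef. rewrite <- RtoC_mult. f_equal. field. apply not_0_INR. lia.
Qed.

Lemma Cmod_fst_snd (z : C) : Cmod z = sqrt (fst z ^ 2 + snd z ^ 2).
Proof. reflexivity. Qed.

(** The comparison with the series runs along rays, so a real computation in coordinates suffices; 1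
    + t Re z > 0 keeps the quotient inside [atan] regular. *)
Lemma RCderiv_Log_ray (z : C) (t : R) :
  (0 <= t <= 1)%R -> inU z ->
  RCderiv (fun s => Log_rhp (1 + RtoC s * z)) t (z / (1 + RtoC t * z)).
Proof.
  intros Ht Hz. assert (Hn := one_plus_neq_0 _ (inU_scal z t Ht Hz)).
  apply (inU_scal z t Ht), inU_bounds in Hz. destruct Hz as [Hx _].
  destruct z as [x y]. simpl in Hx.
  assert (Hp : (0 < 1 + t * x)%R) by lra.
  assert (Hq : (0 < (1 + t * x) * (1 + t * x) + (t * y) * (t * y))%R)
    by (assert (0 <= (t * y) * (t * y))%R by apply Rle_0_sqr; nra).
  split.
  - apply is_derive_ext with (fun s => ln (sqrt ((1 + s * x) * (1 + s * x) + (s * y) * (s * y)))).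
    { intros s. unfold Log_rhp. simpl fst at 1. rewrite Cmod_fst_snd. f_equal. f_equal. simpl. ring. }
    auto_derive.
    + split; [exact Hq |]. split; [| exact I]. now apply sqrt_lt_R0.
    + assert (Hs := sqrt_lt_R0 _ Hq). assert (Hss := sqrt_sqrt _ (Rlt_le _ _ Hq)).
      set (sq := sqrt _) in *.
      transitivity ((x * (1 + t * x) + y * (t * y)) / (sq * sq))%R; [field; lra |].
      rewrite Hss. simpl. field. nra.
  - apply is_derive_ext with (fun s => atan (s * y / (1 + s * x))).
    { intros s. unfold Log_rhp. simpl. f_equal. f_equal; ring. }
    auto_derive.
    + lra.
    + simpl. field. repeat split; nra.
Qed.

Lemma is_derive_eq_01 (f g d : R -> R) :
  (forall t, (0 <= t <= 1)%R -> is_derive f t (d t) /\ is_derive g t (d t)) ->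
  f 0%R = g 0%R -> f 1%R = g 1%R.
Proof.
  intros H H0. apply Rminus_diag_uniq. rewrite <- (Rminus_diag_eq _ _ H0). symmetry.
  apply (eq_is_derive (V := R_NormedModule) (fun t => f t - g t)%R); [| lra].
  intros t Ht. destruct (H t Ht) as [Hf Hg].
  refine (eq_rect _ (fun u => is_derive (fun s => (f s - g s)%R) t u)
    (is_derive_minus (V := R_NormedModule) f g t _ _ Hf Hg) _ (minus_eq_zero (G := R_AbelianGroup) (d t))).
Qed.

Lemma RCderiv_eq_01 (f g d : R -> C) :
  (forall t, (0 <= t <= 1)%R -> RCderiv f t (d t) /\ RCderiv g t (d t)) ->
  f 0%R = g 0%R -> f 1%R = g 1%R.
Proof.
  intros H H0. apply injective_projections.
  - apply (is_derive_eq_01 (fun t => fst (f t)) (fun t => fst (g t)) (fun t => fst (d t))).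
    + intros t Ht. destruct (H t Ht) as [[? ?] [? ?]]. now split.
    + now f_equal.
  - apply (is_derive_eq_01 (fun t => snd (f t)) (fun t => snd (g t)) (fun t => snd (d t))).
    + intros t Ht. destruct (H t Ht) as [[? ?] [? ?]]. now split.
    + now f_equal.
Qed.

Lemma Log_rhp_1 : Log_rhp 1 = 0.
Proof.
  unfold Log_rhp. rewrite Cmod_1, ln_1. simpl. rewrite Rdiv_0_l, atan_0. reflexivity.
Qed.

(* Both sides have the same derivative along the ray from 0 to z. *)
Lemma Log_rhp_PS (z : C) : inU z -> Log_rhp (1 + z) = z * PS log_coef z.
Proof.
  intros Hz.
  assert (H2 : forall t, (0 <= t <= 1)%R ->
    RCderiv (fun s => RtoC s * z * PS log_coef (RtoC s * z)) t (z / (1 + RtoC t * z))).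
  { intros t Ht. assert (Htz := inU_scal z t Ht Hz).
    replace (z / (1 + RtoC t * z))
      with (z * (1 * PS log_coef (RtoC t * z) + RtoC t * z * PS (dPS log_coef) (RtoC t * z)))
      by (rewrite Cmult_1_l, PS_log_ode by exact Htz; reflexivity).
    apply (RCderiv_comp (fun u => u * PS log_coef u) (fun s => RtoC s * z)).
    - apply (Cderiv_mult (fun u => u)); [apply Cderiv_id | apply Cderiv_PS; [apply conv_log_coef | exact Htz]].
    - split.
      + apply is_derive_ext with (fun s => (s * fst z)%R); [intros; simpl; ring |].
        auto_derive; [exact I | simpl; ring].
      + apply is_derive_ext with (fun s => (s * snd z)%R); [intros; simpl; ring |].
        auto_derive; [exact I | simpl; ring]. }
  assert (E1 : RtoC 1 * z = z) by ring.
  rewrite <- E1.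
  apply (RCderiv_eq_01 (fun t => Log_rhp (1 + RtoC t * z)) (fun t => RtoC t * z * PS log_coef (RtoC t * z))
    (fun t => z / (1 + RtoC t * z))).
  - intros t Ht. split; [now apply RCderiv_Log_ray | now apply H2].
  - rewrite !Cmult_0_l, Cplus_0_r. exact Log_rhp_1.
Qed.

Lemma PS_0 (a : nat -> C) : conv_U a -> PS a 0 = a 0%nat.
Proof.
  intros H. rewrite PS_incr; [ring | exact H |]. unfold inU. rewrite Cmod_0. lra.
Qed.

(** The shape of the coordinatewise test for z = 0 in both [Psi] and [starlike_quot]. *)
Lemma zero_test {A : Type} (z : C) (a b : A) :
  z <> 0 -> (if Req_EM_T (fst z) 0 then (if Req_EM_T (snd z) 0 then a else b) else b) = b.
Proof.
  intros H. destruct (Req_EM_T (fst z) 0) as [H1 |]; [| reflexivity].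
  destruct (Req_EM_T (snd z) 0) as [H2 |]; [| reflexivity].
  exfalso. apply H. now apply injective_projections.
Qed.

Lemma zero_test_0 {A : Type} (a b : A) :
  (if Req_EM_T (fst (RtoC 0)) 0 then (if Req_EM_T (snd (RtoC 0)) 0 then a else b) else b) = a.
Proof.
  simpl. destruct (Req_EM_T 0 0) as [_ | H]; [reflexivity | now elim H].
Qed.

Lemma Psi_PS (z : C) : inU z -> Psi z = PS gregory z.
Proof.
  intros Hz. destruct (Ceq_dec z 0) as [-> | Hn].
  - unfold Psi. rewrite zero_test_0, PS_0, gregory_0; [reflexivity | apply conv_gregory].
  - unfold Psi. rewrite zero_test by exact Hn.
    rewrite Log_rhp_PS by exact Hz. assert (H := PS_gregory_log_coef z Hz).
    assert (Hl : PS log_coef z <> 0).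
    { intros E. rewrite E, Cmult_0_r in H. apply (f_equal fst) in H. simpl in H. lra. }
    rewrite <- (Cmult_1_r (z / _)), <- H. field. auto.
Qed.

(** * The derivative of Psi has no zero in the disc *)

Lemma is_series_telescope : is_series (fun n => / (INR (n + 2) * INR (n + 3)))%R (1 / 2)%R.
Proof.
  change (is_lim_seq (sum_n (fun n => / (INR (n + 2) * INR (n + 3)))%R) (1 / 2)%R).
  apply (is_lim_seq_ext (fun n => 1 / 2 - / INR (n + 3))%R).
  - induction n as [| n IH].
    + rewrite sum_O. simpl. field.
    + rewrite sum_Sn, <- IH. unfold plus; simpl plus.
      rewrite !plus_INR, !S_INR. simpl. assert (H := pos_INR n). field. lra.
  - replace (Finite (1 / 2)) with (Finite (1 / 2 - 0)) by (f_equal; ring).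
    apply is_lim_seq_minus'; [apply is_lim_seq_const |].
    apply (is_lim_seq_incr_n (fun n => / INR n)%R 3 0%R).
    apply (is_lim_seq_inv _ p_infty); [apply is_lim_seq_INR | easy].
Qed.

(** The series -(1+z) L'(z) has coefficients [m], that is (-1)^n / ((n+1)(n+2)). Its constant term
    is 1/2, and the moduli of the others add up to 1/2 by telescoping; since |z| < 1 they cannot
    cancel it. *)
Lemma PS_dlog_coef_neq_0 (z : C) : inU z -> PS (dPS log_coef) z <> 0.
Proof.
  intros Hz E. unfold inU in Hz.
  set (m := fun n => RtoC ((-1) ^ n / (INR (n + 1) * INR (n + 2)))).
  assert (Hm1 : forall n, Cmod (m n) = (/ (INR (n + 1) * INR (n + 2)))%R).
  { intros n. unfold m. rewrite Cmod_R. unfold Rdiv. rewrite Rabs_mult, pow_1_abs, Rmult_1_l.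
    apply Rabs_right, Rle_ge, Rlt_le, Rinv_0_lt_compat, Rmult_lt_0_compat; apply lt_0_INR; lia. }
  assert (Hm : conv_U m).
  { apply (conv_U_bounded _ 1). intros n. rewrite Hm1. rewrite <- Rinv_1.
    apply Rinv_le_contravar; [lra |]. rewrite !plus_INR. simpl. generalize (pos_INR n). nra. }
  assert (Hd := conv_U_dPS _ conv_log_coef).
  assert (H : PS m z = - (1 + z) * PS (dPS log_coef) z).
  { assert (Hs := conv_U_incr _ Hd).
    rewrite (PS_incr m z Hm Hz).
    replace (- (1 + z) * PS (dPS log_coef) z)
      with (- PS (dPS log_coef) z + z * (- (1) * PS (dPS log_coef) z)) by ring.
    rewrite (PS_incr (dPS log_coef) z Hd Hz) at 1.
    replace (m 0%nat) with (- dPS log_coef 0)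
      by (unfold m, dPS, log_coef; apply injective_projections; simpl; field).
    replace (PS (fun n => m (S n)) z)
      with (- (1) * PS (fun n => dPS log_coef (S n)) z + - (1) * PS (dPS log_coef) z); [ring |].
    symmetry. apply is_Cseries_unique.
    eapply is_Cseries_ext; [| apply is_Cseries_plus; apply is_Cseries_scal;
      [apply (PS_correct _ z Hs Hz) | apply (PS_correct _ z Hd Hz)]].
    intros n. cbv beta.
    replace (m (S n)) with (- (1) * dPS log_coef (S n) + - (1) * dPS log_coef n); [ring |].
    unfold m, dPS, log_coef. rewrite <- !RtoC_mult, <- RtoC_opp, <- !RtoC_mult, <- RtoC_plus. f_equal.
    assert (Hn := pos_INR n). rewrite !plus_INR, !S_INR. simpl. field. lra. }
  rewrite E, Cmult_0_r, (PS_incr m z Hm Hz) in H.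
  assert (Hb : (Cmod (PS (fun n => m (S n)) z) <= 1 / 2)%R).
  { rewrite <- (is_series_unique _ _ is_series_telescope).
    refine (is_Cseries_Cmod_le _ _ _ _ _ (PS_correct _ z (conv_U_incr _ Hm) Hz));
      [| eexists; exact is_series_telescope].
    intros n. cbv beta. rewrite Cmod_mult, Cmod_pow, Hm1.
    replace (S n + 1)%nat with (n + 2)%nat by lia. replace (S n + 2)%nat with (n + 3)%nat by lia.
    assert (0 < / (INR (n + 2) * INR (n + 3)))%R
      by (apply Rinv_0_lt_compat, Rmult_lt_0_compat; apply lt_0_INR; lia).
    assert (Cmod z ^ n <= 1)%R
      by (rewrite <- (pow1 n); apply pow_incr; generalize (Cmod_ge_0 z); lra).
    nra. }
  assert (Hh : m 0%nat = - (z * PS (fun n => m (S n)) z)).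
  { replace (m 0%nat) with (m 0%nat + z * PS (fun n => m (S n)) z - z * PS (fun n => m (S n)) z) by ring.
    rewrite H. ring. }
  apply (f_equal Cmod) in Hh. rewrite Cmod_opp, Cmod_mult, Hm1 in Hh. simpl in Hh.
  generalize (Cmod_ge_0 z) (Cmod_ge_0 (PS (fun n => m (S n)) z)). nra.
Qed.

(** Differentiating Psi L = 1 gives Psi' L + Psi L' = 0, where neither Psi nor L' vanishes. *)
Lemma PS_dgregory_neq_0 (z : C) : inU z -> PS (dPS gregory) z <> 0.
Proof.
  intros Hz E. assert (Hz' := Hz). unfold inU in Hz'.
  assert (Hd : (0 < 1 - Cmod z)%R) by lra.
  assert (H1 := Cderiv_mult _ _ _ _ _ (Cderiv_PS _ z conv_gregory Hz) (Cderiv_PS _ z conv_log_coef Hz)).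
  assert (H2 : Cderiv (fun x => PS gregory x * PS log_coef x) z 0).
  { apply (Cderiv_ext_loc (fun _ => 1) _ z 0 (mkposreal _ Hd)); [| apply Cderiv_const].
    simpl. intros y Hy. symmetry. apply PS_gregory_log_coef. unfold inU.
    generalize (Cmod_triangle (y - z) z). replace (y - z + z) with y by ring. lra. }
  assert (H := Cderiv_unique _ _ _ _ H1 H2). rewrite E, Cmult_0_l, Cplus_0_l in H.
  assert (H3 := PS_dlog_coef_neq_0 z Hz). assert (H4 := PS_gregory_log_coef z Hz).
  apply (Cmult_neq_0 (PS gregory z) _) in H3; [now apply H3 |].
  intros E4. rewrite E4, Cmult_0_l in H4. apply (f_equal fst) in H4. simpl in H4. lra.
Qed.

(** * The extremal functions *)

(** The coefficients of F(z^n) when [u] are those of F. The filler [z0] is a parameter to serve real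
    and complex sequences alike. *)
Definition spread {A : Type} (z0 : A) (n : nat) (u : nat -> A) (m : nat) : A :=
  if Nat.eqb (m mod n) 0 then u (m / n)%nat else z0.

Lemma is_series_spread (n : nat) (u : nat -> R) (l : R) :
  (1 <= n)%nat -> is_series u l -> is_series (spread 0%R n u) l.
Proof.
  intros Hn H.
  (* Partial sums up to [m] of the spread sequence are those of [u] up to the quotient m / n, which
     tends to infinity. *)
  apply filterlim_ext with (fun m => sum_n u (m / n)).
  - intros m. induction m as [| m IH].
    + rewrite sum_O. unfold spread. rewrite Nat.Div0.div_0_l, Nat.Div0.mod_0_l, sum_O. reflexivity.
    + rewrite sum_Sn, <- IH. unfold spread.
      assert (D1 := Nat.div_mod_eq m n). assert (D2 := Nat.div_mod_eq (S m) n).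
      assert (M1 := Nat.mod_upper_bound m n ltac:(lia)).
      assert (M2 := Nat.mod_upper_bound (S m) n ltac:(lia)).
      destruct (Nat.eqb_spec (S m mod n) 0) as [E | E].
      * assert (Hq : (S m / n = S (m / n))%nat) by nia.
        rewrite Hq, sum_Sn. reflexivity.
      * assert (Hq : (S m / n = m / n)%nat) by nia.
        rewrite Hq. symmetry. apply (plus_zero_r (G := R_AbelianGroup)).
  - eapply filterlim_comp; [| exact H].
    intros P [N HN]. exists (N * n)%nat. intros m Hm. apply HN.
    apply Nat.div_le_lower_bound; nia.
Qed.

Lemma is_Cseries_spread (n : nat) (u : nat -> C) (l : C) :
  (1 <= n)%nat -> is_Cseries u l -> is_Cseries (spread (RtoC 0) n u) l.
Proof.
  intros Hn [H1 H2]. split.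
  - eapply is_series_ext; [| exact (is_series_spread n _ _ Hn H1)].
    intros m. unfold spread. now destruct (Nat.eqb _ _).
  - eapply is_series_ext; [| exact (is_series_spread n _ _ Hn H2)].
    intros m. unfold spread. now destruct (Nat.eqb _ _).
Qed.

(** Coefficients of Psi - 1: the exponent of the extremal function is the integral of (Psi(z^n) -
    1)/z, so the constant term has to go. *)
Definition gregory_tail (k : nat) : C := match k with O => 0 | S _ => gregory k end.

Lemma gregory_tail_abs :
  ex_series (fun k => Cmod (gregory_tail k)) /\ (Series (fun k => Cmod (gregory_tail k)) <= 1)%R.
Proof.
  assert (Hb : forall N, (sum_n (fun k => Cmod (gregory_tail k)) N <= 1)%R).
  { intros [| N].
    - rewrite sum_O. simpl. rewrite Cmod_0. lra.
    - rewrite sum_n_Reals, decomp_sum by lia. simpl. rewrite Cmod_0, Rplus_0_l.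
      eapply Rle_trans; [| apply (sum_Rabs_kaluza N)].
      right. apply sum_eq. intros i _. apply Cmod_gregory. }
  assert (Hl : ex_finite_lim_seq (sum_n (fun k => Cmod (gregory_tail k)))).
  { apply ex_finite_lim_seq_incr with 1%R; [| exact Hb].
    intros N. rewrite sum_Sn. unfold plus; simpl. generalize (Cmod_ge_0 (gregory (S N))). lra. }
  destruct Hl as [l Hl]. split; [now exists l |].
  rewrite (is_series_unique _ l Hl).
  exact (is_lim_seq_le _ (fun _ => 1%R) l 1%R Hb Hl (is_lim_seq_const 1%R)).
Qed.

Lemma PS_gregory_tail (z : C) :
  inU z -> is_Cseries (fun k => gregory_tail k * z ^ k) (PS gregory z - 1).
Proof.
  intros Hz. rewrite (PS_incr _ _ conv_gregory Hz), gregory_0.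
  replace (1 + z * PS (fun n => gregory (S n)) z - 1)
    with (gregory_tail 0 * z ^ 0 + z * PS (fun n => gregory (S n)) z) by (simpl; ring).
  apply (is_Cseries_incr_1 (fun k => gregory_tail k * z ^ k)).
  eapply is_Cseries_ext; [| apply (is_Cseries_scal z), (PS_correct _ _ (conv_U_incr _ conv_gregory) Hz)].
  intros n. simpl. ring.
Qed.

Lemma inU_pow (n : nat) (z : C) : (1 <= n)%nat -> inU z -> inU (z ^ n).
Proof.
  unfold inU. intros Hn Hz. rewrite Cmod_pow. assert (H := Cmod_ge_0 z).
  destruct n as [| n]; [lia |]. simpl.
  assert (Cmod z ^ n <= 1)%R by (rewrite <- (pow1 n); apply pow_incr; lra).
  assert (0 <= Cmod z ^ n)%R by (apply pow_le; lra). nra.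
Qed.

Lemma Cpow_lipschitz (m : nat) (y z : C) :
  inU y -> inU z -> (Cmod (y ^ m - z ^ m) <= INR m * Cmod (y - z))%R.
Proof.
  unfold inU. intros Hy Hz. induction m as [| m IH].
  - simpl. replace (1 - 1) with (RtoC 0) by ring. rewrite Cmod_0. lra.
  - replace (y ^ S m - z ^ S m) with (y * (y ^ m - z ^ m) + z ^ m * (y - z)) by (simpl; ring).
    eapply Rle_trans; [apply Cmod_triangle |]. rewrite !Cmod_mult, Cmod_pow, S_INR.
    assert (H0 := Cmod_ge_0 (y - z)). assert (H1 := Cmod_ge_0 y). assert (H2 := Cmod_ge_0 (y ^ m - z ^ m)).
    assert (Cmod z ^ m <= 1)%R
      by (rewrite <- (pow1 m); apply pow_incr; generalize (Cmod_ge_0 z); lra).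
    nra.
Qed.

(* At m = 0 this is 0 / 0, which is 0. *)
Definition ext_coef (n m : nat) : C := spread (RtoC 0) n gregory_tail m / INR m.

Lemma INR_ext_coef (n m : nat) :
  (1 <= n)%nat -> INR m * ext_coef n m = spread (RtoC 0) n gregory_tail m.
Proof.
  intros Hn. unfold ext_coef. destruct m as [| m].
  - unfold spread. rewrite Nat.Div0.div_0_l, Nat.Div0.mod_0_l. simpl. unfold Cdiv. ring.
  - field. intros E. apply RtoC_inj in E. revert E. apply not_0_INR. lia.
Qed.

Lemma Cmod_spread (n : nat) (u : nat -> C) (m : nat) :
  Cmod (spread (RtoC 0) n u m) = spread 0%R n (fun k => Cmod (u k)) m.
Proof. unfold spread. destruct (Nat.eqb _ _); [reflexivity | apply Cmod_0]. Qed.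

Lemma spread_gregory_abs (n : nat) : (1 <= n)%nat ->
  ex_series (fun m => Cmod (spread (RtoC 0) n gregory_tail m)) /\
  (Series (fun m => Cmod (spread (RtoC 0) n gregory_tail m)) <= 1)%R.
Proof.
  intros Hn. destruct gregory_tail_abs as [H1 H2].
  assert (H := is_series_spread n _ _ Hn (Series_correct _ H1)).
  assert (H' : is_series (fun m => Cmod (spread (RtoC 0) n gregory_tail m))
    (Series (fun k => Cmod (gregory_tail k)))).
  { eapply is_series_ext; [| exact H]. intros m. cbv beta. now rewrite Cmod_spread. }
  split; [eexists; exact H' |]. now rewrite (is_series_unique _ _ H').
Qed.

Lemma conv_ext_coef (n : nat) : (1 <= n)%nat -> conv_U (ext_coef n).
Proof.
  intros Hn. apply (conv_U_bounded _ 1). intros [| m].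
  - unfold ext_coef, spread. rewrite Nat.Div0.div_0_l, Nat.Div0.mod_0_l. simpl.
    replace (0 / 0) with (RtoC 0) by (unfold Cdiv; ring). rewrite Cmod_0. lra.
  - assert (E := INR_ext_coef n (S m) Hn). apply (f_equal Cmod) in E.
    rewrite Cmod_mult, Cmod_R, Rabs_right in E by apply Rle_ge, pos_INR.
    assert (H : (Cmod (spread (RtoC 0) n gregory_tail (S m)) <= 1)%R).
    { unfold spread. destruct (Nat.eqb _ _); [| rewrite Cmod_0; lra].
      unfold gregory_tail. destruct (S m / n)%nat; [rewrite Cmod_0; lra | apply Cmod_gregory_le_1]. }
    rewrite <- E, S_INR in H. generalize (pos_INR m) (Cmod_ge_0 (ext_coef n (S m))). nra.
Qed.

(** The factor m in |y^m - z^m| <= m |y - z| cancels the division by m in [ext_coef], leaving the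
    sum of |G_k|, at most 1 by [gregory_tail_abs]. *)
Lemma PS_ext_lipschitz (n : nat) (y z : C) : (1 <= n)%nat -> inU y -> inU z ->
  (Cmod (PS (ext_coef n) y - PS (ext_coef n) z) <= Cmod (y - z))%R.
Proof.
  intros Hn Hy Hz. destruct (spread_gregory_abs n Hn) as [H1 H2].
  assert (Hc := conv_ext_coef n Hn).
  apply Rle_trans with (Series (fun m => Cmod (spread (RtoC 0) n gregory_tail m) * Cmod (y - z))%R).
  - replace (PS (ext_coef n) y - PS (ext_coef n) z)
      with (PS (ext_coef n) y + - (1) * PS (ext_coef n) z) by ring.
    refine (is_Cseries_Cmod_le _ _ _ _ _ (is_Cseries_plus _ _ _ _ (PS_correct _ _ Hc Hy)
      (is_Cseries_scal (- (1)) _ _ (PS_correct _ _ Hc Hz)))); [| now apply ex_series_scal_r].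
    intros m. cbv beta.
    replace (ext_coef n m * y ^ m + - (1) * (ext_coef n m * z ^ m)) with (ext_coef n m * (y ^ m - z ^ m)) by ring.
    rewrite <- INR_ext_coef, !Cmod_mult, Cmod_R, Rabs_right by (try apply Rle_ge, pos_INR; assumption).
    assert (H := Cpow_lipschitz m y z Hy Hz). assert (H0 := Cmod_ge_0 (ext_coef n m)). nra.
  - rewrite Series_scal_r. generalize (Cmod_ge_0 (y - z)). nra.
Qed.

(** For f = z e^g the quotient z f'/f is 1 + z g'; this identity is therefore the subordination to
    Psi with Schwarz function z^n. *)
Lemma z_dPS_ext (n : nat) (z : C) : (1 <= n)%nat -> inU z ->
  1 + z * PS (dPS (ext_coef n)) z = PS gregory (z ^ n).
Proof.
  intros Hn Hz. assert (Hc := conv_ext_coef n Hn).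
  assert (H1 : is_Cseries (fun m => spread (RtoC 0) n gregory_tail m * z ^ m) (z * PS (dPS (ext_coef n)) z)).
  { replace (z * PS (dPS (ext_coef n)) z)
      with (spread (RtoC 0) n gregory_tail 0 * z ^ 0 + z * PS (dPS (ext_coef n)) z)
      by (rewrite <- INR_ext_coef by exact Hn; simpl; ring).
    apply (is_Cseries_incr_1 (fun m => spread (RtoC 0) n gregory_tail m * z ^ m)).
    eapply is_Cseries_ext; [| apply (is_Cseries_scal z), (PS_correct _ _ (conv_U_dPS _ Hc) Hz)].
    intros m. unfold dPS. cbv beta. rewrite INR_ext_coef by exact Hn. simpl. ring. }
  assert (H2 := is_Cseries_spread n _ _ Hn (PS_gregory_tail _ (inU_pow n z Hn Hz))).
  apply is_Cseries_unique in H1. rewrite <- H1.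
  replace (PS gregory (z ^ n)) with (1 + (PS gregory (z ^ n) - 1)) by ring. f_equal.
  apply is_Cseries_unique. eapply is_Cseries_ext; [| exact H2].
  intros m. unfold spread. cbv beta.
  destruct (Nat.eqb_spec (m mod n) 0) as [E | _]; [| ring].
  rewrite <- Cpow_mult_r. do 2 f_equal. rewrite (Nat.div_mod_eq m n) at 2. lia.
Qed.

Definition extremal (n : nat) (z : C) : C := z * Cexp (PS (ext_coef n) z).

Definition extremal' (n : nat) (z : C) : C :=
  (1 + z * PS (dPS (ext_coef n)) z) * Cexp (PS (ext_coef n) z).

Lemma Cderiv_extremal (n : nat) (z : C) :
  (1 <= n)%nat -> inU z -> Cderiv (extremal n) z (extremal' n z).
Proof.
  intros Hn Hz. unfold extremal, extremal'. assert (Hc := conv_ext_coef n Hn).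
  replace ((1 + z * PS (dPS (ext_coef n)) z) * Cexp (PS (ext_coef n) z))
    with (1 * Cexp (PS (ext_coef n) z) + z * (PS (dPS (ext_coef n)) z * Cexp (PS (ext_coef n) z))) by ring.
  apply (Cderiv_mult (fun u => u) (fun u => Cexp (PS (ext_coef n) u))); [apply Cderiv_id |].
  apply (Cderiv_comp Cexp (PS (ext_coef n))); [apply Cderiv_Cexp | now apply Cderiv_PS].
Qed.

(* The exponent g of the extremal function is 1-Lipschitz: from
   z1 exp(g z1) = z2 exp(g z2) with |z1| <= |z2| one gets
   |z1 - z2| = |z2| |exp(g z2 - g z1) - 1| <= |z2| |z1 - z2|. *)
Lemma extremal_inj_le (n : nat) (z1 z2 : C) :
  (1 <= n)%nat -> inU z1 -> inU z2 -> (Cmod z1 <= Cmod z2)%R ->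
  extremal n z1 = extremal n z2 -> z1 = z2.
Proof.
  intros Hn H1 H2 Hle E. unfold extremal in E.
  set (g1 := PS (ext_coef n) z1) in *. set (g2 := PS (ext_coef n) z2) in *.
  assert (E' : z1 = z2 * Cexp (g2 - g1)).
  { transitivity (z1 * Cexp g1 * Cexp (- g1)).
    - rewrite <- Cmult_assoc, <- Cexp_plus. replace (g1 + - g1) with (RtoC 0) by ring.
      rewrite Cexp_0. ring.
    - rewrite E, <- Cmult_assoc, <- Cexp_plus. reflexivity. }
  destruct (Req_EM_T (Cmod z2) 0) as [Hz | Hz].
  { rewrite (Cmod_eq_0 z2 Hz) in *. rewrite E'. ring. }
  assert (Hp : (0 < Cmod z2)%R) by (generalize (Cmod_ge_0 z2); lra).
  (* Ordering the points by modulus forces Re(g2 - g1) <= 0, the half-plane where |e^s - 1| <= |s|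
     is available. *)
  assert (Hs : (fst (g2 - g1)%C <= 0)%R).
  { rewrite E', Cmod_mult, Cmod_Cexp in Hle.
    destruct (Rle_lt_dec (fst (g2 - g1)%C) 0) as [H | H]; [exact H | exfalso].
    assert (Hx := exp_ineq1_le (fst (g2 - g1)%C)). nra. }
  assert (HL := PS_ext_lipschitz n z2 z1 Hn H2 H1). fold g1 g2 in HL.
  assert (HC := Cmod_Cexp_minus_1 _ Hs).
  assert (HE : (Cmod (z1 - z2) <= Cmod z2 * Cmod (z1 - z2))%R).
  { replace (z1 - z2) with (z2 * (Cexp (g2 - g1) - 1)) at 1 by (rewrite E' at 1; ring).
    rewrite Cmod_mult. apply Rmult_le_compat_l; [lra |].
    rewrite (Cmod_minus_sym z1 z2). lra. }
  unfold inU in H2. assert (H0 := Cmod_ge_0 (z1 - z2)).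
  assert (Hzero : Cmod (z1 - z2) = 0%R) by nra.
  apply Cmod_eq_0 in Hzero. replace z1 with (z1 - z2 + z2) by ring. rewrite Hzero. ring.
Qed.

Lemma extremal_in_SGstar (n : nat) : (1 <= n)%nat -> in_SGstar (extremal n).
Proof.
  intros Hn. assert (Hc := conv_ext_coef n Hn).
  assert (H0 : inU 0) by (unfold inU; rewrite Cmod_0; lra).
  split.
  - split; [| split; [| split]].
    + intros z Hz. exists (extremal' n z). now apply Cderiv_extremal.
    + intros z1 z2 H1 H2 E. destruct (Rle_lt_dec (Cmod z1) (Cmod z2)) as [H | H].
      * now apply (extremal_inj_le n).
      * symmetry. apply (extremal_inj_le n); auto. lra.
    + unfold extremal. ring.
    + replace (RtoC 1) with (extremal' n 0); [now apply Cderiv_extremal |].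
      unfold extremal'. rewrite (PS_0 _ Hc).
      replace (ext_coef n 0) with (RtoC 0).
      * rewrite Cexp_0. ring.
      * unfold ext_coef, spread. rewrite Nat.Div0.div_0_l, Nat.Div0.mod_0_l. simpl. unfold Cdiv. ring.
  - exists (extremal' n). split; [intros z Hz; now apply Cderiv_extremal |].
    exists (fun z => z ^ n). split; [| split; [| split]].
    + intros z _. eexists. apply Cderiv_pow.
    + destruct n as [| n]; [lia |]. simpl. ring.
    + intros z Hz. now apply inU_pow.
    + intros z Hz. rewrite Psi_PS by now apply inU_pow.
      destruct (Ceq_dec z 0) as [-> | Hz0]; unfold starlike_quot.
      * rewrite zero_test_0. destruct n as [| n]; [lia |].
        replace (0 ^ S n) with (RtoC 0) by (simpl; ring). now rewrite (PS_0 _ conv_gregory), gregory_0.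
      * rewrite zero_test by exact Hz0. rewrite <- z_dPS_ext by assumption.
        unfold extremal, extremal'. assert (He := Cexp_neq_0 (PS (ext_coef n) z)). field. auto.
Qed.

Lemma extremal_log_coeffs (n : nat) :
  (1 <= n)%nat -> log_coeffs (extremal n) (fun m => ext_coef n m / 2).
Proof.
  intros Hn. assert (Hc := conv_ext_coef n Hn).
  assert (E0 : ext_coef n 0 = 0).
  { unfold ext_coef, spread. rewrite Nat.Div0.div_0_l, Nat.Div0.mod_0_l. simpl. unfold Cdiv. ring. }
  split; [rewrite E0; unfold Cdiv; ring |].
  exists (PS (ext_coef n)). split; [| split; [| split]].
  - intros z Hz. eexists. apply Cderiv_PS; assumption.
  - now rewrite PS_0, E0.
  - reflexivity.
  - intros z Hz. apply is_pseries_C.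
    eapply is_Cseries_ext; [| apply (PS_correct _ _ Hc Hz)].
    intros m. cbv beta. field.
Qed.

(** At index [n] the exponent has coefficient G_1 / n = 1/(2n), and [beta] is half of it. *)
Lemma extremal_sharp (n : nat) : (1 <= n)%nat -> Cmod (ext_coef n n / 2) = (1 / (4 * INR n))%R.
Proof.
  intros Hn. assert (HI : INR n <> 0%R) by (apply not_0_INR; lia).
  unfold ext_coef, spread. rewrite Nat.div_same, Nat.Div0.mod_same by lia. simpl.
  unfold gregory. rewrite kaluza_1.
  replace (RtoC ((-1) ^ 1 * - (1 / 2)) / RtoC (INR n) / 2) with (RtoC (1 / (4 * INR n))).
  - rewrite Cmod_R. apply Rabs_right, Rle_ge, Rlt_le, Rdiv_lt_0_compat; [lra |].
    apply Rmult_lt_0_compat; [lra | apply lt_0_INR; lia].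
  - rewrite <- !RtoC_div by (auto; intros E; lra). f_equal. field. exact HI.
Qed.

(** * Means over circles *)

Definition circ (t : R) : C := (cos t, sin t).

Lemma Cmod_circ (t : R) : Cmod (circ t) = 1%R.
Proof.
  rewrite Cmod_fst_snd. simpl. rewrite !Rmult_1_r.
  generalize (sin2_cos2 t). unfold Rsqr. intros H.
  rewrite Rplus_comm, H. apply sqrt_1.
Qed.

Definition polar (r t : R) : C := RtoC r * circ t.

Lemma Cmod_circle (r t : R) : (0 <= r)%R -> Cmod (polar r t) = r.
Proof. intros Hr. unfold polar. rewrite Cmod_mult, Cmod_circ, Cmod_R, Rabs_right; lra. Qed.

Lemma circle_punctured (r t : R) : (0 < r < 1)%R -> polar r t <> 0 /\ inU (polar r t).
Proof.
  intros Hr. split.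
  - apply Cmod_gt_0. rewrite Cmod_circle; lra.
  - unfold inU. rewrite Cmod_circle; lra.
Qed.

Lemma RCderiv_circle (r t : R) : RCderiv (fun s => polar r s) t (Ci * (polar r t)).
Proof.
  split.
  - apply is_derive_ext with (fun s => (r * cos s)%R); [intros; simpl; ring |].
    auto_derive; [exact I | simpl; ring].
  - apply is_derive_ext with (fun s => (r * sin s)%R); [intros; simpl; ring |].
    auto_derive; [exact I | simpl; ring].
Qed.

Lemma RCderiv_radius (r t : R) : RCderiv (fun s => polar s t) r (circ t).
Proof.
  split.
  - apply is_derive_ext with (fun s => (s * cos t)%R); [intros; simpl; ring |].
    auto_derive; [exact I | simpl; ring].
  - apply is_derive_ext with (fun s => (s * sin t)%R); [intros; simpl; ring |].
    auto_derive; [exact I | simpl; ring].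
Qed.

(** Joint continuity in radius and angle is what differentiation under the integral sign requires;
    it is applied to the derivative of the integrand. *)
Lemma continuity_2d_polar (f : C -> C) (r t : R) (l : C) :
  Cderiv f (polar r t) l ->
  continuity_2d_pt (fun u v => fst (f (polar u v))) r t /\
  continuity_2d_pt (fun u v => snd (f (polar u v))) r t.
Proof.
  intros Hf.
  assert (Hc : forall eps : posreal,
    locally_2d (fun u v => (Cmod (f (polar u v) - f (polar r t)) < eps)%R) r t).
  { intros eps. destruct (Cderiv_continuous _ _ _ Hf eps) as [d Hd].
    assert (H1 : continuity_2d_pt (fun u v => (u * cos v)%R) r t).
    { apply continuity_2d_pt_mult; [apply continuity_2d_pt_id1 |].
      apply (continuity_1d_2d_pt_comp cos (fun _ v => v)); [apply continuity_cos | apply continuity_2d_pt_id2]. }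
    assert (H2 : continuity_2d_pt (fun u v => (u * sin v)%R) r t).
    { apply continuity_2d_pt_mult; [apply continuity_2d_pt_id1 |].
      apply (continuity_1d_2d_pt_comp sin (fun _ v => v)); [apply continuity_sin | apply continuity_2d_pt_id2]. }
    generalize (locally_2d_and _ _ _ _ (H1 (pos_div_2 d)) (H2 (pos_div_2 d))).
    apply locally_2d_impl, locally_2d_forall. intros u v [Hu Hv]. apply Hd.
    eapply Rle_lt_trans; [apply Cmod_le_Rabs |]. simpl in *.
    replace (u * cos v - 0 * sin v + - (r * cos t - 0 * sin t))%R with (u * cos v - r * cos t)%R by ring.
    replace (u * sin v + 0 * cos v + - (r * sin t + 0 * cos t))%R with (u * sin v - r * sin t)%R by ring.
    lra. }
  split; intros eps; generalize (Hc eps); apply locally_2d_impl, locally_2d_forall; intros u v H;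
    (eapply Rle_lt_trans; [| exact H]).
  - apply (fst_le_Cmod (f (polar u v) - f (polar r t))).
  - apply (snd_le_Cmod (f (polar u v) - f (polar r t))).
Qed.

Lemma continuous_on_circle (f : C -> C) (r t : R) (l : C) :
  Cderiv f (polar r t) l ->
  continuous (fun s => fst (f (polar r s))) t /\
  continuous (fun s => snd (f (polar r s))) t.
Proof.
  intros H. destruct (RCderiv_comp f _ t l _ H (RCderiv_circle r t)) as [H1 H2].
  split; apply (ex_derive_continuous (V := R_NormedModule)); eexists; eassumption.
Qed.

Lemma locally_01 (r : R) (P : R -> Prop) :
  (0 < r < 1)%R -> (forall s, (0 < s < 1)%R -> P s) -> locally r P.
Proof.
  intros Hr H. assert (Hm : (0 < Rmin r (1 - r))%R) by (apply Rmin_pos; lra).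
  exists (mkposreal _ Hm). intros s Hs. apply H.
  change (Rabs (s - r) < Rmin r (1 - r))%R in Hs.
  assert (H1 := Rmin_l r (1 - r)). assert (H2 := Rmin_r r (1 - r)).
  apply Rabs_lt_between in Hs. lra.
Qed.

Lemma ex_RInt_circle (F F' : C -> C) (r : R) :
  (forall z : C, z <> 0 -> inU z -> Cderiv F z (F' z)) ->
  (0 < r < 1)%R ->
  ex_RInt (fun t => fst (F (polar r t))) 0 (2 * PI).
Proof.
  intros F_deriv Hr. apply (ex_RInt_continuous (V := R_CompleteNormedModule)). intros t _.
  destruct (circle_punctured r t Hr) as [H0 H1].
  exact (proj1 (continuous_on_circle F r t _ (F_deriv _ H0 H1))).
Qed.

Lemma is_derive_radius (F F' : C -> C) (r t : R) :
  (forall z : C, z <> 0 -> inU z -> Cderiv F z (F' z)) ->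
  (0 < r < 1)%R ->
  is_derive (fun s => fst (F (polar s t))) r (fst (circ t * F' (polar r t))%C).
Proof.
  intros F_deriv Hr. destruct (circle_punctured r t Hr) as [H0 H1].
  exact (proj1 (RCderiv_comp F _ r _ _ (F_deriv _ H0 H1) (RCderiv_radius r t))).
Qed.

(* Cauchy-Riemann: the radial derivative of Re F is the tangential derivative of Im F / r,
   which integrates to zero over the circle. *)
Lemma is_derive_circle_mean (F F' : C -> C) (r : R) :
  (forall z : C, z <> 0 -> inU z -> Cderiv F z (F' z)) ->
  (forall z : C, z <> 0 -> inU z -> exists l, Cderiv F' z l) ->
  (0 < r < 1)%R ->
  is_derive (fun s => RInt (fun t => fst (F (polar s t))) 0 (2 * PI)) r 0%R.
Proof.
  intros F_deriv F'_deriv Hr.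
  assert (E : RInt (fun t => Derive (fun u => fst (F (polar u t))) r) 0 (2 * PI) = 0%R).
  { transitivity (RInt (fun t => fst (circ t * F' (polar r t))%C) 0 (2 * PI)).
    { apply RInt_ext. intros t _. apply is_derive_unique. now apply (is_derive_radius F F'). }
    apply is_RInt_unique.
    replace 0%R with (minus (snd (F (polar r (2 * PI))) / r) (snd (F (polar r 0)) / r))%R at 2.
    2:{ unfold polar, circ. rewrite cos_2PI, sin_2PI, cos_0, sin_0. apply (minus_eq_zero (G := R_AbelianGroup)). }
    apply (is_RInt_derive (V := R_CompleteNormedModule) (fun t => (snd (F (polar r t)) / r)%R)).
    - intros t _. destruct (circle_punctured r t Hr) as [H0 H1].
      destruct (RCderiv_comp F _ t _ _ (F_deriv _ H0 H1) (RCderiv_circle r t)) as [_ H].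
      (* The angular derivative of F is i r [circ t] F', whose imaginary part divided by r is the
         real part of [circ t] F', the radial derivative. *)
      replace (fst (circ t * F' (polar r t))%C)
        with (snd (Ci * polar r t * F' (polar r t))%C * / r)%R
        by (unfold polar; simpl; field; lra).
      apply (is_derive_ext (fun s => snd (F (polar r s)) * / r)%R); [reflexivity |].
      exact (is_derive_scal_l (V := R_NormedModule) _ _ _ (/ r)%R H).
    - intros t _. destruct (circle_punctured r t Hr) as [H0 H1].
      destruct (F'_deriv _ H0 H1) as [l Hl].
      destruct (continuous_on_circle F' r t l Hl) as [C1 C2].
      apply (continuous_minus (V := R_NormedModule)
        (fun s => cos s * fst (F' (polar r s)))%R (fun s => sin s * snd (F' (polar r s)))%R).
      + apply (continuous_mult (K := R_AbsRing) cos); [apply continuous_cos | exact C1].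
      + apply (continuous_mult (K := R_AbsRing) sin); [apply continuous_sin | exact C2]. }
  refine (eq_rect _ (fun u => is_derive (fun s => RInt (fun t => fst (F (polar s t))) 0 (2 * PI)) r u) _ _ E).
  apply (is_derive_RInt_param (fun s t => fst (F (polar s t)))).
  - apply locally_01; [exact Hr |]. intros s Hs t _. eexists. now apply (is_derive_radius F F').
  - intros t _.
    apply continuity_2d_pt_ext_loc with (fun u v => fst (circ v * F' (polar u v))%C).
    + destruct (locally_01 r (fun s => 0 < s < 1)%R Hr) as [d Hd]; [auto |].
      exists d. intros u v Hu _. symmetry. apply is_derive_unique, (is_derive_radius F F' u v F_deriv).
      apply Hd. exact Hu.
    + destruct (circle_punctured r t Hr) as [H0 H1].
      destruct (F'_deriv _ H0 H1) as [l Hl].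
      destruct (continuity_2d_polar F' r t l Hl) as [C1 C2].
      apply (continuity_2d_pt_minus (fun u v => cos v * fst (F' (polar u v)))%R
        (fun u v => sin v * snd (F' (polar u v)))%R).
      * apply continuity_2d_pt_mult; [| exact C1].
        apply (continuity_1d_2d_pt_comp cos (fun _ v => v)); [apply continuity_cos | apply continuity_2d_pt_id2].
      * apply continuity_2d_pt_mult; [| exact C2].
        apply (continuity_1d_2d_pt_comp sin (fun _ v => v)); [apply continuity_sin | apply continuity_2d_pt_id2].
  - apply locally_01; [exact Hr |]. intros s Hs. exact (ex_RInt_circle F F' s F_deriv Hs).
Qed.

(** The mean does not depend on the radius, and the growth bound drives it to 0 as the radius
    shrinks. Nothing is assumed at the origin itself, so products with negative powers of z
    qualify. *)
Lemma RInt_circle_zero (F F' : C -> C) (r K d : R) :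
  (forall z : C, z <> 0 -> inU z -> Cderiv F z (F' z)) ->
  (forall z : C, z <> 0 -> inU z -> exists l, Cderiv F' z l) ->
  (0 < r < 1)%R -> (0 < d)%R ->
  (forall z : C, z <> 0 -> (Cmod z < d)%R -> (Cmod (F z) <= K * Cmod z)%R) ->
  is_RInt (fun t => fst (F (polar r t))) 0 (2 * PI) 0%R.
Proof.
  intros F_deriv F'_deriv Hr Hd HK.
  set (M := fun s => RInt (fun t => fst (F (polar s t))) 0 (2 * PI)).
  assert (HP := PI_RGT_0).
  assert (Hconst : forall s, (0 < s < r)%R -> M s = M r).
  { intros s Hs. apply (eq_is_derive (V := R_NormedModule) M); [| lra].
    intros t Ht. apply (is_derive_circle_mean F F'); auto. lra. }
  assert (Hsmall : forall s, (0 < s < Rmin r d)%R -> (Rabs (M r) <= 2 * PI * K * s)%R).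
  { intros s Hs. assert (Hs1 := Rmin_l r d). assert (Hs2 := Rmin_r r d).
    rewrite <- (Hconst s) by lra.
    replace (2 * PI * K * s)%R with ((2 * PI - 0) * (K * s))%R by ring.
    apply (abs_RInt_le_const (fun t => fst (F (polar s t)))); [lra | apply (ex_RInt_circle F F'); auto; lra |].
    intros t _. eapply Rle_trans; [apply fst_le_Cmod |].
    rewrite <- (Cmod_circle s t) at 2 by lra.
    apply HK; [apply circle_punctured; lra |]. rewrite Cmod_circle; lra. }
  assert (Hm : (0 < Rmin r d)%R) by (apply Rmin_pos; lra).
  assert (HM : M r = 0%R).
  { destruct (Req_dec (M r) 0) as [H | H]; [exact H | exfalso].
    apply Rabs_pos_lt in H.
    (* A radius small enough that 2 pi K s <= |M r| / 2; [Rabs K + 1] keeps the denominator positive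
       for every [K]. *)
    set (s := Rmin (Rmin r d / 2) (Rabs (M r) / (2 * (2 * PI * (Rabs K + 1))))).
    assert (HKp := Rabs_pos K). assert (HKa := Rle_abs K).
    assert (Hden : (0 < 2 * PI * (Rabs K + 1))%R) by (apply Rmult_lt_0_compat; lra).
    assert (Hs0 : (0 < s)%R).
    { apply Rmin_pos; [lra |]. apply Rdiv_lt_0_compat; lra. }
    assert (Hs1 : (s <= Rmin r d / 2)%R) by apply Rmin_l.
    assert (Hs2 : (s * (2 * PI * (Rabs K + 1)) <= Rabs (M r) / 2)%R).
    { replace (Rabs (M r) / 2)%R
        with (Rabs (M r) / (2 * (2 * PI * (Rabs K + 1))) * (2 * PI * (Rabs K + 1)))%R by (field; lra).
      apply Rmult_le_compat_r; [lra | apply Rmin_r]. }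
    specialize (Hsmall s ltac:(lra)).
    assert (0 <= 2 * PI * s * (Rabs K + 1 - K))%R by (apply Rmult_le_pos; [apply Rmult_le_pos |]; lra). lra. }
  refine (eq_rect _ (fun u => is_RInt (fun t => fst (F (polar r t))) 0 (2 * PI) u) _ _ HM).
  apply (RInt_correct (V := R_CompleteNormedModule)). now apply (ex_RInt_circle F F').
Qed.

(** Stating existence and value of the integrals together lets means be combined linearly without
    separate integrability conditions. *)
Definition circle_mean (f : R -> C) (l : C) : Prop :=
  is_RInt (fun t => fst (f t)) 0 (2 * PI) (2 * PI * fst l)%R /\
  is_RInt (fun t => snd (f t)) 0 (2 * PI) (2 * PI * snd l)%R.

Lemma circle_mean_ext (f g : R -> C) (l : C) :
  (forall t, f t = g t) -> circle_mean f l -> circle_mean g l.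
Proof.
  intros E [H1 H2]. split.
  - apply is_RInt_ext with (2 := H1). intros t _. now rewrite E.
  - apply is_RInt_ext with (2 := H2). intros t _. now rewrite E.
Qed.

Lemma circle_mean_plus (f g : R -> C) (a b : C) :
  circle_mean f a -> circle_mean g b -> circle_mean (fun t => f t + g t) (a + b).
Proof.
  intros [H1 H2] [H3 H4]. split.
  - replace (2 * PI * fst (a + b)%C)%R with (plus (2 * PI * fst a) (2 * PI * fst b))%R
      by (unfold plus; simpl; ring).
    exact (is_RInt_plus (V := R_NormedModule) _ _ _ _ _ _ H1 H3).
  - replace (2 * PI * snd (a + b)%C)%R with (plus (2 * PI * snd a) (2 * PI * snd b))%R
      by (unfold plus; simpl; ring).
    exact (is_RInt_plus (V := R_NormedModule) _ _ _ _ _ _ H2 H4).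
Qed.

Lemma circle_mean_scal (c : C) (f : R -> C) (a : C) :
  circle_mean f a -> circle_mean (fun t => c * f t) (c * a).
Proof.
  intros [H1 H2]. split.
  - replace (2 * PI * fst (c * a)%C)%R
      with (minus (scal (fst c) (2 * PI * fst a)) (scal (snd c) (2 * PI * snd a)))%R
      by (unfold minus, plus, opp, scal; simpl; unfold mult; simpl; ring).
    exact (is_RInt_minus (V := R_NormedModule) _ _ _ _ _ _
      (is_RInt_scal (V := R_NormedModule) _ _ _ (fst c) _ H1)
      (is_RInt_scal (V := R_NormedModule) _ _ _ (snd c) _ H2)).
  - replace (2 * PI * snd (c * a)%C)%R
      with (plus (scal (fst c) (2 * PI * snd a)) (scal (snd c) (2 * PI * fst a)))%R
      by (unfold minus, plus, opp, scal; simpl; unfold mult; simpl; ring).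
    exact (is_RInt_plus (V := R_NormedModule) _ _ _ _ _ _
      (is_RInt_scal (V := R_NormedModule) _ _ _ (fst c) _ H2)
      (is_RInt_scal (V := R_NormedModule) _ _ _ (snd c) _ H1)).
Qed.

Lemma circle_mean_ge_0 (f : R -> C) (a : C) :
  (forall t, (0 <= fst (f t))%R) -> circle_mean f a -> (0 <= fst a)%R.
Proof.
  intros H [H1 _]. assert (HP := PI_RGT_0).
  assert (H0 : (0 <= 2 * PI * fst a)%R).
  { assert (Hz := is_RInt_const (V := R_NormedModule) 0 (2 * PI) 0%R).
    apply (is_RInt_le (fun _ => 0%R) (fun t => fst (f t)) 0 (2 * PI)); auto; [lra |].
    refine (eq_rect _ _ Hz _ _). unfold scal; simpl; unfold mult; simpl; ring. }
  nra.
Qed.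

Definition en (k : Z) (t : R) : C := circ (IZR k * t).

Lemma en_plus (j k : Z) (t : R) : en j t * en k t = en (j + k) t.
Proof.
  unfold en, circ. rewrite plus_IZR, Rmult_plus_distr_r, cos_plus, sin_plus.
  apply injective_projections; simpl; ring.
Qed.

Lemma en_0 (t : R) : en 0 t = 1.
Proof. unfold en, circ. rewrite Rmult_0_l, cos_0, sin_0. reflexivity. Qed.

Lemma Cconj_en (k : Z) (t : R) : Cconj (en k t) = en (- k) t.
Proof.
  unfold en, circ, Cconj. simpl. rewrite opp_IZR, Ropp_mult_distr_l_reverse, cos_neg, sin_neg.
  reflexivity.
Qed.

Lemma circ_pow (n : nat) (t : R) : circ t ^ n = en (Z.of_nat n) t.
Proof.
  induction n as [| n IH]; [now rewrite en_0 |].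
  rewrite Cpow_S, IH, Nat2Z.inj_succ, <- Z.add_1_l, <- en_plus. f_equal.
  unfold en. f_equal. ring.
Qed.

Lemma sin_2PI_Z (k : Z) : sin (IZR k * (2 * PI)) = 0%R.
Proof.
  replace (IZR k * (2 * PI))%R with (IZR (2 * k) * PI)%R by (rewrite mult_IZR; ring).
  apply sin_eq_0_1. now exists (2 * k)%Z.
Qed.

Lemma cos_2PI_Z (k : Z) : cos (IZR k * (2 * PI)) = 1%R.
Proof.
  replace (IZR k * (2 * PI))%R with (2 * (IZR k * PI))%R by ring.
  rewrite cos_2a_sin, (sin_eq_0_1 (IZR k * PI)) by now exists k. ring.
Qed.

Lemma circle_mean_en (k : Z) : k <> 0%Z -> circle_mean (en k) 0.
Proof.
  intros Hk. assert (HI : IZR k <> 0%R) by now apply not_0_IZR.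
  unfold en, circ. split; cbn [fst snd].
  - replace (2 * PI * fst (RtoC 0))%R with (minus (sin (IZR k * (2 * PI)) / IZR k) (sin (IZR k * 0) / IZR k))%R.
    + apply (is_RInt_derive (V := R_CompleteNormedModule) (fun t => sin (IZR k * t) / IZR k)%R).
      * intros t _. auto_derive; [exact I | field; exact HI].
      * intros t _. apply (ex_derive_continuous (V := R_NormedModule)). auto_derive. exact I.
    + rewrite sin_2PI_Z, Rmult_0_r, sin_0. unfold minus, plus, opp; simpl. field. exact HI.
  - replace (2 * PI * snd (RtoC 0))%R with (minus (- cos (IZR k * (2 * PI)) / IZR k) (- cos (IZR k * 0) / IZR k))%R.
    + apply (is_RInt_derive (V := R_CompleteNormedModule) (fun t => - cos (IZR k * t) / IZR k)%R).
      * intros t _. auto_derive; [exact I | field; exact HI].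
      * intros t _. apply (ex_derive_continuous (V := R_NormedModule)). auto_derive. exact I.
    + rewrite cos_2PI_Z, Rmult_0_r, cos_0. unfold minus, plus, opp; simpl. field. exact HI.
Qed.

Lemma circle_mean_en_0 : circle_mean (en 0) 1.
Proof.
  apply circle_mean_ext with (fun _ => RtoC 1); [intros t; now rewrite en_0 |].
  split; simpl.
  - replace (2 * PI * 1)%R with (scal (2 * PI - 0) 1)%R by (unfold scal; simpl; unfold mult; simpl; ring).
    apply (is_RInt_const (V := R_NormedModule)).
  - replace (2 * PI * 0)%R with (scal (2 * PI - 0) 0)%R by (unfold scal; simpl; unfold mult; simpl; ring).
    apply (is_RInt_const (V := R_NormedModule)).
Qed.

(** * Schur parameters of contractive Toeplitz matrices *)

(* Lower triangular Toeplitz matrices with the given first column are contractions. *)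
Definition contr2 (a0 a1 : C) : Prop := forall x0 x1 : C,
  (Cmod (a0 * x0) ^ 2 + Cmod (a0 * x1 + a1 * x0) ^ 2 <= Cmod x0 ^ 2 + Cmod x1 ^ 2)%R.

Definition contr3 (a0 a1 a2 : C) : Prop := forall x0 x1 x2 : C,
  (Cmod (a0 * x0) ^ 2 + Cmod (a0 * x1 + a1 * x0) ^ 2 + Cmod (a0 * x2 + a1 * x1 + a2 * x0) ^ 2
    <= Cmod x0 ^ 2 + Cmod x1 ^ 2 + Cmod x2 ^ 2)%R.

Definition contr4 (a0 a1 a2 a3 : C) : Prop := forall x0 x1 x2 x3 : C,
  (Cmod (a0 * x0) ^ 2 + Cmod (a0 * x1 + a1 * x0) ^ 2 + Cmod (a0 * x2 + a1 * x1 + a2 * x0) ^ 2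
    + Cmod (a0 * x3 + a1 * x2 + a2 * x1 + a3 * x0) ^ 2
    <= Cmod x0 ^ 2 + Cmod x1 ^ 2 + Cmod x2 ^ 2 + Cmod x3 ^ 2)%R.

Definition defect (a : C) : C := 1 - Cconj a * a.

Lemma defect_R (a : C) : defect a = RtoC (1 - Cmod a ^ 2).
Proof. unfold defect. rewrite RtoC_minus, RtoC_pow, <- RtoC_pow, Cmod2_conj. ring. Qed.

Lemma defect_neq_0 (a : C) : (Cmod a < 1)%R -> defect a <> 0.
Proof.
  intros H. rewrite defect_R. intros E. apply RtoC_inj in E.
  generalize (Cmod_ge_0 a). nra.
Qed.

(** The invariance identity of disc automorphisms. With v = A y, summed over coordinates, it carries
    contractivity of A to its Schur transform. *)
Lemma Cmod_mobius (a y v : C) :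
  (Cmod (y - Cconj a * v) ^ 2 - Cmod (v - a * y) ^ 2
    = (1 - Cmod a ^ 2) * (Cmod y ^ 2 - Cmod v ^ 2))%R.
Proof. rewrite !Cmod_sqr. destruct a, y, v. simpl. ring. Qed.

Lemma Cmod_pow2_0 (z : C) : (Cmod z ^ 2 <= 0)%R -> z = 0.
Proof. intros H. apply Cmod_eq_0. generalize (Cmod_ge_0 z). nra. Qed.

Lemma contr2_head (a0 a1 : C) : contr2 a0 a1 -> (Cmod a0 ^ 2 + Cmod a1 ^ 2 <= 1)%R.
Proof.
  intros H. specialize (H 1 0).
  replace (a0 * 1) with a0 in H by ring. replace (a0 * 0 + a1 * 1) with a1 in H by ring.
  rewrite Cmod_0, Cmod_1 in H. lra.
Qed.

Lemma contr3_head (a0 a1 a2 : C) :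
  contr3 a0 a1 a2 -> (Cmod a0 ^ 2 + Cmod a1 ^ 2 + Cmod a2 ^ 2 <= 1)%R.
Proof.
  intros H. specialize (H 1 0 0).
  replace (a0 * 1) with a0 in H by ring. replace (a0 * 0 + a1 * 1) with a1 in H by ring.
  replace (a0 * 0 + a1 * 0 + a2 * 1) with a2 in H by ring.
  rewrite Cmod_0, Cmod_1 in H. lra.
Qed.

Lemma contr4_head (a0 a1 a2 a3 : C) :
  contr4 a0 a1 a2 a3 -> (Cmod a0 ^ 2 + Cmod a1 ^ 2 + Cmod a2 ^ 2 + Cmod a3 ^ 2 <= 1)%R.
Proof.
  intros H. specialize (H 1 0 0 0).
  replace (a0 * 1) with a0 in H by ring. replace (a0 * 0 + a1 * 1) with a1 in H by ring.
  replace (a0 * 0 + a1 * 0 + a2 * 1) with a2 in H by ring.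
  replace (a0 * 0 + a1 * 0 + a2 * 0 + a3 * 1) with a3 in H by ring.
  rewrite Cmod_0, Cmod_1 in H. lra.
Qed.

(** Isolates the degenerate case of the Schur algorithm: if |a0| = 1 all later entries of the column
    vanish, and the next parameters can be taken to be 0. *)
Lemma Cmod_le_1_cases (a : C) (t : R) :
  (0 <= t)%R -> (Cmod a ^ 2 + t <= 1)%R -> (Cmod a < 1)%R \/ (Cmod a = 1%R /\ (t <= 0)%R).
Proof.
  intros Ht H. assert (H0 := Cmod_ge_0 a).
  destruct (Rlt_le_dec (Cmod a) 1) as [H1 | H1]; [now left | right].
  assert (Cmod a = 1)%R by nra. split; [assumption | nra].
Qed.

(* One step of the Schur algorithm: with A the Toeplitz matrix, (A - a0)(1 - conj(a0) A)^(-1)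
   is again a contraction, and it is strictly lower triangular. *)
Lemma contr2_step (a0 a1 : C) : contr2 a0 a1 ->
  exists b0, (Cmod a0 <= 1)%R /\ (Cmod b0 <= 1)%R /\ a1 = defect a0 * b0.
Proof.
  intros H. assert (Hh := contr2_head _ _ H).
  assert (P1 := pow2_ge_0 (Cmod a1)).
  destruct (Cmod_le_1_cases a0 (Cmod a1 ^ 2)) as [H1 | [H1 H2]]; [lra | lra | |].
  - assert (Hs := defect_neq_0 _ H1).
    exists (a1 / defect a0). repeat split; [lra | | field; exact Hs].
    set (s := defect a0) in *.
    (* The vector y solves (1 - conj(a0) A) y = (1, 0), and then (A - a0) y = (0, b0). Adding the
       two Möbius identities gives 1 - |b0|^2 = (1 - |a0|^2)(|y|^2 - |A y|^2) >= 0. *)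
    set (y0 := 1 / s). set (y1 := Cconj a0 * (a1 * y0) / s).
    specialize (H y0 y1).
    assert (M0 := Cmod_mobius a0 y0 (a0 * y0)).
    assert (M1 := Cmod_mobius a0 y1 (a0 * y1 + a1 * y0)).
    replace (y0 - Cconj a0 * (a0 * y0)) with (RtoC 1) in M0
      by (unfold y0, s, defect in *; field; exact Hs).
    replace (a0 * y0 - a0 * y0) with (RtoC 0) in M0 by ring.
    replace (y1 - Cconj a0 * (a0 * y1 + a1 * y0)) with (RtoC 0) in M1
      by (unfold y1, y0, s, defect in *; field; exact Hs).
    replace (a0 * y1 + a1 * y0 - a0 * y1) with (a1 / s) in M1 by (unfold y0; field; exact Hs).
    rewrite Cmod_0 in M0, M1. rewrite Cmod_1 in M0.
    assert (Hd : (0 < 1 - Cmod a0 ^ 2)%R) by (generalize (Cmod_ge_0 a0); nra).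
    assert (Hb := Cmod_ge_0 (a1 / s)). nra.
  - exists 0. rewrite Cmod_0. repeat split; [lra | lra |]. rewrite (Cmod_pow2_0 a1 H2). ring.
Qed.

(** The formulas are the coefficients of z and z^2 in (a0 + z b)/(1 + conj(a0) z b) with b = b0 + b1
    z, the inverse of the Schur transform. *)
Lemma contr3_step (a0 a1 a2 : C) : contr3 a0 a1 a2 ->
  exists b0 b1, (Cmod a0 <= 1)%R /\ contr2 b0 b1 /\ a1 = defect a0 * b0 /\
    a2 = defect a0 * (b1 - Cconj a0 * b0 * b0).
Proof.
  intros H. assert (Hh := contr3_head _ _ _ H).
  assert (P1 := pow2_ge_0 (Cmod a1)). assert (P2 := pow2_ge_0 (Cmod a2)).
  destruct (Cmod_le_1_cases a0 (Cmod a1 ^ 2 + Cmod a2 ^ 2)) as [H1 | [H1 H2]]; [lra | lra | |].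
  - assert (Hs := defect_neq_0 _ H1).
    exists (a1 / defect a0), ((a2 + Cconj a0 * (a1 / defect a0) * a1) / defect a0).
    split; [lra |]. split; [| split; field; exact Hs].
    intros x0 x1. set (s := defect a0) in *.
    (* Forward substitution in (1 - conj(a0) A) y = (x0, x1, 0). The trailing 0 matches the shift:
       (A - a0) y is 0 followed by the Toeplitz matrix of (b0, b1) applied to (x0, x1). *)
    set (y0 := x0 / s). set (y1 := (x1 + Cconj a0 * (a1 * y0)) / s).
    set (y2 := Cconj a0 * (a1 * y1 + a2 * y0) / s).
    specialize (H y0 y1 y2).
    assert (M0 := Cmod_mobius a0 y0 (a0 * y0)).
    assert (M1 := Cmod_mobius a0 y1 (a0 * y1 + a1 * y0)).
    assert (M2 := Cmod_mobius a0 y2 (a0 * y2 + a1 * y1 + a2 * y0)).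
    replace (y0 - Cconj a0 * (a0 * y0)) with x0 in M0
      by (unfold y0, s, defect in *; field; exact Hs).
    replace (a0 * y0 - a0 * y0) with (RtoC 0) in M0 by ring.
    replace (y1 - Cconj a0 * (a0 * y1 + a1 * y0)) with x1 in M1
      by (unfold y1, y0, s, defect in *; field; exact Hs).
    replace (a0 * y1 + a1 * y0 - a0 * y1) with (a1 / s * x0) in M1 by (unfold y0; field; exact Hs).
    replace (y2 - Cconj a0 * (a0 * y2 + a1 * y1 + a2 * y0)) with (RtoC 0) in M2
      by (unfold y2, y1, y0, s, defect in *; field; exact Hs).
    replace (a0 * y2 + a1 * y1 + a2 * y0 - a0 * y2)
      with (a1 / s * x1 + (a2 + Cconj a0 * (a1 / s) * a1) / s * x0) in M2
      by (unfold y1, y0; field; exact Hs).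
    rewrite Cmod_0 in M0, M2.
    assert (Hd : (0 < 1 - Cmod a0 ^ 2)%R) by (generalize (Cmod_ge_0 a0); nra). nra.
  - exists 0, 0. rewrite (Cmod_pow2_0 a1), (Cmod_pow2_0 a2) by lra.
    split; [lra |]. split; [| split; ring].
    intros x0 x1. replace (0 * x0) with (RtoC 0) by ring. replace (0 * x1 + 0) with (RtoC 0) by ring.
    rewrite Cmod_0. generalize (pow2_ge_0 (Cmod x0)) (pow2_ge_0 (Cmod x1)). lra.
Qed.

(** As for three coefficients, with the coefficient of z^3 in (a0 + z b)/(1 + conj(a0) z b)
    added. *)
Lemma contr4_step (a0 a1 a2 a3 : C) : contr4 a0 a1 a2 a3 ->
  exists b0 b1 b2, (Cmod a0 <= 1)%R /\ contr3 b0 b1 b2 /\ a1 = defect a0 * b0 /\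
    a2 = defect a0 * (b1 - Cconj a0 * b0 * b0) /\
    a3 = defect a0 * (b2 - Cconj a0 * (2 * b0 * b1 - Cconj a0 * b0 * b0 * b0)).
Proof.
  intros H. assert (Hh := contr4_head _ _ _ _ H).
  assert (P1 := pow2_ge_0 (Cmod a1)). assert (P2 := pow2_ge_0 (Cmod a2)).
  assert (P3 := pow2_ge_0 (Cmod a3)).
  destruct (Cmod_le_1_cases a0 (Cmod a1 ^ 2 + Cmod a2 ^ 2 + Cmod a3 ^ 2)) as [H1 | [H1 H2]]; [lra | lra | |].
  - assert (Hs := defect_neq_0 _ H1).
    set (s := defect a0) in *.
    set (b0 := a1 / s). set (b1 := (a2 + Cconj a0 * b0 * a1) / s).
    set (b2 := (a3 + Cconj a0 * (a1 * b1 + a2 * b0)) / s).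
    assert (E1 : a1 = s * b0) by (unfold b0; field; exact Hs).
    assert (E2 : a2 = s * (b1 - Cconj a0 * b0 * b0)) by (unfold b1, b0; field; exact Hs).
    assert (E3 : a3 = s * (b2 - Cconj a0 * (2 * b0 * b1 - Cconj a0 * b0 * b0 * b0)))
      by (unfold b2, b1, b0; field; exact Hs).
    exists b0, b1, b2.
    split; [lra |]. split; [| now split; [| split]].
    clearbody b0 b1 b2.
    intros x0 x1 x2.
    set (y0 := x0 / s). set (y1 := (x1 + Cconj a0 * (a1 * y0)) / s).
    set (y2 := (x2 + Cconj a0 * (a1 * y1 + a2 * y0)) / s).
    set (y3 := Cconj a0 * (a1 * y2 + a2 * y1 + a3 * y0) / s).
    specialize (H y0 y1 y2 y3).
    assert (M0 := Cmod_mobius a0 y0 (a0 * y0)).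
    assert (M1 := Cmod_mobius a0 y1 (a0 * y1 + a1 * y0)).
    assert (M2 := Cmod_mobius a0 y2 (a0 * y2 + a1 * y1 + a2 * y0)).
    assert (M3 := Cmod_mobius a0 y3 (a0 * y3 + a1 * y2 + a2 * y1 + a3 * y0)).
    assert (Es : Cconj a0 * a0 = 1 - s) by (unfold s, defect; ring).
    replace (y0 - Cconj a0 * (a0 * y0)) with (y0 - Cconj a0 * a0 * y0) in M0 by ring.
    replace (y1 - Cconj a0 * (a0 * y1 + a1 * y0))
      with (y1 - Cconj a0 * a0 * y1 - Cconj a0 * (a1 * y0)) in M1 by ring.
    replace (y2 - Cconj a0 * (a0 * y2 + a1 * y1 + a2 * y0))
      with (y2 - Cconj a0 * a0 * y2 - Cconj a0 * (a1 * y1 + a2 * y0)) in M2 by ring.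
    replace (y3 - Cconj a0 * (a0 * y3 + a1 * y2 + a2 * y1 + a3 * y0))
      with (y3 - Cconj a0 * a0 * y3 - Cconj a0 * (a1 * y2 + a2 * y1 + a3 * y0)) in M3 by ring.
    rewrite Es in M0, M1, M2, M3.
    replace (y0 - (1 - s) * y0) with x0 in M0 by (unfold y0; field; exact Hs).
    replace (y1 - (1 - s) * y1 - Cconj a0 * (a1 * y0)) with x1 in M1 by (unfold y1; field; exact Hs).
    replace (y2 - (1 - s) * y2 - Cconj a0 * (a1 * y1 + a2 * y0)) with x2 in M2
      by (unfold y2; field; exact Hs).
    replace (y3 - (1 - s) * y3 - Cconj a0 * (a1 * y2 + a2 * y1 + a3 * y0)) with (RtoC 0) in M3
      by (unfold y3; field; exact Hs).
    replace (a0 * y0 - a0 * y0) with (RtoC 0) in M0 by ring.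
    assert (Y1 : y1 = x1 / s + Cconj a0 * b0 * y0) by (unfold y1; rewrite E1; field; exact Hs).
    assert (Y2 : y2 = x2 / s + Cconj a0 * (b0 * y1 + (b1 - Cconj a0 * b0 * b0) * y0))
      by (unfold y2; rewrite E1, E2; field; exact Hs).
    replace (a0 * y1 + a1 * y0 - a0 * y1) with (b0 * x0) in M1
      by (rewrite E1; unfold y0; field; exact Hs).
    replace (a0 * y2 + a1 * y1 + a2 * y0 - a0 * y2) with (b0 * x1 + b1 * x0) in M2
      by (rewrite E1, E2, Y1; unfold y0; field; exact Hs).
    replace (a0 * y3 + a1 * y2 + a2 * y1 + a3 * y0 - a0 * y3) with (b0 * x2 + b1 * x1 + b2 * x0) in M3
      by (rewrite E1, E2, E3, Y2, Y1; unfold y0; field; exact Hs).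
    rewrite Cmod_0 in M0, M3.
    assert (Hd : (0 < 1 - Cmod a0 ^ 2)%R) by (generalize (Cmod_ge_0 a0); nra). nra.
  - exists 0, 0, 0. rewrite (Cmod_pow2_0 a1), (Cmod_pow2_0 a2), (Cmod_pow2_0 a3) by lra.
    split; [lra |]. split; [| split; [| split]; ring].
    intros x0 x1 x2. replace (0 * x0) with (RtoC 0) by ring. replace (0 * x1 + 0) with (RtoC 0) by ring.
    replace (0 * x2 + 0 * x1 + 0) with (RtoC 0) by ring.
    rewrite Cmod_0. generalize (pow2_ge_0 (Cmod x0)) (pow2_ge_0 (Cmod x1)) (pow2_ge_0 (Cmod x2)). lra.
Qed.

Lemma Cmod_minus_le (a b : C) : (Cmod (a - b) <= Cmod a + Cmod b)%R.
Proof. rewrite <- (Cmod_opp b). apply Cmod_triangle. Qed.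

Lemma Cmod_defect (a : C) : (Cmod a <= 1)%R -> Cmod (defect a) = (1 - Cmod a ^ 2)%R.
Proof.
  intros H. rewrite defect_R, Cmod_R. apply Rabs_right. generalize (Cmod_ge_0 a). nra.
Qed.

(** Here x, y, u are the moduli of the first three Schur parameters. The fourth enters only a3,
    linearly with weight 1 - u^2, and is replaced by its bound 1. *)
Lemma schur_bounds (a0 a1 a2 a3 : C) : contr4 a0 a1 a2 a3 ->
  exists x y u : R, Cmod a0 = x /\ (0 <= x <= 1)%R /\ (0 <= y <= 1)%R /\ (0 <= u <= 1)%R /\
    (Cmod a1 <= (1 - x ^ 2) * y)%R /\
    (Cmod a2 <= (1 - x ^ 2) * ((1 - y ^ 2) * u + x * y ^ 2))%R /\
    (Cmod a3 <= (1 - x ^ 2) * ((1 - y ^ 2) * (1 - u ^ 2 + y * u ^ 2)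
      + x * (2 * y * ((1 - y ^ 2) * u) + x * y ^ 3)))%R.
Proof.
  intros H.
  destruct (contr4_step _ _ _ _ H) as (b0 & b1 & b2 & Ha & Hb & -> & -> & ->). clear H.
  destruct (contr3_step _ _ _ Hb) as (g0 & g1 & Hb0 & Hg & -> & ->). clear Hb.
  destruct (contr2_step _ _ Hg) as (h & Hg0 & Hh & ->). clear Hg.
  exists (Cmod a0), (Cmod b0), (Cmod g0).
  assert (X0 := Cmod_ge_0 a0). assert (Y0 := Cmod_ge_0 b0). assert (U0 := Cmod_ge_0 g0).
  assert (Dx := Cmod_defect a0 Ha). assert (Dy := Cmod_defect b0 Hb0). assert (Du := Cmod_defect g0 Hg0).
  assert (Px : (0 <= 1 - Cmod a0 ^ 2)%R) by nra. assert (Py : (0 <= 1 - Cmod b0 ^ 2)%R) by nra.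
  assert (Pu : (0 <= 1 - Cmod g0 ^ 2)%R) by nra.
  repeat split; try assumption.
  - rewrite Cmod_mult, Dx. lra.
  - rewrite Cmod_mult, Dx. apply Rmult_le_compat_l; [exact Px |].
    eapply Rle_trans; [apply Cmod_minus_le |]. rewrite !Cmod_mult, Dy, Cmod_conj. right. ring.
  - rewrite Cmod_mult, Dx. apply Rmult_le_compat_l; [exact Px |].
    eapply Rle_trans; [apply Cmod_minus_le |]. apply Rplus_le_compat.
    + rewrite Cmod_mult, Dy. apply Rmult_le_compat_l; [exact Py |].
      eapply Rle_trans; [apply Cmod_minus_le |]. rewrite !Cmod_mult, Du, Cmod_conj.
      assert ((1 - Cmod g0 ^ 2) * Cmod h <= 1 - Cmod g0 ^ 2)%R by nra. lra.
    + rewrite Cmod_mult, Cmod_conj. apply Rmult_le_compat_l; [exact X0 |].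
      eapply Rle_trans; [apply Cmod_minus_le |]. rewrite !Cmod_mult, Dy, Cmod_conj, Cmod_R.
      rewrite (Rabs_right 2) by lra. right. ring.
Qed.

(** * Polynomial inequalities in the moduli of the Schur parameters *)

Lemma real_bound_3 (x y u : R) :
  (0 <= x <= 1)%R -> (0 <= y <= 1)%R -> (0 <= u <= 1)%R ->
  ((1 - x ^ 2) * ((1 - y ^ 2) * u + x * y ^ 2) + x * ((1 - x ^ 2) * y) / 3 + x ^ 3 / 12 <= 1)%R.
Proof.
  intros Hx Hy Hu.
  (* This removes y: with u <= 1 the factor of 1 - x^2 is then at most 1 + (11/12) x^2. The product
     is 1 - x^2/12 - (11/12) x^4, and -x^2/12 absorbs the last term x^3/12. *)
  assert (H1 : (x * y / 3 <= 11 / 12 * x ^ 2 + y ^ 2 * (1 - x))%R).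
  { destruct (Rle_lt_dec x (1 / 2)) as [H | H].
    - assert (0 <= (x - 2 / 11 * y) ^ 2)%R by apply pow2_ge_0.
      assert (0 <= y ^ 2 * (1 / 2 - x))%R by (apply Rmult_le_pos; [apply pow2_ge_0 | lra]).
      assert (0 <= y ^ 2)%R by apply pow2_ge_0. lra.
    - assert (0 <= y ^ 2 * (1 - x))%R by (apply Rmult_le_pos; [apply pow2_ge_0 | lra]).
      assert (0 <= x * (1 - y))%R by (apply Rmult_le_pos; lra).
      assert (0 <= x * (x - 1 / 2))%R by (apply Rmult_le_pos; lra). nra. }
  assert (Hp : (0 <= 1 - x ^ 2)%R) by nra.
  assert (H2 : (0 <= (1 - y ^ 2) * (1 - u))%R) by (apply Rmult_le_pos; nra).
  assert (H3 : ((1 - x ^ 2) * ((1 - y ^ 2) * u + x * y ^ 2 + x * y / 3) <= (1 - x ^ 2) * (1 + 11 / 12 * x ^ 2))%R)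
    by (apply Rmult_le_compat_l; lra).
  assert (H4 : (0 <= x ^ 2 * (1 - x))%R) by (apply Rmult_le_pos; nra).
  assert (H5 : (0 <= x ^ 4)%R) by (apply pow_le; lra).
  lra.
Qed.

(* For fixed y this concerns a quadratic form in (x, u).  Since x, u <= 1 the term in y^2 can be made
   homogeneous; on each of the cones u <= x and x <= u the square of the smaller variable is
   minorized by a tangent (by a chord if its coefficient is negative). *)
Lemma real_form_bound (x y u : R) :
  (0 <= x <= 1)%R -> (0 <= y <= 1)%R -> (0 <= u <= 1)%R ->
  ((1 - y ^ 2) * (2 * y + 1 / 3) * (x * u)
    <= (1 - y ^ 3 - y ^ 2 / 6 - y / 4) * x ^ 2 + (1 - y ^ 2) * (1 - y) * u ^ 2 + 5 / 6 * y ^ 2)%R.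
Proof.
  intros Hx Hy Hu.
  set (a := (1 - y ^ 3 - y ^ 2 / 6 - y / 4)%R). set (b := ((1 - y ^ 2) * (1 - y))%R).
  set (c := ((1 - y ^ 2) * (2 * y + 1 / 3))%R). set (d := (5 / 6 * y ^ 2)%R).
  assert (Hy2 : (0 <= 1 - y ^ 2)%R) by nra. assert (Hy3 : (0 <= y ^ 2)%R) by apply pow2_ge_0.
  assert (Hb : (0 <= b)%R) by (unfold b; apply Rmult_le_pos; lra).
  assert (Hd : (0 <= d)%R) by (unfold d; nra).
  (* The sum is 2 y^3 - (13/4) y + 5/3, minimal at sqrt(13/24), about 0.736. The hint is a cubic 2
     y^3 - 6 t^2 y + 4 t^3 with double root t near that point. *)
  assert (G : (1 / 20 <= a + b - c + d)%R).
  { unfold a, b, c, d. assert (0 <= (y - 736 / 1000) ^ 2 * (2 * y + 4 * (736 / 1000)))%R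
      by (apply Rmult_le_pos; [apply pow2_ge_0 | lra]). nra. }
  destruct (Rle_lt_dec u x) as [Hux | Hux].
  - assert (H1 : (0 <= a + d - b)%R).
    { unfold a, b, d. replace (_ - _)%R with (y * (3 / 4 + 5 / 3 * y - 2 * y ^ 2))%R by field.
      apply Rmult_le_pos; nra. }
    assert (0 <= b * (u - x) ^ 2)%R by (apply Rmult_le_pos; [exact Hb | apply pow2_ge_0]).
    assert (0 <= d * (1 - x ^ 2))%R by (apply Rmult_le_pos; nra).
    assert (0 <= x * (x - u) * (a + d - b))%R by (repeat apply Rmult_le_pos; lra).
    assert (0 <= x * u * (a + b - c + d))%R by (repeat apply Rmult_le_pos; lra).
    nra.
  - assert (0 <= d * (1 - u ^ 2))%R by (apply Rmult_le_pos; nra).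
    destruct (Rle_lt_dec 0 a) as [Ha | Ha].
    (* A tangent to x^2 at x = u would leave b + d - a = 2 y^3 - (3/4) y, negative for small y; the
       tangent at x = (7/10) u gives up 49/100 and 9/100 of a instead. The points 9/20 and 179/250
       lie near the minima of the two resulting cubics. *)
    + assert (H1 : (0 <= b + d - 49 / 100 * a)%R).
      { unfold a, b, d. assert (0 <= (y - 9 / 20) ^ 2 * (y + 2 * (9 / 20)))%R
          by (apply Rmult_le_pos; [apply pow2_ge_0 | lra]). lra. }
      assert (H2 : (0 <= a + b - c + d - 9 / 100 * a)%R).
      { unfold a, b, c, d. assert (0 <= (y - 179 / 250) ^ 2 * (y + 2 * (179 / 250)))%R
          by (apply Rmult_le_pos; [apply pow2_ge_0 | lra]). lra. }
      assert (0 <= a * (x - 7 / 10 * u) ^ 2)%R by (apply Rmult_le_pos; [exact Ha | apply pow2_ge_0]).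
      assert (0 <= u * (u - x) * (b + d - 49 / 100 * a))%R by (repeat apply Rmult_le_pos; lra).
      assert (0 <= x * u * (a + b - c + d - 9 / 100 * a))%R by (repeat apply Rmult_le_pos; lra).
      nra.
    + assert (0 <= - a * (x * (u - x)))%R by (repeat apply Rmult_le_pos; lra).
      assert (0 <= u * (u - x) * (b + d))%R by (repeat apply Rmult_le_pos; lra).
      assert (0 <= x * u * (a + b - c + d))%R by (repeat apply Rmult_le_pos; lra).
      nra.
Qed.

(** All terms but the last contain 1 - x^2, and [real_form_bound] says precisely that the cofactor
    is at most 1 + x^2. This leaves 1 - x^4 + (19/360) x^4. *)
Lemma real_bound_4 (x y u : R) :
  (0 <= x <= 1)%R -> (0 <= y <= 1)%R -> (0 <= u <= 1)%R ->
  ((1 - x ^ 2) * ((1 - y ^ 2) * (1 - u ^ 2 + y * u ^ 2) + x * (2 * y * ((1 - y ^ 2) * u) + x * y ^ 3))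
    + x * ((1 - x ^ 2) * ((1 - y ^ 2) * u + x * y ^ 2)) / 3 + ((1 - x ^ 2) * y) ^ 2 / 6
    + x ^ 2 * ((1 - x ^ 2) * y) / 4 + 19 / 360 * x ^ 4 <= 1)%R.
Proof.
  intros Hx Hy Hu. assert (H := real_form_bound x y u Hx Hy Hu).
  assert (Hp : (0 <= 1 - x ^ 2)%R) by nra.
  apply (Rmult_le_compat_l _ _ _ Hp) in H.
  assert (0 <= x ^ 4)%R by (apply pow_le; lra).
  nra.
Qed.

Lemma Cmod_scal_R (k : R) (z : C) : (0 <= k)%R -> Cmod (RtoC k * z) = (k * Cmod z)%R.
Proof. intros H. rewrite Cmod_mult, Cmod_R, Rabs_right; lra. Qed.

(** This and the next three lemmas bound the coefficients of z, ..., z^4 in w - w^2/6 + w^3/12 -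
    (19/360) w^4 with w = a0 z + a1 z^2 + a2 z^3 + a3 z^4, the Taylor polynomial of 2 (Psi(w) -
    1). *)
Lemma schwarz_coef_1 (a0 a1 a2 a3 : C) : contr4 a0 a1 a2 a3 -> (Cmod a0 <= 1)%R.
Proof.
  intros H. destruct (schur_bounds _ _ _ _ H) as (x & y & u & -> & Hx & _). lra.
Qed.

Lemma schwarz_coef_2 (a0 a1 a2 a3 : C) :
  contr4 a0 a1 a2 a3 -> (Cmod (a1 - RtoC (1 / 6) * a0 ^ 2) <= 1)%R.
Proof.
  intros H. destruct (schur_bounds _ _ _ _ H) as (x & y & u & E & Hx & Hy & Hu & H1 & _).
  eapply Rle_trans; [apply Cmod_minus_le |]. rewrite Cmod_scal_R, Cmod_pow, E by lra.
  assert (0 <= (1 - x ^ 2) * (1 - y))%R by (apply Rmult_le_pos; nra).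
  assert (0 <= x ^ 2)%R by apply pow2_ge_0. lra.
Qed.

Lemma schwarz_coef_3 (a0 a1 a2 a3 : C) :
  contr4 a0 a1 a2 a3 ->
  (Cmod (a2 - RtoC (1 / 3) * (a0 * a1) + RtoC (1 / 12) * a0 ^ 3) <= 1)%R.
Proof.
  intros H. destruct (schur_bounds _ _ _ _ H) as (x & y & u & E & Hx & Hy & Hu & H1 & H2 & _).
  eapply Rle_trans; [| exact (real_bound_3 x y u Hx Hy Hu)].
  eapply Rle_trans; [apply Cmod_triangle |]. apply Rplus_le_compat.
  2:{ rewrite Cmod_scal_R, Cmod_pow, E by lra. right. field. }
  eapply Rle_trans; [apply Cmod_minus_le |]. apply Rplus_le_compat; [exact H2 |].
  rewrite Cmod_scal_R, Cmod_mult, E by lra.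
  assert (x * Cmod a1 <= x * ((1 - x ^ 2) * y))%R by (apply Rmult_le_compat_l; lra). lra.
Qed.

Lemma schwarz_coef_4 (a0 a1 a2 a3 : C) :
  contr4 a0 a1 a2 a3 ->
  (Cmod (a3 - RtoC (1 / 3) * (a0 * a2) - RtoC (1 / 6) * a1 ^ 2 + RtoC (1 / 4) * (a0 ^ 2 * a1)
    - RtoC (19 / 360) * a0 ^ 4) <= 1)%R.
Proof.
  intros H. destruct (schur_bounds _ _ _ _ H) as (x & y & u & E & Hx & Hy & Hu & H1 & H2 & H3).
  eapply Rle_trans; [| exact (real_bound_4 x y u Hx Hy Hu)].
  eapply Rle_trans; [apply Cmod_minus_le |]. apply Rplus_le_compat.
  2:{ rewrite Cmod_scal_R, Cmod_pow, E by lra. right. field. }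
  eapply Rle_trans; [apply Cmod_triangle |]. apply Rplus_le_compat.
  2:{ rewrite Cmod_scal_R, Cmod_mult, Cmod_pow, E by lra.
      assert (x ^ 2 * Cmod a1 <= x ^ 2 * ((1 - x ^ 2) * y))%R by (apply Rmult_le_compat_l; nra). lra. }
  eapply Rle_trans; [apply Cmod_minus_le |]. apply Rplus_le_compat.
  2:{ rewrite Cmod_scal_R, Cmod_pow by lra.
      assert (Cmod a1 ^ 2 <= ((1 - x ^ 2) * y) ^ 2)%R
        by (apply pow_incr; split; [apply Cmod_ge_0 | exact H1]). lra. }
  eapply Rle_trans; [apply Cmod_minus_le |]. apply Rplus_le_compat; [exact H3 |].
  rewrite Cmod_scal_R, Cmod_mult, E by lra.
  assert (x * Cmod a2 <= x * ((1 - x ^ 2) * ((1 - y ^ 2) * u + x * y ^ 2)))%R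
    by (apply Rmult_le_compat_l; lra). lra.
Qed.

(** * Bessel's inequality for trigonometric polynomials *)

Definition trig4 (x0 x1 x2 x3 : C) (t : R) : C :=
  x0 * en 0 t + x1 * en 1 t + x2 * en 2 t + x3 * en 3 t.

Lemma circle_mean_en_eqb (k : Z) : circle_mean (en k) (if Z.eqb k 0 then 1 else 0).
Proof.
  destruct (Z.eqb_spec k 0) as [-> | Hk]; [exact circle_mean_en_0 | now apply circle_mean_en].
Qed.

Lemma circle_mean_trig4 (u : R -> C) (v : Z -> C) (x0 x1 x2 x3 : C) (k : Z) :
  (forall j, (0 <= j <= 3)%Z -> circle_mean (fun t => u t * en (j + k) t) (v (j + k)%Z)) ->
  circle_mean (fun t => u t * trig4 x0 x1 x2 x3 t * en k t)
    (x0 * v (0 + k)%Z + x1 * v (1 + k)%Z + x2 * v (2 + k)%Z + x3 * v (3 + k)%Z).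
Proof.
  intros H.
  apply circle_mean_ext with (fun t => x0 * (u t * en (0 + k) t) + x1 * (u t * en (1 + k) t)
    + x2 * (u t * en (2 + k) t) + x3 * (u t * en (3 + k) t)).
  - intros t. unfold trig4. rewrite <- !en_plus. ring.
  - apply circle_mean_plus; [apply circle_mean_plus; [apply circle_mean_plus |] |];
      apply circle_mean_scal, H; lia.
Qed.

Lemma circle_mean_conj_trig4 (u : R -> C) (v : Z -> C) (y0 y1 y2 y3 : C) :
  (forall k, (0 <= k <= 3)%Z -> circle_mean (fun t => u t * en (- k) t) (v k)) ->
  circle_mean (fun t => u t * Cconj (trig4 y0 y1 y2 y3 t))
    (Cconj y0 * v 0%Z + Cconj y1 * v 1%Z + Cconj y2 * v 2%Z + Cconj y3 * v 3%Z).
Proof.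
  intros H.
  apply circle_mean_ext with (fun t => Cconj y0 * (u t * en (- 0) t) + Cconj y1 * (u t * en (- (1)) t)
    + Cconj y2 * (u t * en (- (2)) t) + Cconj y3 * (u t * en (- (3)) t)).
  - intros t. unfold trig4. rewrite !Cplus_conj, !Cmult_conj, !Cconj_en. ring.
  - apply circle_mean_plus; [apply circle_mean_plus; [apply circle_mean_plus |] |];
      apply circle_mean_scal, H; lia.
Qed.

Lemma circle_mean_trig4_coef (x0 x1 x2 x3 : C) (k : Z) :
  circle_mean (fun t => trig4 x0 x1 x2 x3 t * en (- k) t)
    (if Z.eqb k 0 then x0 else if Z.eqb k 1 then x1 else if Z.eqb k 2 then x2
     else if Z.eqb k 3 then x3 else 0).
Proof.
  assert (H := circle_mean_trig4 (fun _ => 1) (fun j => if Z.eqb j 0 then 1 else 0) x0 x1 x2 x3 (- k)).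
  cbv beta in H.
  match goal with |- circle_mean _ ?l =>
    replace l with (x0 * (if Z.eqb (0 + - k) 0 then 1 else 0) + x1 * (if Z.eqb (1 + - k) 0 then 1 else 0)
      + x2 * (if Z.eqb (2 + - k) 0 then 1 else 0) + x3 * (if Z.eqb (3 + - k) 0 then 1 else 0)) end.
  - eapply circle_mean_ext; [| apply H].
    + intros t. cbv beta. ring.
    + intros j _. eapply circle_mean_ext; [| apply circle_mean_en_eqb].
      intros t. cbv beta. ring.
  - clear H. destruct (Z.eqb_spec k 0) as [-> | H0]; [simpl; ring |].
    destruct (Z.eqb_spec k 1) as [-> | H1]; [simpl; ring |].
    destruct (Z.eqb_spec k 2) as [-> | H2]; [simpl; ring |].
    destruct (Z.eqb_spec k 3) as [-> | H3]; [simpl; ring |].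
    replace (Z.eqb (0 + - k) 0) with false by (symmetry; apply Z.eqb_neq; lia).
    replace (Z.eqb (1 + - k) 0) with false by (symmetry; apply Z.eqb_neq; lia).
    replace (Z.eqb (2 + - k) 0) with false by (symmetry; apply Z.eqb_neq; lia).
    replace (Z.eqb (3 + - k) 0) with false by (symmetry; apply Z.eqb_neq; lia).
    ring.
Qed.

(* Bessel: h = trig4 B is the projection of u = W e^(-it) q on the frequencies 0..3, so
   |B|^2 <= mean |u|^2 <= mean |q|^2 = |x|^2. *)
Lemma bessel_contr4 (W : R -> C) (mu : Z -> C) :
  (forall t, (Cmod (W t) <= 1)%R) ->
  (forall k, (-2 <= k <= 4)%Z -> circle_mean (fun t => W t * en (- k) t) (mu k)) ->
  (forall k, (k <= 0)%Z -> mu k = 0) ->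
  contr4 (mu 1%Z) (mu 2%Z) (mu 3%Z) (mu 4%Z).
Proof.
  intros HW Hmu Hmu0 x0 x1 x2 x3.
  set (c1 := mu 1%Z). set (c2 := mu 2%Z). set (c3 := mu 3%Z). set (c4 := mu 4%Z).
  set (B0 := c1 * x0). set (B1 := c1 * x1 + c2 * x0). set (B2 := c1 * x2 + c2 * x1 + c3 * x0).
  set (B3 := c1 * x3 + c2 * x2 + c3 * x1 + c4 * x0).
  set (q := trig4 x0 x1 x2 x3). set (h := trig4 B0 B1 B2 B3).
  set (u := fun t => W t * en (- (1)) t * q t).
  set (vB := fun k => if Z.eqb k 0 then B0 else if Z.eqb k 1 then B1 else if Z.eqb k 2 then B2
     else if Z.eqb k 3 then B3 else 0).
  set (vx := fun k => if Z.eqb k 0 then x0 else if Z.eqb k 1 then x1 else if Z.eqb k 2 then x2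
     else if Z.eqb k 3 then x3 else 0).
  (* Frequency k of u collects the coefficients mu(1 - j + k) with j, k in 0..3, hence the range
     -2..4. Vanishing at indices <= 0 makes the matrix lower triangular. *)
  assert (Hu : forall k, (0 <= k <= 3)%Z -> circle_mean (fun t => u t * en (- k) t) (vB k)).
  { intros k Hk.
    assert (H := circle_mean_trig4 (fun t => W t * en (- (1)) t) (fun j => mu (1 - j)%Z) x0 x1 x2 x3 (- k)).
    replace (vB k) with (x0 * mu (1 - (0 + - k))%Z + x1 * mu (1 - (1 + - k))%Z
      + x2 * mu (1 - (2 + - k))%Z + x3 * mu (1 - (3 + - k))%Z).
    - apply H. intros j Hj. eapply circle_mean_ext; [| apply (Hmu (1 - (j + - k))%Z); lia].
      intros t. cbv beta. rewrite <- Cmult_assoc, en_plus. do 2 f_equal. lia.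
    - assert (Hk' : (k = 0 \/ k = 1 \/ k = 2 \/ k = 3)%Z) by lia.
      destruct Hk' as [-> | [-> | [-> | ->]]]; unfold vB, B0, B1, B2, B3; simpl;
        rewrite ?(Hmu0 0%Z), ?(Hmu0 (-1)%Z), ?(Hmu0 (-2)%Z) by lia; fold c1 c2 c3 c4; ring. }
  assert (Hh := circle_mean_conj_trig4 h vB B0 B1 B2 B3 (fun k _ => circle_mean_trig4_coef B0 B1 B2 B3 k)).
  assert (Hq := circle_mean_conj_trig4 q vx x0 x1 x2 x3 (fun k _ => circle_mean_trig4_coef x0 x1 x2 x3 k)).
  assert (Huh := circle_mean_conj_trig4 u vB B0 B1 B2 B3 Hu).
  fold h in Huh, Hh. fold q in Hq.
  (* The integrand |q|^2 + |h|^2 - 2 u conj(h) has real part at least |u - h|^2 >= 0, because |u| <=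
     |q|. Its mean is |x|^2 + |B|^2 - 2 |B|^2. *)
  assert (HT := circle_mean_plus _ _ _ _ (circle_mean_plus _ _ _ _ Hq Hh) (circle_mean_scal (- (2)) _ _ Huh)).
  apply circle_mean_ge_0 in HT.
  - change (vB 0%Z) with B0 in HT. change (vB 1%Z) with B1 in HT. change (vB 2%Z) with B2 in HT.
    change (vB 3%Z) with B3 in HT. change (vx 0%Z) with x0 in HT. change (vx 1%Z) with x1 in HT.
    change (vx 2%Z) with x2 in HT. change (vx 3%Z) with x3 in HT.
    rewrite !Cmod_sqr. clearbody B0 B1 B2 B3. clear -HT. simpl in *. lra.
  - intros t. clear HT.
    assert (Hle : (Cmod (u t) ^ 2 <= Cmod (q t) ^ 2)%R).
    { apply pow_incr. split; [apply Cmod_ge_0 |]. unfold u. rewrite !Cmod_mult.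
      unfold en at 1. rewrite Cmod_circ. generalize (HW t) (Cmod_ge_0 (W t)) (Cmod_ge_0 (q t)). nra. }
    assert (Hd := pow2_ge_0 (Cmod (u t - h t))).
    rewrite Cmod_sqr in Hd, Hle. rewrite (Cmod_sqr (q t)) in Hle.
    destruct (u t) as [u1 u2], (q t) as [q1 q2], (h t) as [h1 h2]. clear -Hd Hle. simpl in *. lra.
Qed.

(** * Taylor coefficients of the Schwarz function *)

(** The condition [d <= 1] keeps the ball inside the disc and makes lowering the exponent
    legitimate. *)
Definition bigO (n : nat) (f : C -> C) : Prop :=
  exists K d : R, (0 <= K)%R /\ (0 < d <= 1)%R /\
    forall z, (Cmod z < d)%R -> (Cmod (f z) <= K * Cmod z ^ n)%R.

Lemma bigO_plus (n : nat) (f g : C -> C) :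
  bigO n f -> bigO n g -> bigO n (fun z => f z + g z).
Proof.
  intros (K1 & d1 & P1 & Q1 & H1) (K2 & d2 & P2 & Q2 & H2).
  exists (K1 + K2)%R, (Rmin d1 d2). assert (M1 := Rmin_l d1 d2). assert (M2 := Rmin_r d1 d2).
  split; [lra |]. split; [split; [apply Rmin_pos |]; lra |].
  intros z Hz. eapply Rle_trans; [apply Cmod_triangle |].
  specialize (H1 z ltac:(lra)). specialize (H2 z ltac:(lra)). lra.
Qed.

Lemma bigO_mult (m n : nat) (f g : C -> C) :
  bigO m f -> bigO n g -> bigO (m + n) (fun z => f z * g z).
Proof.
  intros (K1 & d1 & P1 & Q1 & H1) (K2 & d2 & P2 & Q2 & H2).
  exists (K1 * K2)%R, (Rmin d1 d2). assert (M1 := Rmin_l d1 d2). assert (M2 := Rmin_r d1 d2).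
  split; [now apply Rmult_le_pos |]. split; [split; [apply Rmin_pos |]; lra |].
  intros z Hz. rewrite Cmod_mult.
  replace (K1 * K2 * Cmod z ^ (m + n))%R with ((K1 * Cmod z ^ m) * (K2 * Cmod z ^ n))%R
    by (rewrite pow_add; ring).
  apply Rmult_le_compat; try apply Cmod_ge_0; [apply H1 | apply H2]; lra.
Qed.

Lemma bigO_ext (n : nat) (f g : C -> C) : (forall z, inU z -> f z = g z) -> bigO n f -> bigO n g.
Proof.
  intros E (K & d & P & Q & H). exists K, d. split; [exact P |]. split; [exact Q |].
  intros z Hz. rewrite <- E; [now apply H | unfold inU; lra].
Qed.

Lemma bigO_Cderiv (f : C -> C) (l : C) : Cderiv f 0 l -> bigO 0 f.
Proof.
  intros H. destruct (Cderiv_continuous _ _ _ H (mkposreal 1 Rlt_0_1)) as [d Hd]. simpl in Hd.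
  assert (H0 := Cmod_ge_0 (f 0)). assert (Hp := cond_pos d).
  exists (1 + Cmod (f 0))%R, (Rmin d 1). assert (M1 := Rmin_l d 1). assert (M2 := Rmin_r d 1).
  split; [lra |]. split; [split; [apply Rmin_pos |]; lra |].
  intros z Hz. simpl. assert (H1 := Hd z). replace (z - 0) with z in H1 by ring.
  generalize (Cmod_triangle (f z - f 0) (f 0)). replace (f z - f 0 + f 0) with (f z) by ring.
  specialize (H1 ltac:(lra)). lra.
Qed.

Lemma bigO_Cderiv_0 (f : C -> C) (l : C) : f 0 = 0 -> Cderiv f 0 l -> bigO 1 f.
Proof.
  intros E H. destruct (proj1 (Cderiv_eps _ _ _) H (mkposreal 1 Rlt_0_1)) as [d Hd]. simpl in Hd.
  assert (H0 := Cmod_ge_0 l). assert (Hp := cond_pos d).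
  exists (1 + Cmod l)%R, (Rmin d 1). assert (M1 := Rmin_l d 1). assert (M2 := Rmin_r d 1).
  split; [lra |]. split; [split; [apply Rmin_pos |]; lra |].
  intros z Hz. simpl. assert (H1 := Hd z). rewrite E in H1. replace (z - 0) with z in H1 by ring.
  specialize (H1 ltac:(lra)).
  generalize (Cmod_triangle (f z - 0 - z * l) (z * l)). replace (f z - 0 - z * l + z * l) with (f z) by ring.
  rewrite Cmod_mult. lra.
Qed.

Lemma bigO_const (c : C) : bigO 0 (fun _ => c).
Proof. exact (bigO_Cderiv _ _ (Cderiv_const c 0)). Qed.

Lemma bigO_scal (n : nat) (c : C) (f : C -> C) : bigO n f -> bigO n (fun z => c * f z).
Proof. intros H. exact (bigO_mult 0 n _ _ (bigO_const c) H). Qed.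

Lemma bigO_id : bigO 1 (fun z => z).
Proof. exact (bigO_Cderiv_0 _ _ eq_refl (Cderiv_id 0)). Qed.

Lemma bigO_pow (n : nat) (f : C -> C) : bigO 1 f -> bigO n (fun z => f z ^ n).
Proof.
  intros H. induction n as [| n IH]; [exact (bigO_const 1) |].
  exact (bigO_mult 1 n _ _ H IH).
Qed.

Lemma bigO_weaken (m n : nat) (f : C -> C) : (n <= m)%nat -> bigO m f -> bigO n f.
Proof.
  intros Hmn (K & d & P & Q & H). exists K, d. split; [exact P |]. split; [exact Q |].
  intros z Hz. eapply Rle_trans; [now apply H |]. apply Rmult_le_compat_l; [exact P |].
  replace m with (n + (m - n))%nat by lia. rewrite pow_add.
  assert (H0 := Cmod_ge_0 z).
  assert (0 <= Cmod z ^ n)%R by (now apply pow_le).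
  assert (Cmod z ^ (m - n) <= 1)%R by (rewrite <- (pow1 (m - n)); apply pow_incr; lra).
  nra.
Qed.

(** Near 0 one has |m| <= 1/2, so |f| <= |f|/2 + |r| and |f| <= 2 |r|. The order is thus obtained in
    one stroke, not coefficient by coefficient. *)
Lemma bigO_absorb (n : nat) (f m r : C -> C) :
  bigO 1 m -> bigO n r -> (forall z, inU z -> f z = m z * f z + r z) -> bigO n f.
Proof.
  intros (K1 & d1 & P1 & Q1 & H1) (K2 & d2 & P2 & Q2 & H2) E.
  set (d3 := (/ (2 * (K1 + 1)))%R).
  assert (H3 : (0 < d3)%R) by (apply Rinv_0_lt_compat; lra).
  assert (H3' : (K1 * d3 <= 1 / 2)%R).
  { unfold d3. apply Rmult_le_reg_r with (2 * (K1 + 1))%R; [lra |].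
    rewrite Rmult_assoc, Rinv_l by lra. lra. }
  exists (2 * K2)%R, (Rmin (Rmin d1 d2) d3).
  assert (M1 := Rmin_l d1 d2). assert (M2 := Rmin_r d1 d2).
  assert (M3 := Rmin_l (Rmin d1 d2) d3). assert (M4 := Rmin_r (Rmin d1 d2) d3).
  split; [lra |]. split; [split; [repeat apply Rmin_pos |]; lra |].
  intros z Hz. specialize (H1 z ltac:(lra)). specialize (H2 z ltac:(lra)).
  assert (Hf := E z ltac:(unfold inU; lra)).
  assert (Hm : (Cmod (m z) <= 1 / 2)%R).
  { assert (H0 := Cmod_ge_0 z). simpl in H1. nra. }
  assert (Ht := Cmod_triangle (m z * f z) (r z)). rewrite <- Hf, Cmod_mult in Ht.
  assert (H0 := Cmod_ge_0 (f z)). nra.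
Qed.

Lemma PS_taylor4 (a : nat -> C) : conv_U a ->
  exists S : C -> C, (exists l, Cderiv S 0 l) /\ forall z, inU z ->
    PS a z = a 0%nat + a 1%nat * z + a 2%nat * z ^ 2 + a 3%nat * z ^ 3 + z ^ 4 * S z.
Proof.
  intros H0. assert (H1 := conv_U_incr _ H0). assert (H2 := conv_U_incr _ H1).
  assert (H3 := conv_U_incr _ H2). assert (H4 := conv_U_incr _ H3).
  exists (PS (fun n => a (S (S (S (S n)))))). split.
  - eexists. apply Cderiv_PS; [exact H4 | unfold inU; rewrite Cmod_0; lra].
  - intros z Hz. rewrite (PS_incr _ _ H0 Hz), (PS_incr _ _ H1 Hz), (PS_incr _ _ H2 Hz), (PS_incr _ _ H3 Hz).
    simpl. ring.
Qed.

Lemma gregory_taylor5 :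
  exists S : C -> C, (exists l, Cderiv S 0 l) /\ forall z, inU z ->
    PS gregory z = 1 + RtoC (1 / 2) * z - RtoC (1 / 12) * z ^ 2 + RtoC (1 / 24) * z ^ 3
      - RtoC (19 / 720) * z ^ 4 + z ^ 5 * S z.
Proof.
  destruct (PS_taylor4 _ (conv_U_incr _ conv_gregory)) as (S & HS & E).
  exists S. split; [exact HS |]. intros z Hz.
  rewrite (PS_incr _ _ conv_gregory Hz), (E z Hz). unfold gregory.
  rewrite kaluza_1, kaluza_2, kaluza_3, kaluza_4.
  replace ((-1) ^ 0 * kaluza 0)%R with 1%R by (unfold kaluza; simpl; ring).
  replace ((-1) ^ 1 * - (1 / 2))%R with (1 / 2)%R by field.
  replace ((-1) ^ 2 * - (1 / 12))%R with (- (1 / 12))%R by field.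
  replace ((-1) ^ 3 * - (1 / 24))%R with (1 / 24)%R by field.
  replace ((-1) ^ 4 * - (19 / 720))%R with (- (19 / 720))%R by field.
  rewrite !RtoC_opp. simpl. ring.
Qed.

(* The Taylor coefficients of the solution w of Psi(w) = 1 + e1 z + e2 z^2 + ... *)
Definition inv_coef (e1 e2 e3 e4 : C) : C * C * C * C :=
  let d1 := 2 * e1 in
  let d2 := 2 * e2 + RtoC (1 / 6) * d1 ^ 2 in
  let d3 := 2 * e3 + RtoC (1 / 3) * (d1 * d2) - RtoC (1 / 12) * d1 ^ 3 in
  let d4 := 2 * e4 + RtoC (1 / 3) * (d1 * d3) + RtoC (1 / 6) * d2 ^ 2
    - RtoC (1 / 4) * (d1 ^ 2 * d2) + RtoC (19 / 360) * d1 ^ 4 in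
  (d1, d2, d3, d4).

Lemma bigO_0_mult (f g : C -> C) : bigO 0 f -> bigO 0 g -> bigO 0 (fun z => f z * g z).
Proof. exact (bigO_mult 0 0 f g). Qed.

Lemma bigO_opp (n : nat) (f : C -> C) : bigO n f -> bigO n (fun z => - f z).
Proof.
  intros (K & d & P & Q & H). exists K, d. split; [exact P |]. split; [exact Q |].
  intros z Hz. rewrite Cmod_opp. now apply H.
Qed.

Lemma bigO_minus (n : nat) (f g : C -> C) :
  bigO n f -> bigO n g -> bigO n (fun z => f z - g z).
Proof. intros Hf Hg. exact (bigO_plus n f _ Hf (bigO_opp n g Hg)). Qed.

Lemma bigO_0_id : bigO 0 (fun z => z).
Proof. apply bigO_weaken with 1%nat; [lia | exact bigO_id]. Qed.

Ltac bigO_0 :=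
  repeat first [apply bigO_const | apply bigO_0_id | apply bigO_plus | apply bigO_minus
    | apply bigO_opp | apply bigO_0_mult].

(** Both [w] and the candidate polynomial q solve v = 2 (e1 z + ... + e4 z^4) + k2 v^2 - k3 v^3 + k4
    v^4 up to O(z^5). Subtracting gives w - q = m (w - q) + r with m = O(z) and r = O(z^5), ready
    for [bigO_absorb]. *)
Lemma schwarz_taylor4 (w R : C -> C) (e1 e2 e3 e4 d1 d2 d3 d4 lw lR : C) :
  (forall z, inU z -> inU (w z)) -> w 0 = 0 -> Cderiv w 0 lw -> Cderiv R 0 lR ->
  (forall z, inU z -> PS gregory (w z) =
    1 + e1 * z + e2 * z ^ 2 + e3 * z ^ 3 + e4 * z ^ 4 + z ^ 5 * R z) ->
  (d1, d2, d3, d4) = inv_coef e1 e2 e3 e4 ->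
  bigO 5 (fun z => w z - (d1 * z + d2 * z ^ 2 + d3 * z ^ 3 + d4 * z ^ 4)).
Proof.
  intros HU Hw0 Hw HR HE Hd.
  unfold inv_coef in Hd. injection Hd as D1 D2 D3 D4.
  destruct gregory_taylor5 as (T & [lT HT] & ET).
  (* Horner tails of the candidate: q = z p and p = d1 + z t. *)
  set (t := fun z : C => d2 + d3 * z + d4 * (z * z)).
  set (p := fun z : C => d1 + z * t z).
  set (q := fun z : C => z * p z).
  assert (Ot : bigO 0 t) by (unfold t; bigO_0).
  assert (Op : bigO 0 p) by (unfold p; apply bigO_plus; [bigO_0 | exact (bigO_0_mult _ _ bigO_0_id Ot)]).
  assert (Oq : bigO 1 q) by exact (bigO_mult 1 0 _ _ bigO_id Op).
  assert (Ow := bigO_Cderiv_0 _ _ Hw0 Hw).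
  set (k2 := RtoC (1 / 6)) in *. set (k3 := RtoC (1 / 12)) in *. set (k4 := RtoC (19 / 360)) in *.
  (* The cofactor of w - q in k2 (w^2 - q^2) - k3 (w^3 - q^3) + k4 (w^4 - q^4). *)
  set (m := fun z : C => k2 * (w z + q z) - k3 * (w z * w z + w z * q z + q z * q z)
    + k4 * (w z * (w z * w z) + w z * (w z * q z) + w z * (q z * q z) + q z * (q z * q z))).
  (* The part of degree at least 5 of k2 q^2 - k3 q^3 + k4 q^4, divided by z^5; the d_k are chosen
     so that all lower degrees match. *)
  set (X := fun z : C => k2 * (2 * (d1 * d4 + d2 * d3) + (2 * d2 * d4 + d3 * d3) * z
      + 2 * d3 * d4 * (z * z) + d4 * d4 * (z * z * z))
    - k3 * (3 * d1 * d1 * (d3 + d4 * z) + 3 * d1 * (t z * t z) + z * (t z * t z * t z))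
    + k4 * (t z * (p z * p z * p z + p z * p z * d1 + p z * d1 * d1 + d1 * d1 * d1))).
  set (r := fun z : C => z ^ 5 * (2 * R z + X z) - 2 * (w z ^ 5 * T (w z))).
  assert (P11 : forall f g, bigO 1 f -> bigO 1 g -> bigO 1 (fun z => f z * g z)).
  { intros f g Hf Hg. apply bigO_weaken with 2%nat; [lia | exact (bigO_mult 1 1 _ _ Hf Hg)]. }
  assert (Om : bigO 1 m).
  { unfold m. apply bigO_plus; [apply bigO_minus |]; apply bigO_scal;
      repeat first [assumption | apply bigO_plus | apply P11]. }
  assert (OX : bigO 0 X).
  { unfold X. repeat first [assumption | apply bigO_const | apply bigO_0_id | apply bigO_minus
      | apply bigO_plus | apply bigO_0_mult]. }
  assert (Or : bigO 5 r).
  { unfold r. apply bigO_minus.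
    - apply (bigO_mult 5 0 (fun z => z ^ 5)); [exact (bigO_pow 5 _ bigO_id) |].
      apply bigO_plus; [apply bigO_scal; exact (bigO_Cderiv _ _ HR) | exact OX].
    - apply bigO_scal. apply (bigO_mult 5 0 (fun z => w z ^ 5)); [exact (bigO_pow 5 _ Ow) |].
      apply (bigO_Cderiv (fun z => T (w z)) (lw * lT)). apply (Cderiv_comp T w); [now rewrite Hw0 | exact Hw]. }
  apply bigO_ext with (fun z => w z - q z); [intros z _; unfold q, p, t; ring |].
  apply (bigO_absorb 5 _ m r Om Or).
  intros z Hz. assert (E := HE z Hz). rewrite (ET _ (HU z Hz)) in E.
  replace (RtoC (1 / 2)) with (/ 2) in E by (rewrite <- RtoC_inv by lra; f_equal; lra).
  replace (RtoC (1 / 24)) with (k3 / 2) in E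
    by (unfold k3; rewrite <- RtoC_div by lra; f_equal; field).
  replace (RtoC (19 / 720)) with (k4 / 2) in E
    by (unfold k4; rewrite <- RtoC_div by lra; f_equal; field).
  (* The number 1/12 plays two roles: as quadratic coefficient of Psi, up to sign, it is k2/2, while
     k3 is twice the cubic coefficient 1/24. *)
  fold k3 in E. replace (k3 * w z ^ 2) with (k2 / 2 * w z ^ 2) in E
    by (unfold k2, k3; rewrite <- RtoC_div by lra; do 2 f_equal; field).
  replace (RtoC (1 / 3)) with (2 * k2) in D3, D4
    by (unfold k2; rewrite <- RtoC_mult; f_equal; field).
  replace (RtoC (1 / 4)) with (3 * k3) in D4
    by (unfold k3; rewrite <- RtoC_mult; f_equal; field).
  assert (W : w z = 2 * (e1 * z + e2 * z ^ 2 + e3 * z ^ 3 + e4 * z ^ 4 + z ^ 5 * R z)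
     + k2 * w z ^ 2 - k3 * w z ^ 3 + k4 * w z ^ 4 - 2 * (w z ^ 5 * T (w z))).
  { transitivity (2 * ((1 + / 2 * w z - k2 / 2 * w z ^ 2 + k3 / 2 * w z ^ 3 - k4 / 2 * w z ^ 4
      + w z ^ 5 * T (w z)) - 1) + k2 * w z ^ 2 - k3 * w z ^ 3 + k4 * w z ^ 4 - 2 * (w z ^ 5 * T (w z)));
      [field | rewrite E; ring]. }
  assert (Q : q z = 2 * (e1 * z + e2 * z ^ 2 + e3 * z ^ 3 + e4 * z ^ 4)
     + k2 * q z ^ 2 - k3 * q z ^ 3 + k4 * q z ^ 4 - z ^ 5 * X z).
  { replace (2 * (e1 * z + e2 * z ^ 2 + e3 * z ^ 3 + e4 * z ^ 4))
      with (d1 * z + (d2 - k2 * d1 ^ 2) * z ^ 2 + (d3 - 2 * k2 * (d1 * d2) + k3 * d1 ^ 3) * z ^ 3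
        + (d4 - 2 * k2 * (d1 * d3) - k2 * d2 ^ 2 + 3 * k3 * (d1 ^ 2 * d2) - k4 * d1 ^ 4) * z ^ 4).
    - unfold q, X, p, t. ring.
    - rewrite D4, D3, D2, D1. ring. }
  transitivity (2 * (e1 * z + e2 * z ^ 2 + e3 * z ^ 3 + e4 * z ^ 4 + z ^ 5 * R z)
     + k2 * w z ^ 2 - k3 * w z ^ 3 + k4 * w z ^ 4 - 2 * (w z ^ 5 * T (w z))
    - (2 * (e1 * z + e2 * z ^ 2 + e3 * z ^ 3 + e4 * z ^ 4)
     + k2 * q z ^ 2 - k3 * q z ^ 3 + k4 * q z ^ 4 - z ^ 5 * X z)).
  - rewrite <- W, <- Q. reflexivity.
  - unfold m, r. ring.
Qed.

(** * Fourier coefficients of the Schwarz function on circles *)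

(** The second derivative gives the continuity of the first that the circle means need. Omitting the
    origin admits negative powers of z, and the class is closed under sums and products. *)
Definition twice_diff (f : C -> C) : Prop :=
  exists f' : C -> C, forall z : C, z <> 0 -> inU z ->
    Cderiv f z (f' z) /\ exists l, Cderiv f' z l.

Lemma twice_diff_const (c : C) : twice_diff (fun _ => c).
Proof.
  exists (fun _ => 0). intros z _ _. split; [apply Cderiv_const |]. eexists; apply Cderiv_const.
Qed.

Lemma twice_diff_id : twice_diff (fun z => z).
Proof.
  exists (fun _ => 1). intros z _ _. split; [apply Cderiv_id |]. eexists; apply Cderiv_const.
Qed.

Lemma twice_diff_plus (f g : C -> C) : twice_diff f -> twice_diff g -> twice_diff (fun z => f z + g z).
Proof.
  intros [f' Hf] [g' Hg]. exists (fun z => f' z + g' z). intros z H0 Hz.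
  destruct (Hf z H0 Hz) as [F1 [l1 F2]], (Hg z H0 Hz) as [G1 [l2 G2]].
  split; [now apply Cderiv_plus |]. eexists. apply Cderiv_plus; eassumption.
Qed.

Lemma twice_diff_mult (f g : C -> C) : twice_diff f -> twice_diff g -> twice_diff (fun z => f z * g z).
Proof.
  intros [f' Hf] [g' Hg]. exists (fun z => f' z * g z + f z * g' z). intros z H0 Hz.
  destruct (Hf z H0 Hz) as [F1 [l1 F2]], (Hg z H0 Hz) as [G1 [l2 G2]].
  split; [now apply Cderiv_mult |].
  eexists. apply (Cderiv_plus (fun z => f' z * g z) (fun z => f z * g' z)); apply Cderiv_mult; eassumption.
Qed.

Lemma twice_diff_scal (c : C) (f : C -> C) : twice_diff f -> twice_diff (fun z => c * f z).
Proof. intros H. apply twice_diff_mult; [apply twice_diff_const | exact H]. Qed.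

Lemma twice_diff_pow (n : nat) (f : C -> C) : twice_diff f -> twice_diff (fun z => f z ^ n).
Proof.
  intros H. induction n as [| n IH]; [exact (twice_diff_const 1) |].
  exact (twice_diff_mult _ _ H IH).
Qed.

Lemma twice_diff_inv : twice_diff Cinv.
Proof.
  exists (fun z => - / (z * z)). intros z H0 _. split; [now apply Cderiv_Cinv |].
  assert (Hzz : z * z <> 0) by now apply Cmult_neq_0.
  eexists. apply Cderiv_ext_loc with (f := fun y => - (1) * / (y * y)) (d := mkposreal 1 Rlt_0_1).
  - intros y _. ring.
  - apply Cderiv_mult; [apply Cderiv_const |].
    apply (Cderiv_inv (fun y => y * y)); [exact Hzz |]. apply Cderiv_mult; apply Cderiv_id.
Qed.

Lemma twice_diff_circle_mean (F : C -> C) (r : R) :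
  twice_diff F -> bigO 1 F -> (0 < r < 1)%R -> circle_mean (fun t => F (polar r t)) 0.
Proof.
  intros HF (K & d & HK & Hd & HO) Hr.
  assert (HO' : forall z, (Cmod z < d)%R -> (Cmod (F z) <= K * Cmod z)%R).
  { intros z Hz. rewrite <- (pow_1 (Cmod z)). now apply HO. }
  split; simpl; rewrite Rmult_0_r.
  - destruct HF as [F' HF].
    apply (RInt_circle_zero F F' r K d (fun z H0 Hz => proj1 (HF z H0 Hz)) (fun z H0 Hz => proj2 (HF z H0 Hz)) Hr);
      [lra |]. intros z _. apply HO'.
  (* The imaginary part of F is the real part of -iF, so the real statement applies again. *)
  - destruct (twice_diff_scal (- Ci) F HF) as [F' HF'].
    apply is_RInt_ext with (fun t => fst (- Ci * F (polar r t))%C).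
    { intros t _. simpl. ring. }
    apply (RInt_circle_zero (fun z => - Ci * F z) F' r K d (fun z H0 Hz => proj1 (HF' z H0 Hz))
      (fun z H0 Hz => proj2 (HF' z H0 Hz)) Hr); [lra |].
    intros z _ Hz. rewrite Cmod_mult, Cmod_opp, Cmod_Ci, Rmult_1_l. now apply HO'.
Qed.

Lemma polar_pow (r t : R) (n : nat) : polar r t ^ n = RtoC r ^ n * en (Z.of_nat n) t.
Proof. unfold polar. rewrite Cpow_mult_l, circ_pow. reflexivity. Qed.

Lemma en_neq_0 (k : Z) (t : R) : en k t <> 0.
Proof. apply Cmod_gt_0. unfold en. rewrite Cmod_circ. lra. Qed.

Definition trunc4 (d1 d2 d3 d4 : C) (z : C) : C := d1 * z + d2 * z ^ 2 + d3 * z ^ 3 + d4 * z ^ 4.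

(** On the circle of radius r the polynomial part has Fourier coefficients r^k d_k. The remainder
    times z^(-k) is O(z) for k <= 4, so its mean is 0 and it contributes nothing to frequencies up
    to 4. *)
Lemma schwarz_contr4 (w : C -> C) (d1 d2 d3 d4 : C) (r : R) :
  (forall z, inU z -> inU (w z)) -> twice_diff w ->
  bigO 5 (fun z => w z - trunc4 d1 d2 d3 d4 z) -> (0 < r < 1)%R ->
  contr4 (RtoC r * d1) (RtoC r ^ 2 * d2) (RtoC r ^ 3 * d3) (RtoC r ^ 4 * d4).
Proof.
  intros HU Hw HO Hr.
  assert (Hr0 : RtoC r <> 0) by (intros E; apply RtoC_inj in E; lra).
  set (mu := fun k : Z => if Z.eqb (k - 1) 0 then RtoC r * d1 else if Z.eqb (k - 1) 1 then RtoC r ^ 2 * d2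
    else if Z.eqb (k - 1) 2 then RtoC r ^ 3 * d3 else if Z.eqb (k - 1) 3 then RtoC r ^ 4 * d4 else 0).
  apply (bessel_contr4 (fun t => w (polar r t)) mu).
  - intros t. left. apply HU. apply circle_punctured. exact Hr.
  - intros k Hk.
    (* Writing z^(-k) as z^2 (1/z)^j with j = k + 2 keeps both exponents natural for k >= -2. *)
    set (j := Z.to_nat (k + 2)).
    assert (Hj : (j <= 6)%nat) by lia.
    assert (H0 : circle_mean (fun t => (w (polar r t) - trunc4 d1 d2 d3 d4 (polar r t)) * en (- k) t) 0).
    { set (F := fun z => (w z + - (1) * trunc4 d1 d2 d3 d4 z) * (z ^ 2 * (/ z) ^ j)).
      assert (HF : twice_diff F).
      { unfold F, trunc4. apply twice_diff_mult.
        - apply twice_diff_plus; [exact Hw | apply twice_diff_scal].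
          apply twice_diff_plus; [apply twice_diff_plus; [apply twice_diff_plus |] |]; apply twice_diff_scal;
            [apply twice_diff_id | | |]; apply (twice_diff_pow _ (fun z => z)), twice_diff_id.
        - apply twice_diff_mult; [apply (twice_diff_pow _ (fun z => z)), twice_diff_id |
            apply (twice_diff_pow _ Cinv), twice_diff_inv]. }
      assert (HFO : bigO 1 F).
      { destruct HO as (K & d & HK & Hd & HO). exists K, d. split; [exact HK |]. split; [exact Hd |].
        intros z Hz. destruct (Ceq_dec z 0) as [-> | Hz0].
        - unfold F. replace (_ * _) with (RtoC 0) by (simpl; ring).
          rewrite Cmod_0. simpl. lra.
        - assert (Hp := proj1 (Cmod_gt_0 z) Hz0). specialize (HO z Hz).
          unfold F. replace (w z + - (1) * trunc4 d1 d2 d3 d4 z) with (w z - trunc4 d1 d2 d3 d4 z) by ring.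
          rewrite !Cmod_mult, !Cmod_pow, Cmod_inv by exact Hz0.
          (* The worst case is j = 6, that is k = 4, where 5 + 2 - 6 leaves one power of |z|. *)
          apply Rle_trans with (K * Cmod z ^ 5 * (Cmod z ^ 2 * (/ Cmod z) ^ 6))%R.
          + apply Rmult_le_compat; [apply Cmod_ge_0 | | exact HO |].
            * apply Rmult_le_pos; apply pow_le; [lra |]. left. now apply Rinv_0_lt_compat.
            * apply Rmult_le_compat_l; [apply pow_le; lra |].
              apply Rle_pow; [| exact Hj]. rewrite <- Rinv_1. apply Rinv_le_contravar; lra.
          + right. field. lra. }
      assert (H := twice_diff_circle_mean F r HF HFO Hr).
      replace (RtoC 0) with (RtoC r ^ j / RtoC r ^ 2 * 0) by ring.
      eapply circle_mean_ext; [| apply circle_mean_scal, H].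
      intros t. cbv beta. unfold F.
      destruct (circle_punctured r t Hr) as [Hp _].
      rewrite Cpow_inv by exact Hp. rewrite !polar_pow.
      assert (E2 : en (Z.of_nat 2) t = en (- k) t * en (Z.of_nat j) t) by (rewrite en_plus; f_equal; lia).
      rewrite E2. assert (N1 := en_neq_0 (Z.of_nat j) t). assert (N2 := Cpow_nz _ j Hr0).
      field. auto. }
    assert (H1 : circle_mean (fun t => trunc4 d1 d2 d3 d4 (polar r t) * en (- k) t) (mu k)).
    { eapply circle_mean_ext;
        [| exact (circle_mean_trig4_coef (RtoC r * d1) (RtoC r ^ 2 * d2) (RtoC r ^ 3 * d3) (RtoC r ^ 4 * d4) (k - 1))].
      intros t. cbv beta. unfold trunc4. replace (polar r t) with (polar r t ^ 1) at 1 by (simpl; ring).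
      rewrite !polar_pow. unfold trig4.
      replace (en (- (k - 1)) t) with (en 1 t * en (- k) t) by (rewrite en_plus; f_equal; lia).
      replace (en (Z.of_nat 1) t) with (en 0 t * en 1 t) by now rewrite en_plus.
      replace (en (Z.of_nat 2) t) with (en 1 t * en 1 t) by now rewrite en_plus.
      replace (en (Z.of_nat 3) t) with (en 2 t * en 1 t) by now rewrite en_plus.
      replace (en (Z.of_nat 4) t) with (en 3 t * en 1 t) by now rewrite en_plus.
      ring. }
    replace (mu k) with (0 + mu k) by ring.
    eapply circle_mean_ext; [| exact (circle_mean_plus _ _ _ _ H0 H1)].
    intros t. cbv beta. ring.
  - intros k Hk. unfold mu.
    replace (Z.eqb (k - 1) 0) with false by (symmetry; apply Z.eqb_neq; lia).
    replace (Z.eqb (k - 1) 1) with false by (symmetry; apply Z.eqb_neq; lia).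
    replace (Z.eqb (k - 1) 2) with false by (symmetry; apply Z.eqb_neq; lia).
    replace (Z.eqb (k - 1) 3) with false by (symmetry; apply Z.eqb_neq; lia).
    reflexivity.
Qed.

Lemma bernoulli_pow (n : nat) (e : R) : (0 <= e <= 1)%R -> (1 - INR n * e <= (1 - e) ^ n)%R.
Proof.
  intros He. induction n as [| n IH]; [simpl; lra |].
  rewrite S_INR. cbn [pow].
  assert (0 <= INR n)%R by apply pos_INR.
  apply Rle_trans with ((1 - e) * (1 - INR n * e))%R; [nra |].
  apply Rmult_le_compat_l; lra.
Qed.

(** The limit r -> 1 made explicit: if x > 1, Bernoulli's inequality at r = 1 - e, with e so small
    that n e x < (x - 1)/2, gives r^n x > 1. *)
Lemma le_1_of_dilations (n : nat) (x : R) :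
  (forall r, (0 < r < 1)%R -> (r ^ n * x <= 1)%R) -> (x <= 1)%R.
Proof.
  intros H. destruct (Rle_lt_dec x 1) as [Hx | Hx]; [exact Hx | exfalso].
  assert (Hn := pos_INR n).
  set (e := ((x - 1) / (2 * (INR n + 1) * x))%R).
  assert (Hden : (0 < 2 * (INR n + 1) * x)%R) by (repeat apply Rmult_lt_0_compat; lra).
  assert (He : (0 < e)%R) by (apply Rdiv_lt_0_compat; lra).
  assert (He' : (e * (2 * (INR n + 1) * x) = x - 1)%R) by (unfold e; field; lra).
  assert (He1 : (e < 1)%R) by nra.
  specialize (H (1 - e)%R ltac:(lra)).
  assert (Hb := bernoulli_pow n e ltac:(lra)). nra.
Qed.

(** Contractivity is known only for the dilated coefficients r^k d_k with r < 1. The polynomial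
    expressing 2 e_n in the d_k is homogeneous of weight n, so dilation multiplies it by r^n, and r
    tends to 1. *)
Lemma schwarz_inv_coef_bounds (w R : C -> C) (e1 e2 e3 e4 lR : C) :
  (forall z, inU z -> inU (w z)) -> w 0 = 0 -> (exists l, Cderiv w 0 l) -> twice_diff w ->
  Cderiv R 0 lR ->
  (forall z, inU z -> PS gregory (w z) =
    1 + e1 * z + e2 * z ^ 2 + e3 * z ^ 3 + e4 * z ^ 4 + z ^ 5 * R z) ->
  (2 * Cmod e1 <= 1 /\ 2 * Cmod e2 <= 1 /\ 2 * Cmod e3 <= 1 /\ 2 * Cmod e4 <= 1)%R.
Proof.
  intros HU Hw0 [lw Hw] Hw2 HR HE.
  destruct (inv_coef e1 e2 e3 e4) as [[[d1 d2] d3] d4] eqn:Hd.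
  assert (HO := schwarz_taylor4 w R e1 e2 e3 e4 d1 d2 d3 d4 lw lR HU Hw0 Hw HR HE (eq_sym Hd)).
  assert (HC := fun r => schwarz_contr4 w d1 d2 d3 d4 r HU Hw2 HO).
  unfold inv_coef in Hd. injection Hd as D1 D2 D3 D4.
  assert (Hmod : forall r n e, (0 < r < 1)%R -> Cmod (RtoC r ^ n * (2 * e)) = (r ^ n * (2 * Cmod e))%R).
  { intros r n e Hr. rewrite !Cmod_mult, Cmod_pow, !Cmod_R, !Rabs_right by lra. reflexivity. }
  repeat split.
  - apply (le_1_of_dilations 1). intros r Hr. rewrite <- Hmod by exact Hr.
    eapply Rle_trans; [| exact (schwarz_coef_1 _ _ _ _ (HC r Hr))]. right. apply (f_equal Cmod).
    rewrite <- D1.  ring.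
  - apply (le_1_of_dilations 2). intros r Hr. rewrite <- Hmod by exact Hr.
    eapply Rle_trans; [| exact (schwarz_coef_2 _ _ _ _ (HC r Hr))]. right. apply (f_equal Cmod).
    rewrite <- D2, <- D1. ring.
  - apply (le_1_of_dilations 3). intros r Hr. rewrite <- Hmod by exact Hr.
    eapply Rle_trans; [| exact (schwarz_coef_3 _ _ _ _ (HC r Hr))]. right. apply (f_equal Cmod).
    rewrite <- D3, <- D2, <- D1. ring.
  - apply (le_1_of_dilations 4). intros r Hr. rewrite <- Hmod by exact Hr.
    eapply Rle_trans; [| exact (schwarz_coef_4 _ _ _ _ (HC r Hr))]. right. apply (f_equal Cmod).
    rewrite <- D4, <- D3, <- D2, <- D1. ring.
Qed.

(** * From logarithmic coefficients to the Schwarz function *)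

Lemma inU_open (z : C) : inU z -> exists d : posreal, forall y, (Cmod (y - z) < d)%R -> inU y.
Proof.
  unfold inU. intros Hz. assert (Hd : (0 < 1 - Cmod z)%R) by lra.
  exists (mkposreal _ Hd). simpl. intros y Hy.
  generalize (Cmod_triangle (y - z) z). replace (y - z + z) with y by ring. lra.
Qed.

(** Logarithmic differentiation of f = z e^g gives z f'/f = 1 + z g' away from 0. At 0 both sides
    equal 1, since w(0) = 0 and Psi(0) = 1. *)
Lemma Psi_eq_log_deriv (f f' w : C -> C) (b : nat -> C) :
  conv_U b -> (forall z, inU z -> z * Cexp (PS b z) = f z) ->
  (forall z, inU z -> Cderiv f z (f' z)) -> w 0 = 0 -> (forall z, inU z -> inU (w z)) ->
  (forall z, inU z -> starlike_quot f f' z = Psi (w z)) ->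
  forall z, inU z -> PS gregory (w z) = 1 + z * PS (dPS b) z.
Proof.
  intros Hb Hf Hf' Hw0 HU HS z Hz.
  destruct (Ceq_dec z 0) as [-> | Hz0].
  - rewrite Hw0, (PS_0 _ conv_gregory), gregory_0. ring.
  - rewrite <- Psi_PS by now apply HU. rewrite <- HS by exact Hz.
    unfold starlike_quot. rewrite zero_test by exact Hz0.
    assert (E : f' z = 1 * Cexp (PS b z) + z * (PS (dPS b) z * Cexp (PS b z))).
    { apply (Cderiv_unique f z); [now apply Hf' |].
      destruct (inU_open z Hz) as [d Hd].
      apply (Cderiv_ext_loc (fun y => y * Cexp (PS b y)) f z _ d).
      - intros y Hy. apply Hf, Hd, Hy.
      - apply (Cderiv_mult (fun y => y) (fun y => Cexp (PS b y))); [apply Cderiv_id |].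
        apply (Cderiv_comp Cexp (PS b)); [apply Cderiv_Cexp | now apply Cderiv_PS]. }
    rewrite E, <- Hf by exact Hz. assert (He := Cexp_neq_0 (PS b z)). field. auto.
Qed.

(* Since Psi' does not vanish, w' = P' / Psi'(w) is itself differentiable: this replaces
   Goursat's theorem for w. *)
Lemma twice_diff_schwarz (w : C -> C) (b : nat -> C) :
  conv_U b -> analytic_on_U w -> (forall z, inU z -> inU (w z)) ->
  (forall z, inU z -> PS gregory (w z) = 1 + z * PS b z) -> twice_diff w.
Proof.
  intros Hb Hw HU HE.
  assert (Hb' := conv_U_dPS _ Hb). assert (Hg' := conv_U_dPS _ conv_gregory).
  exists (fun z => (PS b z + z * PS (dPS b) z) * / PS (dPS gregory) (w z)).
  intros z _ Hz. destruct (Hw z Hz) as [l Hl].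
  assert (Hn := PS_dgregory_neq_0 (w z) (HU z Hz)).
  split.
  - replace (_ * / _) with l; [exact Hl |].
    assert (H1 := Cderiv_comp (PS gregory) w z _ l (Cderiv_PS _ _ conv_gregory (HU z Hz)) Hl).
    assert (H2 : Cderiv (fun y => PS gregory (w y)) z (0 + (1 * PS b z + z * PS (dPS b) z))).
    { destruct (inU_open z Hz) as [d Hd].
      apply (Cderiv_ext_loc (fun y => 1 + y * PS b y) _ z _ d).
      - intros y Hy. symmetry. apply HE, Hd, Hy.
      - apply (Cderiv_plus (fun _ => 1) (fun y => y * PS b y)); [apply Cderiv_const |].
        apply (Cderiv_mult (fun y => y)); [apply Cderiv_id | now apply Cderiv_PS]. }
    assert (H := Cderiv_unique _ _ _ _ H1 H2).
    replace (PS b z + z * PS (dPS b) z) with (l * PS (dPS gregory) (w z)) by (rewrite H; ring).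
    field. exact Hn.
  - eexists. apply (Cderiv_mult (fun y => PS b y + y * PS (dPS b) y) (fun y => / PS (dPS gregory) (w y))).
    + apply (Cderiv_plus (PS b) (fun y => y * PS (dPS b) y)); [now apply Cderiv_PS |].
      apply (Cderiv_mult (fun y => y)); [apply Cderiv_id | now apply Cderiv_PS].
    + apply (Cderiv_inv (fun y => PS (dPS gregory) (w y))); [exact Hn |].
      apply (Cderiv_comp (PS (dPS gregory)) w); [apply Cderiv_PS; [exact Hg' | now apply HU] | exact Hl].
Qed.

Lemma log_coeffs_bound (f : C -> C) (beta : nat -> C) :
  in_SGstar f -> log_coeffs f beta ->
  forall n : nat, (1 <= n <= 4)%nat -> (Cmod (beta n) <= 1 / (4 * INR n))%R.
Proof.
  intros [_ (f' & Hf' & w & Hw & Hw0 & HU & HS)] [_ (g & _ & _ & Hexp & Hser)] n Hn.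
  (* These are the coefficients of log(f(z)/z), so [dPS b (n - 1)] = 2 n beta_n is the coefficient
     of z^n in P, and twice its modulus is 4 n |beta_n|. *)
  set (b := fun k => 2 * beta k).
  assert (Hser' : forall z, inU z -> is_Cseries (fun k => b k * z ^ k) (g z)).
  { intros z Hz. apply is_pseries_C, Hser, Hz. }
  assert (Hb := conv_U_of_pseries b g Hser').
  assert (HE := Psi_eq_log_deriv f f' w b Hb).
  assert (HE' : forall z, inU z -> PS gregory (w z) = 1 + z * PS (dPS b) z).
  { apply HE; auto. intros z Hz. rewrite <- Hexp by exact Hz. do 2 f_equal.
    apply is_Cseries_unique. now apply Hser'. }
  assert (Hb' := conv_U_dPS _ Hb).
  assert (Hw2 := twice_diff_schwarz w (dPS b) Hb' Hw HU HE').
  destruct (PS_taylor4 _ Hb') as (R & [lR HR] & ER).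
  destruct (schwarz_inv_coef_bounds w R (dPS b 0) (dPS b 1) (dPS b 2) (dPS b 3) lR HU Hw0) as (B1 & B2 & B3 & B4);
    auto.
  - apply Hw. unfold inU. rewrite Cmod_0. lra.
  - intros z Hz. rewrite HE', ER by exact Hz. ring.
  - assert (HB : (2 * Cmod (dPS b (n - 1)) <= 1)%R).
    { assert (Hc : (n = 1 \/ n = 2 \/ n = 3 \/ n = 4)%nat) by lia.
      destruct Hc as [-> | [-> | [-> | ->]]]; assumption. }
    unfold dPS, b in HB. replace (S (n - 1)) with n in HB by lia.
    assert (Hp : (0 < INR n)%R) by (apply lt_0_INR; lia).
    rewrite !Cmod_mult, !Cmod_R, !Rabs_right in HB by lra.
    apply Rmult_le_reg_r with (4 * INR n)%R; [lra |].
    replace (1 / (4 * INR n) * (4 * INR n))%R with 1%R by (field; lra). lra.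
Qed.

Theorem theorem3 :
  (forall (f : C -> C) (beta : nat -> C),
      in_SGstar f -> log_coeffs f beta ->
      forall n : nat, (1 <= n <= 4)%nat ->
        (Cmod (beta n) <= 1 / (4 * INR n))%R) /\
  (forall n : nat, (1 <= n <= 4)%nat ->
      exists (f : C -> C) (beta : nat -> C),
        in_SGstar f /\ log_coeffs f beta /\
        Cmod (beta n) = (1 / (4 * INR n))%R).
Proof.
  split; [exact log_coeffs_bound |].
  intros n [Hn _]. exists (extremal n), (fun m => ext_coef n m / 2).
  split; [now apply extremal_in_SGstar |].
  split; [now apply extremal_log_coeffs | now apply extremal_sharp].
Qed.
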